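(* Let $M$ be an odd-dimensional closed manifold and let $f: M \to M$ be a $C^2$ Anosov diffeomorphism. Then $f$ preserves no contact structure on $M$; that is, there is no contact structure $\xi \subset TM$ on $M$ with $Df(\xi(x)) = \xi(f(x))$ for all $x \in M$.
   Context: A closed manifold is a (nonempty) smooth compact manifold without boundary. A diffeomorphism $f$ of $M$ is Anosov if there are a continuous $Df$-invariant splitting $TM = E^s \oplus E^u$, a continuous Riemannian metric on $M$ with induced norm $\|\cdot\|$, and a constant $0<\lambda<1$ such that $\|Df|_{E^s}\| \le \lambda$ and $\|Df^{-1}|_{E^u}\| \le \lambda$ at every point. (Equivalently, for some, hence any, Riemannian metric there are $C>0$ and $0<\lambda<1$ with $\|Df^n|_{E^s}\| \le C\lambda^n$ and $\|Df^{-n}|_{E^u}\| \le C\lambda^n$ for all $n \ge 0$.) A contact structure on $M$ with $\dim M = 2m+1$ is a smooth hyperplane field $\xi \subset TM$ which is locally the kernel of a smooth 1-form $\alpha$ with $\alpha \wedge (d\alpha)^m$ nowhere zero. It is not assumed to be coorientable: $\xi$ is globally defined by a pair of 1-forms $\{\alpha,-\alpha\}$, well defined up to sign. *)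

(* Defs.v *)
From HB Require Import structures.
From mathcomp Require Import all_boot all_order all_fingroup all_algebra.
From mathcomp Require Import all_classical all_reals all_analysis.

Set Implicit Arguments.
Unset Strict Implicit.
Unset Printing Implicit Defensive.

Import Order.TTheory GRing.Theory Num.Theory.
Import numFieldNormedType.Exports.

Local Open Scope classical_set_scope.
Local Open Scope ring_scope.

(* [C_on k U f]: f is of class C^k on the open set U. In finite dimension all
   directional derivatives being C^k is the same as all partial derivatives
   of order at most k+1 being continuous. *)
Fixpoint C_on (R : realType) (V W : normedModType R) (k : nat) (U : set V)
    (f : V -> W) : Prop :=
  match k with
  | 0 => forall x, U x -> {for x, continuous f}
  | k'.+1 => (forall x, U x -> differentiable f x) /\
             (forall v : V, C_on k' U (fun x => 'D_v f x))
  end.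

Definition smooth_on (R : realType) (V W : normedModType R) (U : set V)
    (f : V -> W) : Prop :=
  forall k, C_on k U f.

(* The inverse of a chart is a total function, meaningful only on the image of
   the chart domain. *)
Record smooth_atlas (R : realType) (n : nat) (M : topologicalType) :=
  SmoothAtlas {
  chart_index : Type;
  chart_dom : chart_index -> set M;
  chart : chart_index -> M -> 'rV[R]_n;
  chart_inv : chart_index -> 'rV[R]_n -> M;
  dom_cover : forall x, exists i, chart_dom i x;
  dom_open : forall i, open (chart_dom i);
  codom_open : forall i, open (chart i @` chart_dom i);
  chartK : forall i x, chart_dom i x -> chart_inv i (chart i x) = x;
  chart_continuous : forall i x, chart_dom i x -> {for x, continuous (chart i)};
  chart_inv_continuous : forall i y, (chart i @` chart_dom i) y ->
    {for y, continuous (chart_inv i)};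
  chart_smooth : forall i j,
    smooth_on (chart i @` (chart_dom i `&` chart_dom j)) (chart j \o chart_inv i)
}.

(* Smooth manifold without boundary: the atlas is modelled on open subsets of
   R^n. Second countability follows from compactness. *)
Definition closed_manifold (R : realType) (n : nat) (M : topologicalType)
    (A : smooth_atlas R n M) : Prop :=
  [/\ [set: M] !=set0, compact [set: M] & hausdorff_space M].

Section Manifold.
Variables (R : realType) (n : nat) (M : topologicalType).
Variable A : smooth_atlas R n M.

Local Notation V := 'rV[R]_n.

(* The tangent space at x is R^n, each tangent vector being represented by its
   coordinates in the chosen chart [chart_at x] around x. As [chart_at x] jumps
   with x, continuity and smoothness of tangent objects are always expressed
   in a fixed chart i, using the change of coordinates [tcoord i x] from
   [chart_at x] to i and its inverse [tvec i x]. *)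
Definition chart_at (x : M) : chart_index A := projT1 (cid (dom_cover A x)).

Definition tcoord (i : chart_index A) (x : M) : V -> V :=
  'd (chart i \o chart_inv (chart_at x)) (chart (chart_at x) x).

Definition tvec (i : chart_index A) (x : M) : V -> V :=
  'd (chart (chart_at x) \o chart_inv i) (chart i x).

Definition C_map (k : nat) (f : M -> M) : Prop :=
  continuous f /\
  forall i j, C_on k (chart (s := A) i @` (chart_dom i `&` f @^-1` chart_dom j))
                     (chart (s := A) j \o f \o chart_inv i).

Record diffeo (k : nat) := Diffeo {
  diffeo_fun :> M -> M;
  diffeo_inv : M -> M;
  diffeoK : cancel diffeo_fun diffeo_inv;
  diffeo_invK : cancel diffeo_inv diffeo_fun;
  diffeo_C : C_map k diffeo_fun;
  diffeo_inv_C : C_map k diffeo_inv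
}.

(* Differential of f at x, from the tangent space at x to the one at f x. *)
Definition tmap (f : M -> M) (x : M) : V -> V :=
  'd (chart (chart_at (f x)) \o f \o chart_inv (chart_at x))
     (chart (chart_at x) x).

Definition subspace_field := M -> {vspace V}.

Definition preserves (f : M -> M) (E : subspace_field) : Prop :=
  forall x, (linfun (tmap f x) @: E x)%VS = E (f x).

(* Near every point E is spanned by a continuous frame; its rank is thus
   locally constant. *)
Definition continuous_subspace_field (E : subspace_field) : Prop :=
  forall x0 : M, exists (i : chart_index A) (r : nat) (e : 'I_r -> M -> V),
    \forall x \near x0,
      [/\ chart_dom i x,
          basis_of (linfun (tcoord i x) @: E x)%VS [seq e k x | k <- enum 'I_r]
        & forall k, {for x, continuous (e k)}].

Record continuous_metric := ContinuousMetric {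
  metric_form :> M -> {dot V for @idfun R};
  metric_continuous : forall (i : chart_index A) (u v : V) (x : M), chart_dom i x ->
    {for x, continuous (fun y => metric_form y (tvec i y u) (tvec i y v) : R)}
}.

Definition tnorm (g : continuous_metric) (x : M) (v : V) : R :=
  Num.sqrt (g x v v).

Definition Anosov (k : nat) (f : diffeo k) : Prop :=
  exists (Es Eu : subspace_field) (g : continuous_metric) (lambda : R),
    [/\ continuous_subspace_field Es /\ continuous_subspace_field Eu,
        forall x, (Es x + Eu x)%VS = fullv /\ directv (Es x + Eu x),
        preserves f Es /\ preserves f Eu,
        0 < lambda < 1
      & (forall x v, v \in Es x ->
           tnorm g (f x) (tmap f x v) <= lambda * tnorm g x v) /\
        (forall x v, v \in Eu x ->
           tnorm g (diffeo_inv f x) (tmap (diffeo_inv f) x v) <= lambda * tnorm g x v)].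

End Manifold.

Section Forms.
Variables (R : realType) (n : nat).

Local Notation V := 'rV[R]_n.

(* Alternating multilinear k-forms on R^n, and differential k-forms, as bare
   functions: the operations below are only used on genuine forms. *)
Definition kform (k : nat) := ('I_k -> V) -> R.
Definition diff_form (k : nat) := V -> kform k.

Definition wedge (k l : nat) (a : kform k) (b : kform l) : kform (k + l) :=
  fun v => (k`! * l`!)%:R^-1 *
    \sum_(s : 'S_(k + l)) (-1) ^+ s *
      a (fun i => v (s (lshift l i))) * b (fun j => v (s (rshift k j))).

Fixpoint wedge_pow (b : kform 2) (m : nat) : kform m.*2 :=
  match m with
  | 0 => fun _ => 1
  | m'.+1 => wedge b (@wedge_pow b m')
  end.

Definition extd (k : nat) (w : diff_form k) : diff_form k.+1 :=
  fun y v => \sum_(i < k.+1)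
    (-1) ^+ i * 'D_(v i) (fun z => w z (fun j => v (lift i j)) : R^o) y.

(* A 1-kform a_1 dx_1 + ... + a_n dx_n is given by the column of the a_i. *)
Definition pairing (v : V) (a : 'cV[R]_n) : R := (v *m a) ord0 ord0.

Definition one_form (a : V -> 'cV[R]_n) : diff_form 1 :=
  fun y v => pairing (v ord0) (a y).

End Forms.

Section Contact.
Variables (R : realType) (m : nat) (M : topologicalType).
Variable A : smooth_atlas R m.*2.+1 M.

Local Notation V := 'rV[R]_(m.*2.+1).

(* xi is a hyperplane field which, near every point, is the kernel of a smooth
   1-kform alpha, written in some chart i on an open set O of coordinates, with
   alpha /\ (d alpha)^m nowhere zero. Smoothness of xi is part of this. *)
Definition contact_structure (xi : subspace_field R m.*2.+1 M) : Prop :=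
  (forall x, \dim (xi x) = m.*2) /\
  forall x0 : M, exists (i : chart_index A) (O : set V) (alpha : V -> 'cV[R]_(m.*2.+1)),
    [/\ chart_dom i x0 /\ O (chart i x0),
        open O /\ O `<=` chart i @` chart_dom i,
        smooth_on O alpha,
        forall y, O y -> exists v : 'I_(1 + m.*2) -> V,
          wedge (one_form alpha y) (wedge_pow (m := m) (extd (one_form alpha) y)) v != 0
      & forall x, chart_dom i x -> O (chart i x) -> forall v : V,
          v \in xi x <-> pairing (tcoord i x v) (alpha (chart i x)) = 0].

End Contact.

(* Main.v *)
(* Write f^*alpha = h alpha, so that f^*(d alpha) = h d alpha on xi and the
   Jacobian of f is |h|^(m+1). Since dim Es + dim Eu = 2m+1, one of the two is
   at most m at a given point; exchanging f and its inverse, let the set N of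
   points with dim Eu <= m be nonempty. It is open, closed and invariant.
   If Es(x) were contained in xi(x) for some x in N, then Eu would be uniformly
   transversal to xi along the orbit of x, so the factor of f^n would be bounded
   below by c lambda^(-n) there; as d alpha (Df^n v, Df^n w) tends to 0 for v, w in
   Es(x), Es(x) would be isotropic in the symplectic space xi(x), so
   dim Es <= m, which is absurd. Hence Es is transversal to xi on N, by
   compactness uniformly so, and the factor of f^n on N is at most C lambda^n.
   Thus f^n contracts volume on N as strongly as we like, whereas f^n(N) = N has
   positive volume. Volume is replaced by sums of s^(2m+1) over finite covers by
   coordinate cubes of radius s; a lattice point count bounds them from below. *)

(* The exponent m+1 comes from matrices: bordering d alpha by alpha gives an invertible matrix of
   size 2m+2, which f pulls back, up to unipotent factors, to h times itself; so (det Df)^2 and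
   h^(2m+2) agree up to bounded factors. Pulling back d alpha means differentiating f^*alpha = h
   alpha, and the second derivatives of f cancel by symmetry; this is where C^2 enters. A global
   alpha need not exist: finitely many compact coordinate cubes carry their own forms, h depends on
   the cubes chosen at both ends, and only |h| is estimated. Eu is uniformly transversal to xi where
   Es lies in xi, because that set is closed and Es + Eu, being everything, cannot lie in xi. The
   end works because of the order of the constants: changes of chart, pivoting and cubes cost
   factors that depend on the dimension and on the finite family of pieces, never on n. So n is
   fixed after them, to make the Jacobian small enough to beat them all, and the scale of the cubes
   after n, to make f^n nearly linear on each. *)
Require Import Defs.
From mathcomp Require Import all_boot all_order all_fingroup all_algebra.
From mathcomp Require Import all_classical all_reals all_analysis.
From mathcomp Require Import ring lra zify.

Set Implicit Arguments.
Unset Strict Implicit.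
Unset Printing Implicit Defensive.

Import Order.TTheory GRing.Theory Num.Theory.
Import numFieldNormedType.Exports.

Local Open Scope classical_set_scope.
Local Open Scope ring_scope.

(** * Linear algebra *)

(* A substitute for the singular value decomposition: complete pivoting keeps
   the entries of both outer factors bounded. *)
Lemma pivot_factorization (R : realFieldType) d (L : 'M[R]_d) :
  exists (A : 'M[R]_d) (D : 'rV[R]_d) (B : 'M[R]_d),
    [/\ L = A *m diag_mx D *m B, forall i j, `|A i j| <= 1,
        forall i j, `|B i j| <= 1 & `|\prod_i D 0 i| = `|\det L| ].
Proof.
elim: d L => [|d IH] L.
  exists 0, 0, 0; split; try by case.
    by apply/matrixP; case.
  by rewrite big_ord0 det_mx00.
have [->|L0] := eqVneq L 0.
  exists 0, 0, 0; split; try by move=> i j; rewrite mxE normr0.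
    by rewrite mulmx0.
  by rewrite det0 big_ord_recl mxE mul0r.
pose ij := [arg max_(ij > (@ord0 d, @ord0 d)) `|L ij.1 ij.2|]%O.
have ijP k l : `|L k l| <= `|L ij.1 ij.2|.
  by rewrite /ij; case: arg_maxP => //= p _ /(_ (k, l)) /=; exact.
pose M : 'M[R]_(1 + d) := xrow ij.1 ord0 (xcol ij.2 ord0 L).
pose p := L ij.1 ij.2.
have p0 : p != 0.
  apply: contra L0 => /eqP p0; apply/eqP/matrixP => k l; rewrite mxE.
  by apply/eqP; rewrite -normr_le0 (le_trans (ijP k l))// -/p p0 normr0.
have Mp k l : `|M k l| <= `|p| by rewrite !mxE ijP.
have Mul : ulsubmx M = p%:M.
  by rewrite [LHS]mx11_scalar !mxE !lshift0 !tpermR.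
(* Schur complement of the pivot: one elimination on each side splits [M] into [p] and [S], and the
   factorization of [S] goes into the lower right blocks. *)
pose S := drsubmx M - p^-1 *: (dlsubmx M *m ursubmx M).
have [A [D [B [SE A1 B1 DE]]]] := IH S.
pose A' : 'M[R]_(1 + d) := block_mx 1%:M 0 (p^-1 *: dlsubmx M) A.
pose D' : 'rV[R]_(1 + d) := row_mx p%:M D.
pose B' : 'M[R]_(1 + d) := block_mx 1%:M (p^-1 *: ursubmx M) 0 B.
have le1 x k l : x = M k l -> `|p^-1 * x| <= 1.
  by move=> ->; rewrite normrM normfV ler_pdivrMl ?normr_gt0// mulr1.
have A'1 i j : `|A' i j| <= 1.
  rewrite /A'; case: (split_ordP i) => [{}i ->|{}i ->];
    case: (split_ordP j) => [{}j ->|{}j ->].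
  - by rewrite block_mxEul !mxE; case: eqP; rewrite ?normr1 ?normr0.
  - by rewrite block_mxEur mxE normr0.
  - by rewrite block_mxEdl mxE; apply: le1; rewrite !mxE.
  - by rewrite block_mxEdr.
have B'1 i j : `|B' i j| <= 1.
  rewrite /B'; case: (split_ordP i) => [{}i ->|{}i ->];
    case: (split_ordP j) => [{}j ->|{}j ->].
  - by rewrite block_mxEul !mxE; case: eqP; rewrite ?normr1 ?normr0.
  - by rewrite block_mxEur mxE; apply: le1; rewrite !mxE.
  - by rewrite block_mxEdl mxE normr0.
  - by rewrite block_mxEdr.
have ME : M = A' *m diag_mx D' *m B'.
  rewrite /A' /B' /D' diag_mx_row mulmx_block !mulmx0 !mul0mx !mul1mx !addr0 !add0r.
  rewrite mulmx_block !mulmx0 !mul0mx !mulmx1 !addr0 -SE.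
  have -> : diag_mx (p%:M : 'rV[R]_1) = p%:M.
    by rewrite [LHS]mx11_scalar !mxE eqxx mulr1n.
  rewrite !mul_mx_scalar !mul_scalar_mx !scalerA mulfV// !scale1r.
  by rewrite -scalemxAr addrC subrK -Mul submxK.
have detM : \det M = p * \det S.
  have -> : M = block_mx 1%:M 0 (p^-1 *: dlsubmx M) 1%:M *m
                block_mx p%:M (ursubmx M) 0 S.
    rewrite mulmx_block !mul0mx !mul1mx !addr0 -scalemxAl mul_mx_scalar.
    by rewrite scalerA mulVf// scale1r -scalemxAl addrC subrK -Mul submxK.
  by rewrite det_mulmx det_lblock det_ublock !det1 !mul1r det_scalar1.
have detLM : `|\det L| = `|\det M|.
  rewrite /M xrowE xcolE !det_mulmx !det_perm !normrM !normrX !normrN1 !expr1n.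
  by rewrite mul1r mulr1.
exists (xrow ij.1 ord0 A'), D', (xcol ij.2 ord0 B'); split.
- have -> : L = xrow ij.1 ord0 (xcol ij.2 ord0 M).
    by rewrite /M; apply/matrixP => k l; rewrite !mxE !tpermK.
  by rewrite ME !xrowE !xcolE !mulmxA.
- by move=> k l; rewrite mxE.
- by move=> k l; rewrite mxE.
- rewrite detLM detM !normrM -DE -normrM; congr `| _ |.
  rewrite [LHS](@big_ord_recl _ _ _ d) -/(lshift _ _); congr (_ * _).
    have -> : ord0 = lshift d (ord0 : 'I_1) :> 'I_(1 + d) by apply/val_inj.
    by rewrite [LHS]row_mxEl !mxE eqxx.
  apply: eq_bigr => i _.
  have -> : lift ord0 i = rshift 1 i by apply/val_inj.
  exact: row_mxEr.
Qed.

(* If A is the matrix of d alpha and a that of alpha, in dimension 2m+1, the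
   determinant is a nonzero constant times the square of the coefficient of
   alpha /\ (d alpha)^m. *)
Definition bordered (R : pzRingType) d (a : 'cV[R]_d) (A : 'M[R]_d) : 'M[R]_(1 + d) :=
  block_mx 0 a^T (- a) A.

(* The terms in b stand for dh /\ alpha in f^*(d alpha) = h d alpha + dh /\ alpha;
   a row and a column operation with the border remove them. *)
Lemma det_bordered_pullback (R : fieldType) d (L A A' : 'M[R]_d) (a a' b : 'cV[R]_d)
    (h : R) : h != 0 -> L *m a' = h *: a ->
  L *m A' *m L^T = h *: A + (b *m a^T - a *m b^T) ->
  \det L ^+ 2 * \det (bordered a' A') = h ^+ d.+1 * \det (bordered a A).
Proof.
move=> h0 La LA.
pose P : 'M[R]_(1 + d) := block_mx 1%:M 0 0 L.
pose Q : 'M[R]_(1 + d) := block_mx 1%:M 0 (h^-1 *: b) 1%:M.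
have PE : P *m bordered a' A' *m P^T = Q *m (h *: bordered a A) *m Q^T.
  rewrite /P /Q /bordered !tr_block_mx !trmx1 !trmx0 scale_block_mx !mulmx_block.
  rewrite ?(mul0mx, mulmx0, mul1mx, mulmx1, addr0, add0r, scaler0).
  have aL : a'^T *m L^T = h *: a^T by rewrite -trmx_mul La linearZ.
  congr block_mx.
  - by rewrite aL.
  - by rewrite mulmxN La scalerN.
  - have -> : h *: - a *m (h^-1 *: b)^T = - (a *m b^T).
      by rewrite linearZ /= -scalemxAl -scalemxAr scalerA divff// scale1r mulNmx.
    have -> : h^-1 *: b *m (h *: a^T) = b *m a^T.
      by rewrite -scalemxAl -scalemxAr scalerA mulVf// scale1r.
    by rewrite LA addrCA addrA [_ - _]addrC addrCA addrC.
have dP : \det P = \det L by rewrite det_lblock det1 mul1r.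
have dQ : \det Q = 1 by rewrite det_lblock !det1 mulr1.
have := congr1 (@determinant _ _) PE.
by rewrite !det_mulmx !det_tr dP dQ mul1r mulr1 detZ => <-; ring.
Qed.

Lemma bordered_neq0 (R : fieldType) n (a : 'cV[R]_n) (B : 'M[R]_n) : \det (bordered a B) != 0 -> a != 0.
Proof.
apply: contra_neq => ->; apply/eqP/det0P; exists (row_mx 1%:M 0).
  apply/eqP => /rowP/(_ (lshift _ 0)); rewrite row_mxEl !mxE/=.
  by move/eqP; rewrite oner_eq0.
by rewrite /bordered mul_row_block !(trmx0, oppr0, mulmx0, mul0mx, addr0) row_mx0.
Qed.

(** Adding the border direction to the rows of [X] gives r+1 independent vectors, isotropic for a
    nondegenerate bordered form in dimension d+1; hence 2(r+1) <= d+1. For d = 2m+1 this means r <=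
    m. *)
Lemma isotropic_rank (R : fieldType) d r (X : 'M[R]_(r, d)) (a : 'cV[R]_d) (A : 'M[R]_d) :
  \det (bordered a A) != 0 -> row_free X -> X *m a = 0 -> X *m A *m X^T = 0 ->
  (r.*2 < d)%N.
Proof.
move=> dA rX Xa XA.
pose Y : 'M[R]_(1 + r, 1 + d) := block_mx 1%:M 0 0 X.
have Y0 : Y *m bordered a A *m Y^T = 0.
  rewrite /Y /bordered !tr_block_mx !trmx1 !trmx0 !mulmx_block.
  rewrite ?(mul0mx, mulmx0, mul1mx, mulmx1, addr0, add0r, scaler0).
  by rewrite mulmxN Xa oppr0 XA -trmx_mul Xa trmx0 block_mx0.
have rY : \rank Y = r.+1.
  by rewrite rank_diag_block_mx mxrank1 (eqP (rX : _ == _)).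
have := mulmx0_rank_max Y0.
rewrite mxrankMfree ?row_free_unit ?unitmxE ?unitfE//.
rewrite mxrank_tr rY; lia.
Qed.

(** * Exterior algebra *)

Section Multilinear.
Variables (R : realType) (n : nat).
Local Notation V := 'rV[R]_n.

Definition upd k (v : 'I_k -> V) (i : 'I_k) (x : V) : 'I_k -> V :=
  fun j => if j == i then x else v j.

Definition multilinear_form k (F : kform R n k) :=
  forall v i c x y, F (upd v i (c *: x + y)) = c * F (upd v i x) + F (upd v i y).

Lemma multilinear_sum k (F : kform R n k) (v : 'I_k -> V) i p
    (c : 'I_p -> R) (e : 'I_p -> V) : multilinear_form F ->
  F (upd v i (\sum_j c j *: e j)) = \sum_j c j * F (upd v i (e j)).
Proof.
move=> mF.
have F0 : F (upd v i 0) = 0.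
  by have := mF v i (-1) 0 0; rewrite scaler0 addr0 mulN1r addrC subrr.
pose G x := F (upd v i x).
apply: (big_ind2 (fun x y => F (upd v i x) = y)) => //.
  by move=> x1 y1 x2 y2 <- <-; have := mF v i 1 x1 x2; rewrite scale1r mul1r.
by move=> j _; have := mF v i (c j) (e j) 0; rewrite addr0 F0 addr0.
Qed.

(** The arguments are expanded along [e] one at a time; in the induction, [t] counts the leading
    arguments not yet known to belong to [e]. *)
Lemma multilinear_eq0 k (F : kform R n k) p (e : 'I_p -> V) :
  multilinear_form F -> (forall v, exists c, v = \sum_j c j *: e j) ->
  (forall phi, F (e \o phi) = 0) -> forall v, F v = 0.
Proof.
move=> mF span F0 v.
suff H t (w : 'I_k -> V) : (forall j : 'I_k, (t <= j)%N -> exists i, w j = e i) -> F w = 0.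
  by apply: (H k) => j; rewrite leqNgt ltn_ord.
elim: t w => [|t IH] w wP.
  have /fin_all_exists [phi phiP] : forall j, exists i, w j = e i by move=> j; apply: wP.
  by rewrite (_ : w = e \o phi)//; apply/funext => j; rewrite /= phiP.
have [tk|kt] := ltnP t k; last first.
  by apply: IH => j tj; have := leq_trans (ltn_ord j) (leq_trans kt tj); rewrite ltnn.
have [c wc] := span (w (Ordinal tk)).
have -> : w = upd w (Ordinal tk) (\sum_j c j *: e j).
  by apply/funext => j; rewrite /upd; case: eqP => // ->.
rewrite multilinear_sum// big1// => i _; rewrite IH ?mulr0// => j tj.
rewrite /upd; case: eqP => [_|jt]; first by exists i.
by apply: wP; rewrite ltn_neqAle tj andbT; apply/eqP => tj'; apply: jt; apply/val_inj.
Qed.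

Lemma multilinear_perm k (F : kform R n k) (s : {perm 'I_k}) :
  multilinear_form F -> multilinear_form (fun v => F (v \o s)).
Proof.
move=> mF v i c x y.
have E z : upd v i z \o s = upd (v \o s) ((s^-1)%g i) z.
  apply/funext => j; rewrite /upd /=; congr (if _ then _ else _).
  by apply/eqP/eqP => [<-|->]; rewrite ?permK ?permKV.
by rewrite !E mF.
Qed.

Lemma multilinear_tensor k l (a : kform R n k) (b : kform R n l) :
  multilinear_form a -> multilinear_form b ->
  multilinear_form (fun v : 'I_(k + l) -> V =>
    a (fun i => v (lshift l i)) * b (fun j => v (rshift k j))).
Proof.
move=> ma mb v i c x y; case: (split_ordP i) => {}i ->.
- have E z : (fun j => upd v (lshift l i) z (lshift l j)) =
             upd (fun j => v (lshift l j)) i z.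
    by apply/funext => j; rewrite /upd (inj_eq (@lshift_inj _ _)).
  have E' z : (fun j => upd v (lshift l i) z (rshift k j)) = fun j => v (rshift k j).
    by apply/funext => j; rewrite /upd eq_rlshift.
  by rewrite !E !E' ma; ring.
- have E z : (fun j => upd v (rshift k i) z (rshift k j)) =
             upd (fun j => v (rshift k j)) i z.
    by apply/funext => j; rewrite /upd (inj_eq (@rshift_inj _ _)).
  have E' z : (fun j => upd v (rshift k i) z (lshift l j)) = fun j => v (lshift l j).
    by apply/funext => j; rewrite /upd eq_lrshift.
  by rewrite !E !E' mb; ring.
Qed.

Lemma multilinear_wedge k l (a : kform R n k) (b : kform R n l) :
  multilinear_form a -> multilinear_form b -> multilinear_form (wedge a b).
Proof.
move=> ma mb v i c x y; rewrite /wedge mulrCA -mulrDr [X in _ = _ * (X + _)]mulr_sumr -big_split/=.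
congr (_ * _); apply: eq_bigr => s _.
have := multilinear_perm s (multilinear_tensor ma mb) v i c x y => /= E.
by rewrite -!mulrA E mulrDr mulrCA.
Qed.

Lemma wedge_perm k l (a : kform R n k) (b : kform R n l) (t : 'S_(k + l)) v :
  wedge a b (v \o t) = (-1) ^+ t * wedge a b v.
Proof.
rewrite /wedge mulrCA; congr (_ * _); rewrite [RHS]mulr_sumr.
rewrite [RHS](reindex_inj (mulIg t)) /=; apply: eq_bigr => s _.
have E p : v ((s * t)%g p) = (v \o t) (s p) by rewrite /= permM.
rewrite odd_permM signr_addb -!mulrA [X in _ = _ * X]mulrCA signrMK.
congr (_ * (a _ * b _));
  by apply/funext => p /=; rewrite permM.
Qed.

Lemma wedge_repeat k l (a : kform R n k) (b : kform R n l) v (i j : 'I_(k + l)) :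
  i != j -> v i = v j -> wedge a b v = 0.
Proof.
move=> ij vij; have := wedge_perm a b (tperm i j) v.
have -> : v \o tperm i j = v.
  by apply/funext => p /=; case: tpermP => [->|->|].
by rewrite odd_tperm ij expr1 mulN1r; lra.
Qed.

Definition bilinear_kform (B : 'M[R]_n) : kform R n 2 :=
  fun v => (v ord0 *m B *m (v (lift ord0 ord0))^T) 0 0.

Lemma multilinear_bilinear_kform B : multilinear_form (bilinear_kform B).
Proof.
move=> v i c x y; rewrite /bilinear_kform /upd.
have [->|i1] : i = ord0 \/ i = lift ord0 ord0.
  case: i => [[|[]]] // Hi; [left|right]; exact/val_inj.
  by rewrite /= !mulmxDl -!scalemxAl !mxE.
by rewrite i1 /= linearP /= mulmxDr -scalemxAr !mxE.
Qed.

Lemma multilinear_wedge_pow (b : kform R n 2) m :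
  multilinear_form b -> multilinear_form (wedge_pow b (m := m)).
Proof. by move=> mb; elim: m => [v []//|m IH]; exact: (@multilinear_wedge 2 m.*2 _ _ mb IH). Qed.

(** In each term of the wedge product some factor [b] receives [u], and that factor vanishes. [K]
    records where the other arguments live: in [contact_bordered] it is the kernel of the 1-form,
    the place where [b] is known to vanish against [u]. *)
Lemma wedge_pow_eq0 (b : kform R n 2) (K : V -> Prop) (u : V) m :
  (forall w, (exists i, w i = u) -> (forall i, K (w i)) -> b w = 0) ->
  forall w : 'I_(m.*2) -> V, (exists i, w i = u) -> (forall i, K (w i)) ->
  wedge_pow b w = 0.
Proof.
move=> b0; elim: m => [w [[]]//|m IH w [i wi] wK].
rewrite [LHS]/= /wedge big1 ?mulr0// => s _.
case: (split_ordP ((s^-1)%g i : 'I_(2 + m.*2))) => j /(canRL (permKV s)) ij.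
  by rewrite [b _]b0 ?(mulr0, mul0r)//; exists j; rewrite -ij.
by rewrite [wedge_pow _ _]IH ?(mulr0, mul0r)//; exists j; rewrite -ij.
Qed.

(** A vector outside the kernel of [a] comes first, then [u], then a complement of [u] in that
    kernel. On such a basis the 1-form sees only the first vector, which makes the wedge product in
    [contact_bordered] computable. *)
Lemma adapted_basis d (a : 'cV[R]_n) (u : V) : d.+1 = n -> a != 0 -> u != 0 ->
  u *m a = 0 ->
  exists X : n.-tuple V, [/\ <<X>>%VS = fullv, X`_1 = u, (1 < n)%N &
    forall i, (0 < i)%N -> X`_i *m a = 0].
Proof.
move=> dn a0 u0 ua.
pose K := lker (linfun (mulmxr a : V -> 'rV[R]_1)).
have KP v : (v \in K) = (v *m a == 0) by rewrite memv_ker lfunE.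
have [e0 e0K] : exists e0, e0 \notin K.
  have [i ai] : exists i, a i 0 != 0.
    apply/existsP; apply: contraR a0; rewrite negb_exists => /forallP ai.
    by apply/eqP/colP => i; rewrite mxE; apply/eqP; rewrite -[_ == _]negbK.
  exists (delta_mx 0 i); rewrite KP -rowE; apply: contra ai => /eqP/rowP/(_ 0).
  by rewrite !mxE => ->.
have dimV : \dim (fullv : {vspace V}) = n by rewrite dimvf /dim /= mul1n.
have dKd : (d <= \dim K)%N.
  have := limg_ker_dim (linfun (mulmxr a : V -> 'rV[R]_1)) fullv.
  rewrite capfv dimV; have := dimvS (subvf (limg (linfun (mulmxr a : V -> 'rV[R]_1)))).
  rewrite [\dim {:'rV_1}]dimvf /dim /= -/K; lia.
have e00 : e0 != 0 by apply: contraNneq e0K => ->; rewrite mem0v.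
have disj : (<[e0]> :&: K = 0)%VS.
  apply/eqP; rewrite -subv0; apply/subvP => v; rewrite memv_cap => /andP[/vlineP[k ->]].
  by have [->|k0] := eqVneq k 0; rewrite ?scale0r ?mem0v// rpredZeq (negPf k0) (negPf e0K).
have dsum := dimv_disjoint_sum disj; rewrite dim_vline e00 in dsum.
have dKn : \dim K = d.
  have := dimvS (subvf (<[e0]> + K)); rewrite dsum dimV; lia.
have full : (<[e0]> + K)%VS = fullv.
  by apply/eqP; rewrite eqEdim subvf dsum dimV; lia.
have capu : (K :&: <[u]> = <[u]>)%VS.
  by apply/capv_idPr; rewrite -memvE KP ua.
have := dimv_cap_compl K <[u]>; rewrite capu dim_vline u0 dKn => dc.
have sz : size (e0 :: u :: vbasis (K :\: <[u]>)) == n.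
  by rewrite /= size_tuple; apply/eqP; lia.
exists (Tuple sz); split => //=.
- rewrite !span_cons (span_basis (vbasisP _)) -full; congr (_ + _)%VS.
  by rewrite -{1}capu addvC addv_diff_cap.
- lia.
- case=> [//|[|i]] _ /=; first by rewrite ua.
  have [il|il] := ltnP i (size (vbasis (K :\: <[u]>))); last first.
    by rewrite nth_default// mul0mx.
  apply/eqP; rewrite -KP.
  have /vbasis_mem : (vbasis (K :\: <[u]>))`_i \in vbasis (K :\: <[u]>) by rewrite mem_nth.
  by apply: subvP; rewrite diffvSl.
Qed.

End Multilinear.

(** A null vector (t, u) of the bordered matrix has u in the kernel of alpha and u A = - t a^T, so u
    lies in the radical of d alpha restricted to that kernel. Every term of the wedge product then
    vanishes on a basis adapted to u. *)
Lemma contact_bordered (R : realType) m (a : 'cV[R]_(m.*2.+1)) (A : 'M[R]_(m.*2.+1)) :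
  (exists v : 'I_(1 + m.*2) -> 'rV[R]_(m.*2.+1),
    wedge (fun w => pairing (w ord0) a) (wedge_pow (m := m) (bilinear_kform A)) v != 0) ->
  A^T = - A ->
  \det (bordered a A) != 0.
Proof.
move=> [v /negP Wv] AT; apply/negP => /det0P [x x0 xB]; apply: Wv; apply/eqP.
rewrite -[x]hsubmxK in xB x0; move: xB; set t := lsubmx x; set u := rsubmx x => xB.
have [a0|a0] := eqVneq a 0.
  rewrite /wedge big1 ?mulr0// => s _; rewrite a0 /pairing mulmx0 mxE.
  by rewrite mulr0 mul0r.
move: xB; rewrite /bordered mul_row_block mulmx0 add0r.
rewrite -[0 in X in X -> _]row_mx0 => /eq_row_mx [ua uA].
have {}ua : u *m a = 0 by apply/eqP; rewrite -oppr_eq0 -mulmxN ua.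
have u0 : u != 0.
  apply: contraNneq x0 => u0; rewrite -/t -/u u0.
  move: uA; rewrite u0 mul0mx addr0 (mx11_scalar t) mul_scalar_mx => /eqP.
  rewrite scaler_eq0 trmx_eq0 (negPf a0) orbF => /eqP ->.
  by rewrite raddf0 row_mx0.
have uAw w : w *m a = 0 -> u *m A *m w^T = 0.
  move=> wa; have -> : u *m A = - (t *m a^T) by apply/eqP; rewrite eq_sym -subr_eq0 -opprD oppr_eq0 uA.
  by rewrite mulNmx -mulmxA -trmx_mul wa trmx0 mulmx0 oppr0.
have [X [Xspan X1 n1 Xker]] := adapted_basis (erefl _) a0 u0 ua.
have null (w : 'I_2 -> _) : (exists i, w i = u) -> (forall i, w i *m a = 0) -> bilinear_kform A w = 0.
  move=> [i wi] wa; rewrite /bilinear_kform.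
  have [i0|i1] : i = ord0 \/ i = lift ord0 ord0.
    case: (i) => [[|[]]] // Hi; [left|right]; exact/val_inj.
    by rewrite -i0 wi uAw ?mxE.
  have -> : w ord0 *m A *m (w (lift ord0 ord0))^T = - (u *m A *m (w ord0)^T)^T.
    by rewrite -i1 wi !trmx_mul trmxK AT mulNmx mulmxN opprK mulmxA.
  by rewrite uAw// trmx0 oppr0 mxE.
pose e (j : 'I_(m.*2.+1)) := X`_j.
apply: (@multilinear_eq0 _ _ _ _ _ e).
- apply: multilinear_wedge; last exact/multilinear_wedge_pow/multilinear_bilinear_kform.
  by move=> w i c x' y; rewrite /upd !ord1 /= /pairing mulmxDl -scalemxAl !mxE.
- move=> w; exists (fun j => coord X j w); apply: coord_span; rewrite Xspan; exact: memvf.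
move=> phi; have [inj|] := boolP (injectiveb phi); last first.
  move=> /injectivePn [i [j ij pij]].
  by apply: (@wedge_repeat _ _ _ _ _ _ _ i j ij); rewrite /= pij.
rewrite /wedge big1 ?mulr0// => s _.
(* Only terms giving the first basis vector to the 1-form survive; [u], the basis vector of index 1,
   is then among the arguments of the power of d alpha. *)
have [ps0|ps0] := eqVneq (phi (s (lshift _ ord0))) ord0; last first.
  rewrite /pairing /= Xker ?lt0n//; first by rewrite mxE mulr0 mul0r.
have bij : bijective (phi \o s) by apply: injF_bij; exact: inj_comp (injectiveP _ inj) perm_inj.
have [psi psiK Kpsi] := bij.
rewrite [wedge_pow _ _](@wedge_pow_eq0 _ _ _ (fun w => w *m a = 0) u) ?mulr0//.
- case: (split_ordP (psi (Ordinal n1))) => j jE.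
    by have := Kpsi (Ordinal n1); rewrite jE ord1 /= ps0.
  by exists j; rewrite -jE /=; have := Kpsi (Ordinal n1); rewrite /= => ->.
- move=> j; rewrite /= Xker// lt0n; apply/negP => /eqP pj0.
  have pj : phi (s (rshift 1 j)) = ord0 by exact: val_inj.
  have := bij_inj bij (etrans pj (esym ps0)).
  by move/eqP; rewrite eq_rlshift.
Qed.

(** * Covering by cubes *)

Section Covering.
Variable R : realType.

Lemma rV_norm_leP n (v : 'rV[R]_n) s : 0 <= s ->
  `|v| <= s <-> forall j, `|v 0 j| <= s.
Proof.
move=> s0; rewrite [`|v|]mx_normrE; split.
  by move=> /bigmax_leP [_ H] j; exact: (H (0, j)).
by move=> H; apply: bigmax_le => // -[i j] _ /=; rewrite ord1.
Qed.

Lemma rV_coord_le n (v : 'rV[R]_n) j : `|v 0 j| <= `|v|.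
Proof. exact: (iffLR (rV_norm_leP v (normr_ge0 v))). Qed.

Lemma norm_mulmx_le n p (v : 'rV[R]_n) (B : 'M[R]_(n, p)) c s :
  0 <= c -> (forall i j, `|B i j| <= c) -> `|v| <= s -> `|v *m B| <= n%:R * c * s.
Proof.
move=> c0 Bc vs; have s0 : 0 <= s := le_trans (normr_ge0 _) vs.
apply/rV_norm_leP => [|j]; first by rewrite !mulr_ge0.
rewrite mxE (le_trans (ler_norm_sum _ _ _))//.
apply: le_trans (_ : \sum_(k < n) c * s <= _).
  apply: ler_sum => k _; rewrite normrM mulrC ler_pM//.
  by rewrite (le_trans (rV_coord_le _ _)).
by rewrite sumr_const card_ord -mulrA mulr_natl.
Qed.

Lemma interval_grid (T : nat) (sigma x : R) : (0 < T)%N -> 0 < sigma ->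
  `|x| <= T%:R * sigma ->
  exists k : 'I_T, `|x - (2 * k%:R + 1 - T%:R) * sigma| <= sigma.
Proof.
move=> T0 s0; rewrite ler_norml => /andP[xl xu].
pose q := (x + T%:R * sigma) / (2 * sigma).
have s20 : 0 < 2 * sigma by lra.
have q0 : 0 <= q by rewrite divr_ge0//; lra.
have xq : x = 2 * sigma * q - T%:R * sigma by rewrite /q mulrC divfK ?gt_eqF//; ring.
have qT : q <= T%:R by rewrite ler_pdivrMr//; lra.
have /andP[kl ku] := truncn_itv q0; set k := Num.truncn q in kl ku.
have [kT|Tk] := ltnP k T.
  exists (Ordinal kT) => /=; rewrite ler_norml xq; rewrite -natr1 in ku.
  by apply/andP; split; nra.
(* At the right end x = T sigma the quotient is T itself, one past the last cell; the last cell is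
   used instead. *)
have TE : q = T%:R by apply/le_anti; rewrite qT (le_trans _ kl)// ler_nat.
have T1 : (T.-1 < T)%N by rewrite prednK.
exists (Ordinal T1) => /=.
have -> : (T.-1)%:R = T%:R - 1 :> R by rewrite -subn1 natrB.
rewrite xq TE (_ : _ - _ = sigma) ?gtr0_norm//; ring.
Qed.

(** Centre of the cell [t] when the box around 0 with half-sides [T i * sigma] is cut into cubes of
    half-side [sigma]. *)
Definition grid_point n (T : 'I_n -> nat) (sigma : R)
    (t : {dffun forall i, 'I_(T i)}) : 'rV[R]_n :=
  \row_i ((2 * (t i)%:R + 1 - (T i)%:R) * sigma).

Lemma box_grid n (T : 'I_n -> nat) (sigma : R) (w : 'rV[R]_n) :
  (forall i, 0 < T i)%N -> 0 < sigma ->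
  (forall i, `|w 0 i| <= (T i)%:R * sigma) ->
  exists t : {dffun forall i, 'I_(T i)}, `|w - grid_point sigma t| <= sigma.
Proof.
move=> T0 s0 wT.
have H i : exists k : 'I_(T i), `|w 0 i - (2 * k%:R + 1 - (T i)%:R) * sigma| <= sigma.
  exact: interval_grid.
exists [ffun i => projT1 (cid (H i))]; apply/rV_norm_leP => [|i]; first exact: ltW.
by rewrite !mxE ffunE; exact: projT2 (cid (H i)).
Qed.

Lemma card_grid n (T : 'I_n -> nat) :
  #|{dffun forall i, 'I_(T i)}| = (\prod_i T i)%N.
Proof.
rewrite card_dep_ffun foldrE big_map enumT.
by apply: eq_bigr => i _; rewrite card_ord.
Qed.

(** The product is a polynomial in tau, hence continuous at 0. The slack pays, in
    [linear_image_cover], for rounding the sides of a box up to whole cubes. *)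
Lemma prod_add_lt n (b : 'I_n -> R) (delta : R) : (forall i, 0 <= b i) ->
  \prod_i b i < delta -> exists2 tau, 0 < tau & \prod_i (b i + tau) < delta.
Proof.
move=> b0 bd.
pose p : {poly R} := \prod_i ((b i)%:P + 'X).
have pE t : p.[t] = \prod_i (b i + t).
  by rewrite horner_prod; apply: eq_bigr => i _; rewrite hornerD hornerC hornerX.
have p0 : p.[0] < delta by rewrite pE; under eq_bigr do rewrite addr0.
have pc := cvg_at_right_filter (@continuous_horner R p 0).
near (0 : R)^'+ => t; exists t => //; rewrite -pE.
by near: t; exact: cvgr_lt pc _ p0.
Unshelve. all: by end_near. Qed.

(** Write d for the dimension and L = A D B. A cube of radius s goes under A into one of radius d s,
    then under D into a box with half-sides b_i s, which is filled by cubes of radius tau s; B sends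
    each into a cube of radius d tau s, and e adds tau s. So A costs a factor d, and B and e
    together cost d + 1, whatever L is. Flat directions of D do no harm, as each side is rounded up
    to a whole number of cubes. The error e makes room for a nonlinear remainder. *)
Lemma linear_image_cover n (L : 'M[R]_n.+1) (delta : R) : `|\det L| < delta ->
  exists2 eta, 0 < eta & forall s, 0 < s ->
  exists (l : seq 'rV[R]_n.+1) sigma,
    [/\ 0 < sigma,
        forall v e : 'rV[R]_n.+1, `|v| <= s -> `|e| <= eta * s ->
          exists2 c, c \in l & `|v *m L + e - c| <= sigma
      & (size l)%:R * sigma ^+ n.+1 <= (n.+2 * n.+1)%:R ^+ n.+1 * delta * s ^+ n.+1].
Proof.
move=> Ld; have [A [D [B [LE A1 B1 DE]]]] := pivot_factorization L.
set d := n.+1 in L Ld A D B LE A1 B1 DE *.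
pose b i := d%:R * `|D 0 i|.
have b0 i : 0 <= b i by rewrite mulr_ge0.
have bd : \prod_i b i < d%:R ^+ d * delta.
  rewrite big_split /= prodr_const card_ord -normr_prod DE ltr_pM2l//.
  by rewrite exprn_gt0// ltr0n.
have [tau tau0 btau] := prod_add_lt b0 bd.
exists tau => // s s0.
pose sg := tau * s; have sg0 : 0 < sg by rewrite mulr_gt0.
pose T i := (Num.truncn (b i / tau)).+1.
have T1 i : b i * s <= (T i)%:R * sg.
  have /andP[_ /ltW] := truncn_itv (divr_ge0 (b0 i) (ltW tau0)).
  by rewrite /sg mulrA ler_pM2r// ler_pdivrMr.
have T2 i : (T i)%:R * sg <= (b i + tau) * s.
  have /andP[+ _] := truncn_itv (divr_ge0 (b0 i) (ltW tau0)).
  by rewrite /sg mulrA ler_pM2r// /T -natr1 mulrDl mul1r lerD2r ler_pdivlMr.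
exists [seq grid_point sg t *m B | t <- enum {: {dffun forall i, 'I_(T i)}}].
exists (d.+1%:R * sg); split.
- by rewrite mulr_gt0// ltr0n.
- move=> v e vs es.
  have [i|t tP] := @box_grid d T sg (v *m A *m diag_mx D) (fun=> isT) sg0.
    rewrite mul_mx_diag mxE normrM (le_trans _ (T1 i))// /b mulrAC ler_wpM2r//.
    have := norm_mulmx_le ler01 A1 vs; rewrite mulr1; apply: le_trans.
    exact: rV_coord_le.
  exists (grid_point sg t *m B).
    by apply/mapP; exists t => //; rewrite mem_enum.
  rewrite LE !mulmxA addrAC -mulmxBl -natr1 mulrDl mul1r.
  rewrite (le_trans (ler_normD _ _))// lerD//.
  by have := norm_mulmx_le ler01 B1 tP; rewrite mulr1.
- rewrite size_map -cardE card_grid [(_ * sg) ^+ d]exprMn mulrCA natrM [(_%:R * _%:R) ^+ _]exprMn -!mulrA.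
  rewrite ler_pM2l ?exprn_gt0 ?ltr0n//.
  have -> : (\prod_i T i)%:R * sg ^+ d = \prod_i ((T i)%:R * sg).
    by rewrite big_split/= prodr_const card_ord natr_prod.
  apply: le_trans (_ : \prod_i ((b i + tau) * s) <= _).
    by apply: ler_prod => i _; rewrite T2 mulr_ge0// ltW.
  rewrite [leLHS]big_split/= prodr_const card_ord mulrA ler_pM2r ?exprn_gt0//.
  exact: ltW.
Qed.

Lemma card_ord_interval N (P : pred 'I_N) (x : R) : 0 <= x ->
  (forall i j, P i -> P j -> (j : nat)%:R <= (i : nat)%:R + x) -> (#|P|)%:R <= x + 1.
Proof.
move=> x0 H; have [k Pk|] := pickP P; last first.
  by move=> /eq_card0 ->; apply: addr_ge0.
pose i0 := [arg min_(i < k | P i) (i : nat)].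
have [Pi0 imin] : P i0 /\ forall j, P j -> (i0 <= j)%N by rewrite /i0; case: arg_minnP.
have /andP[_ xK] := truncn_itv x0.
pose K := (Num.truncn x).+1.
have PK j : P j -> (i0 <= j < i0 + K)%N.
  move=> Pj; rewrite imin//= -(ltr_nat R) natrD.
  by apply: le_lt_trans (H _ _ Pi0 Pj) _; rewrite ltrD2l.
have : (#|P| <= K)%N.
  rewrite cardE -(size_map val) -[K](size_iota i0); apply: uniq_leq_size.
    by rewrite map_inj_uniq ?enum_uniq//; exact: val_inj.
  by move=> _ /mapP[j + ->]; rewrite mem_enum mem_iota => /PK.
rewrite -(ler_nat R) => /le_trans; apply; rewrite /K -natr1 lerD2r.
by have /andP[] := truncn_itv x0.
Qed.

(** N^n points of mesh r / N are placed in a corner of the cube. A cube of radius s holds at most 2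
    s N / r + 1 of them per direction, hence at most 3 s N / r once N s >= r, which the choice of N
    ensures for all of [l]. The powers of N cancel. *)
Lemma cube_cover_lower_bound n r (y : 'rV[R]_n) (l : seq ('rV[R]_n * R)) : 0 < r ->
  (forall b, b \in l -> 0 < b.2) ->
  (forall w, `|w - y| <= r -> exists2 b, b \in l & `|w - b.1| <= b.2) ->
  r ^+ n <= 3 ^+ n * \sum_(b <- l) b.2 ^+ n.
Proof.
move=> r0 l0 lc.
pose N := (\max_(b <- l) (Num.truncn (r / b.2)).+1).+1.
have N0 : 0 < N%:R :> R by rewrite ltr0n.
have NP b : b \in l -> r <= N%:R * b.2.
  move=> bl; rewrite -ler_pdivrMr ?l0//.
  have /andP[_ /ltW] := truncn_itv (divr_ge0 (ltW r0) (ltW (l0 _ bl))).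
  move=> /le_trans; apply; rewrite ler_nat /N leqW//.
  exact: (leq_bigmax_seq b bl isT).
pose w (t : {ffun 'I_n -> 'I_N}) : 'rV[R]_n := y + \row_i (r / N%:R * (t i : nat)%:R).
have wy t : `|w t - y| <= r.
  rewrite /w addrC addKr; apply/rV_norm_leP => [|i]; first exact: ltW.
  rewrite mxE ger0_norm ?mulr_ge0 ?invr_ge0 ?(ltW r0)//.
  by rewrite mulrAC ler_pdivrMr// ler_pM2l// ler_nat ltnW.
pose P (b : 'rV[R]_n * R) t := `|w t - b.1| <= b.2.
have cardP b : b \in l -> (#|P b|)%:R <= (3 * b.2 * N%:R / r) ^+ n.
  move=> bl; have b0 := l0 _ bl.
  pose Q i := [pred k : 'I_N | `|y 0 i + r / N%:R * (k : nat)%:R - b.1 0 i| <= b.2].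
  have : (#|P b| <= #|(family Q : pred _)|)%N.
    apply/subset_leq_card/fintype.subsetP => t; rewrite !inE => Pt.
    apply/familyP => i; rewrite inE.
    by have := iffLR (rV_norm_leP _ (ltW b0)) Pt i; rewrite /w !mxE.
  rewrite -(ler_nat R) => /le_trans; apply.
  rewrite card_family foldrE big_map enumT natr_prod.
  set C := 3 * b.2 * N%:R / r.
  have -> : C ^+ n = \prod_(i < n) C by rewrite prodr_const card_ord.
  apply: ler_prod => i _; rewrite ler0n/=.
  have x0 : 0 <= 2 * b.2 * N%:R / r.
    by rewrite divr_ge0 ?mulr_ge0 ?(ltW r0) ?(ltW b0).
  have := @card_ord_interval N (Q i) _ x0 => /(_ _)/le_trans; apply.
    move=> j k /=; rewrite ?inE !ler_norml => /andP[j1 j2] /andP[k1 k2].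
    rewrite -(ler_pM2l (divr_gt0 r0 N0)) mulrDr.
    rewrite (_ : r / N%:R * (2 * b.2 * N%:R / r) = 2 * b.2); last first.
      by field; rewrite !gt_eqF.
    lra.
  rewrite /C (_ : 3 * b.2 * N%:R / r = 2 * b.2 * N%:R / r + N%:R * b.2 / r); last first.
    by field; rewrite gt_eqF.
  by rewrite lerD2l ler_pdivlMr// mul1r NP.
have : \sum_(t : {ffun 'I_n -> 'I_N}) 1 <=
       \sum_(t : {ffun 'I_n -> 'I_N}) \sum_(b <- l) (P b t)%:R :> R.
  apply: ler_sum => t _; have [b bl bt] := lc _ (wy t).
  rewrite (big_rem b)//= /P bt -[X in X <= _]addr0 lerD2l.
  by apply: sumr_ge0 => ? _; rewrite ler0n.
rewrite exchange_big/= sumr_const card_ffun !card_ord natrX.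
move=> /le_trans => /(_ (\sum_(b <- l) (3 * b.2 * N%:R / r) ^+ n)) H.
have {H} : N%:R ^+ n <= \sum_(b <- l) (3 * b.2 * N%:R / r) ^+ n.
  apply: H; rewrite big_seq [leRHS]big_seq; apply: ler_sum => b bl.
  rewrite (le_trans _ (cardP _ bl))// -sum1_card natr_sum [leRHS]big_mkcond/=.
  apply: ler_sum => t _; rewrite -topredE /=; by case: (P b t).
have -> : \sum_(b <- l) (3 * b.2 * N%:R / r) ^+ n =
          (3 * N%:R / r) ^+ n * \sum_(b <- l) b.2 ^+ n.
  rewrite mulr_sumr; apply: eq_bigr => b _; rewrite -exprMn.
  by congr (_ ^+ _); ring.
rewrite expr_div_n exprMn mulrAC ler_pdivlMr ?exprn_gt0//.
by rewrite -mulrA mulrCA ler_pM2l ?exprn_gt0.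
Qed.

End Covering.

(** * Calculus *)

Lemma near_eq_diff (R : numFieldType) (V W : normedModType R) (f g : V -> W) (x : V) :
  (\forall y \near x, f y = g y) -> differentiable f x ->
  differentiable g x /\ 'd g x = 'd f x :> (V -> W).
Proof.
move=> fg df.
have E : g \o shift x = cst (g x) + 'd f x +o_ 0 id.
  apply/eqaddoP => e e0.
  have /eqaddoP/(_ e e0) := diff_locally df.
  have : \forall y \near (0 : V), f (y + x) = g (y + x).
    by move: fg; rewrite (near_shift 0 x) subr0.
  apply: filterS2 => y /= fgy.
  by rewrite !fctE /= fgy (nbhs_singleton fg).
have dE := diff_unique (diff_continuous df) E.
split=> //; apply/diff_locallyP; split; rewrite dE//; exact: diff_continuous.
Qed.

Section Calculus.
Variable R : realType.

Lemma mean_value (V' : normedModType R) (g : V' -> R^o) (y : V') r z z' :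
  (forall x, `|x - y| < r -> differentiable g x) ->
  `|z - y| < r -> `|z' - y| < r ->
  exists2 xi, `|xi - y| < r & g z - g z' = 'D_(z - z') g xi.
Proof.
move=> dg zr z'r.
pose l (t : R) : V' := z' + t *: (z - z').
have lr t : 0 <= t <= 1 -> `|l t - y| < r.
  move=> /andP[t0 t1]; have -> : l t - y = t *: (z - y) + (1 - t) *: (z' - y).
    rewrite -(subrKA z' z (- y)) scalerDr scalerBl scale1r -[RHS]addrA.
    by rewrite [t *: (z' - y) + _]addrC subrK [RHS]addrA /l [z' + _]addrC.
  have [->|t1'] := eqVneq t 0; first by rewrite scale0r add0r subr0 scale1r.
  have tp : 0 < t by rewrite lt_neqAle eq_sym t1'.
  rewrite (le_lt_trans (ler_normD _ _))// !normrZ !ger0_norm ?subr_ge0//.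
  have -> : r = t * r + (1 - t) * r by ring.
  by rewrite ltr_leD ?ltr_pM2l// ler_wpM2l ?subr_ge0// ltW.
have dl t : is_diff t l (fun s : R => s *: (z - z')).
  have -> : l = cst z' + ( *:%R^~ (z - z')) by apply/funext.
  apply: (is_diff_eq (is_diffD (is_diff_cst z' t) (is_diff_scalel t (z - z')))).
  by apply/funext => s /=; rewrite fctE add0r.
pose phi := g \o l : R -> R.
have dphi (t : R) : 0 <= t <= 1 -> is_derive t 1 phi ('D_(z - z') g (l t)).
  move=> t01; have dgl := dg _ (lr _ t01).
  have dp : differentiable phi t by apply: differentiable_comp.
  apply: DeriveDef; first exact/derivable1_diffP.
  by rewrite deriveE// diff_comp//= deriveE// diff_val scale1r.
have [t||c c01 cE] := @MVT R phi (fun t => 'D_(z - z') g (l t)) 0 1 ltr01.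
- by rewrite in_itv/= => /andP[t0 t1]; apply: dphi; rewrite !ltW.
- apply: continuous_in_subspaceT => t; rewrite inE/= in_itv/= => t01.
  by apply: differentiable_continuous; apply/derivable1_diffP; case: (dphi t t01).
exists (l c); first by apply: lr; move: c01; rewrite in_itv/= => /andP[? ?]; rewrite !ltW.
by move: cE; rewrite subr0 mulr1 /phi /l /= scale1r scale0r addr0 subrKC.
Qed.

Lemma dist_le_of_close (p q p' q' e : R) : p' = q' -> `|p - p'| < e / 2 ->
  `|q - q'| < e / 2 -> `|q - p| <= e.
Proof. by move=> ->; rewrite !ltr_norml ler_norml => /andP[] ? ? /andP[] ? ?; lra. Qed.

Lemma derive_translate (V' W : normedModType R) (g : V' -> W) (a c x : V') :
  'D_a (fun x => g (x + c)) x = 'D_a g (x + c).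
Proof.
rewrite /derive; congr (lim _); apply: (congr1 (fun F : R -> W => F @ 0^')).
by apply/funext => h; rewrite /= addrA.
Qed.

(** The second difference of g over the parallelogram with sides s u and s v is symmetric in u and
    v. Two uses of the mean value theorem ([key]) write it as s^2 times either mixed derivative at a
    point near y, and these derivatives are continuous. *)
Lemma schwarz (V' : normedModType R) (g : V' -> R^o) (U : set V') (u v y : V') :
  open U -> U y -> C_on 2 U g -> 'D_u ('D_v g) y = 'D_v ('D_u g) y.
Proof.
move=> oU Uy [dg C2g].
have [d1 c1] := C2g u; have [d2 c2] := C2g v.
apply/eqP; rewrite -subr_eq0 -normr_le0; apply/ler_addgt0Pl => e e0; rewrite addr0.
have e20 : 0 < e / 2 by rewrite divr_gt0.
have : \forall z \near y, [/\ U z, `|'D_v ('D_u g) y - 'D_v ('D_u g) z| < e / 2 &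
    `|'D_u ('D_v g) y - 'D_u ('D_v g) z| < e / 2].
  have /cvgrPdist_lt/(_ _ e20) c1v := c1 v _ Uy.
  have /cvgrPdist_lt/(_ _ e20) c2u := c2 u _ Uy.
  have nU : nbhs y U by exact: open_nbhs_nbhs.
  apply: filterS3 nU c1v c2u => z; exact: And3.
move=> /nbhs_ballP[r /= r0 rP].
have {}rP z : `|z - y| < r -> [/\ U z, `|'D_v ('D_u g) y - 'D_v ('D_u g) z| < e / 2 &
    `|'D_u ('D_v g) y - 'D_u ('D_v g) z| < e / 2].
  by move=> zr; apply: rP; rewrite -ball_normE /ball_/= distrC.
have key (a b : V') s : 0 < s -> `|s *: a| + `|s *: b| < r ->
   (forall x, U x -> differentiable ('D_a g) x) ->
   exists2 xi, `|xi - y| < r &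
   g (y + s *: a + s *: b) - g (y + s *: a) - g (y + s *: b) + g y =
     s ^+ 2 * 'D_b ('D_a g) xi.
  move=> s0 abr da.
  have DZ (h : V' -> R^o) x c : differentiable h x -> 'D_(s *: c) h x = s * 'D_c h x.
    by move=> dh; rewrite !deriveE// linearZ.
  have dU x : `|x - y| < r - `|s *: b| -> U x /\ U (x + s *: b).
    move=> xr; split.
      by have [] := rP x (lt_le_trans xr _) => //; rewrite gerBl.
    by have [] := rP (x + s *: b); rewrite // addrAC (le_lt_trans (ler_normD _ _))// -ltrBrDr.
  have dsh x : differentiable (fun x => x + s *: b) x.
    by apply: differentiableD => //; exact: differentiable_cst.
  pose G x := g (x + s *: b) - g x : R^o.
  have dG x : `|x - y| < r - `|s *: b| -> differentiable G x.
    move=> /dU[Ux Uxb]; apply: differentiableB; last exact: dg.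
    by apply: (@differentiable_comp _ _ _ _ (fun x => x + s *: b)); [exact: dsh|exact: dg].
  have [|||xi1 xi1r] := @mean_value _ G y (r - `|s *: b|) (y + s *: a) y.
  - exact: dG.
  - by rewrite addrAC subrr add0r ltrBrDr.
  - by rewrite subrr normr0 subr_gt0 (le_lt_trans _ abr)// lerDr.
  rewrite [y + _ - y]addrAC subrr add0r DZ; last exact: dG.
  have [Ux1 Ux1b] := dU _ xi1r.
  have -> : 'D_a G xi1 = 'D_a g (xi1 + s *: b) - 'D_a g xi1.
    rewrite /G deriveB.
    - by congr (_ + _); exact: derive_translate.
    - apply: diff_derivable.
      by apply: (@differentiable_comp _ _ _ _ (fun x => x + s *: b)); [exact: dsh|exact: dg].
    - exact/diff_derivable/dg.
  have [|||xi xir] := @mean_value _ ('D_a g) y r (xi1 + s *: b) xi1.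
  - by move=> x /rP [Ux _ _]; exact: da.
  - by rewrite addrAC (le_lt_trans (ler_normD _ _))// -ltrBrDr.
  - by rewrite (lt_le_trans xi1r)// gerBl.
  rewrite [xi1 + _ - xi1]addrAC subrr add0r DZ; last by apply: da; have [] := rP _ xir.
  move=> -> GE; exists xi => //; rewrite expr2 -mulrA -GE /G.
  by rewrite opprB addrA [RHS]addrAC.
have [s s0 suv] : exists2 s : R, 0 < s & `|s *: u| + `|s *: v| < r.
  have D0 : 0 < `|u| + `|v| + 1 by rewrite ltr_wpDl// addr_ge0.
  have s0 : 0 < r / (`|u| + `|v| + 1) by rewrite divr_gt0.
  exists (r / (`|u| + `|v| + 1)) => //.
  rewrite [`|_ *: u|]normrZ [`|_ *: v|]normrZ [`|r / _|]gtr0_norm// -mulrDr mulrAC ltr_pdivrMr// ltr_pM2l//.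
  by rewrite ltrDl.
have [xi xir E1] := key u v s s0 suv d1.
have [|xi' xi'r E2] := key v u s s0 _ d2; first by rewrite addrC.
have E12 : g (y + s *: u + s *: v) - g (y + s *: u) - g (y + s *: v) + g y =
           g (y + s *: v + s *: u) - g (y + s *: v) - g (y + s *: u) + g y.
  by rewrite [y + _ + _]addrAC [_ - _ - g (y + s *: v)]addrAC.
have s2 : s ^+ 2 != 0 by rewrite expf_neq0// gt_eqF.
have E := mulfI s2 (etrans (etrans (esym E1) E12) E2).
have [_ a1 _] := rP _ xir; have [_ _ a2] := rP _ xi'r.
exact: (dist_le_of_close E a1 a2).
Qed.

End Calculus.

Lemma near_and (T : Type) (F : set_system T) (FF : Filter F) (P Q : T -> Prop) :
  (\forall x \near F, P x) -> (\forall x \near F, Q x) ->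
  \forall x \near F, P x /\ Q x.
Proof. exact: filterI. Qed.
Arguments near_and {T F FF P Q}.

(** * Strict differentiability and its stability under composition *)

Section Strict.
Variable R : realType.

Lemma near_ball (V : normedModType R) (y : V) (P : V -> Prop) :
  (\forall z \near y, P z) -> exists2 t, 0 < t & forall z, `|z - y| < t -> P z.
Proof.
move=> /nbhs_ballP[t /= t0 tP]; exists t => // z zt.
by apply: tP; rewrite -ball_normE /ball_/= distrC.
Qed.

Lemma derive_sum_delta n (W : normedModType R) (F : 'rV[R]_n -> W) x w :
  differentiable F x -> 'D_w F x = \sum_i w 0 i *: 'D_(delta_mx 0 i) F x.
Proof.
move=> dF; rewrite deriveE// {1}(row_sum_delta w) linear_sum.
by apply: eq_bigr => i _; rewrite linearZ/= deriveE.
Qed.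

Lemma derive_coord n p q (F : 'rV[R]_n -> 'M[R]_(p, q)) x w i j :
  differentiable F x -> 'D_w (fun y => F y i j : R^o) x = ('D_w F x) i j.
Proof. by move=> dF; rewrite derive_mx ?mxE//; exact: diff_derivable. Qed.

Lemma differentiable_entry n p q (F : 'rV[R]_n -> 'M[R]_(p, q)) x i j :
  differentiable F x -> differentiable (fun y => F y i j : R^o) x.
Proof.
move=> dF; apply: (@differentiable_comp _ _ _ _ F (fun N : 'M[R]_(p, q) => N i j : R^o)) => //.
exact: differentiable_coord.
Qed.

(** Both points move. One matrix [L] thus controls F on all small cubes near [y], whatever their
    centres, as the compactness argument in [image_cover] requires; the notion also composes, hence
    passes to iterates. *)
Definition strict_diff n p (F : 'rV[R]_n -> 'rV[R]_p) y (L : 'M[R]_(n, p)) :=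
  forall eta : R, 0 < eta -> exists2 t, 0 < t & forall z z',
    `|z - y| < t -> `|z' - y| < t -> `|F z - F z' - (z - z') *m L| <= eta * `|z - z'|.

Lemma C1_strict_diff n p (F : 'rV[R]_n -> 'rV[R]_p) (U : set 'rV[R]_n) y :
  open U -> U y -> C_on 1 U F -> strict_diff F y ('J F y).
Proof.
move=> oU Uy [dF cF] eta eta0.
have n0 : 0 < n.+1%:R :> R by rewrite ltr0n.
(* Each of the n partial derivatives may contribute eta / (n + 1); the successor avoids a zero
   denominator. *)
have e0 : 0 < eta / n.+1%:R by rewrite divr_gt0.
have H : \forall z \near y, forall i : 'I_n,
    `|'D_(delta_mx 0 i) F y - 'D_(delta_mx 0 i) F z| < eta / n.+1%:R.
  apply: (@filter_forall _ _ (fun (i : 'I_n) z =>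
    `|'D_(delta_mx 0 i) F y - 'D_(delta_mx 0 i) F z| < eta / n.+1%:R) (nbhs y) _) => i.
  by have /cvgrPdist_lt/(_ _ e0) := cF (delta_mx 0 i) _ Uy.
have [t t0 tP] := near_ball (near_and (open_nbhs_nbhs (conj oU Uy)) H).
exists t => // z z' zt z't.
set w := z - z'.
apply/rV_norm_leP => [|j]; first by rewrite mulr_ge0// ltW.
have [|xi xit FE] := @mean_value _ _ (fun x => F x 0 j : R^o) y t z z' _ zt z't.
  by move=> x /tP[Ux _]; apply: differentiable_entry; exact: dF.
have [Uxi xiP] := tP _ xit.
rewrite -deriveEjacobian; last exact: dF.
have -> : (F z - F z' - 'D_w F y) 0 j = ('D_w F xi) 0 j - ('D_w F y) 0 j.
  by rewrite !mxE FE derive_coord//; exact: dF.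
rewrite (derive_sum_delta w (dF _ Uxi)) (derive_sum_delta w (dF _ Uy)) !summxE -sumrB.
rewrite (le_trans (ler_norm_sum _ _ _))//.
apply: le_trans (_ : \sum_(i < n) eta / n.+1%:R * `|w| <= _).
  apply: ler_sum => i _; rewrite mxE [X in _ - X]mxE -mulrBr normrM mulrC.
  rewrite ler_pM// ?rV_coord_le// distrC (le_trans _ (ltW (xiP i)))//.
  by have := rV_coord_le ('D_(delta_mx 0 i) F y - 'D_(delta_mx 0 i) F xi) j; rewrite !mxE.
rewrite sumr_const card_ord -[leLHS]mulr_natl mulrA ler_wpM2r//.
by rewrite mulrCA ler_piMr ?(ltW eta0)// ler_pdivrMr// mul1r ler_nat.
Qed.

Lemma strict_diff_lipschitz n p (F : 'rV[R]_n -> 'rV[R]_p) y L : strict_diff F y L ->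
  exists2 c, 0 < c & exists2 t, 0 < t & forall z z',
    `|z - y| < t -> `|z' - y| < t -> `|F z - F z'| <= c * `|z - z'|.
Proof.
move=> /(_ 1 ltr01)[t t0 tP].
exists (1 + n%:R * `|L|); first by rewrite ltr_wpDr// mulr_ge0.
exists t => // z z' zt z't; rewrite mulrDl.
rewrite -(subrK ((z - z') *m L) (F z - F z')) (le_trans (ler_normD _ _))// lerD ?tP//.
apply: norm_mulmx_le => // i j.
by rewrite [`|L|]mx_normrE; apply: (le_bigmax _ (fun ij => `|L ij.1 ij.2|) (i, j)).
Qed.

Lemma strict_diff_comp n p q (F : 'rV[R]_n -> 'rV[R]_p) (G : 'rV[R]_p -> 'rV[R]_q) y L K :
  strict_diff F y L -> strict_diff G (F y) K -> strict_diff (G \o F) y (L *m K).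
Proof.
move=> dF dG eta eta0.
have [c c0 [t1 t10 t1P]] := strict_diff_lipschitz dF.
have e20 : 0 < eta / 2 by rewrite divr_gt0.
have k0 : 0 < p%:R * `|K| + 1 by rewrite ltr_wpDl// mulr_ge0.
(* Half of eta goes to each error: that of F is multiplied by K, which enlarges vectors at most p
   |K| times, and that of G is taken on increments of F, at most c times those of z. *)
have [t2 t20 t2P] := dF (eta / 2 / (p%:R * `|K| + 1)) (divr_gt0 e20 k0).
have [t3 t30 t3P] := dG (eta / 2 / c) (divr_gt0 e20 c0).
exists (Num.min t1 (Num.min t2 (t3 / c))).
  by rewrite !lt_min t10 t20 divr_gt0.
have Ft3 z : `|z - y| < t1 -> `|z - y| < t3 / c -> `|F z - F y| < t3.
  move=> z1 z3; rewrite (le_lt_trans (t1P _ _ z1 _)) ?subrr ?normr0//.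
  by rewrite mulrC -ltr_pdivlMr.
move=> z z'; rewrite !lt_min => /and3P[z1 z2 z3] /and3P[z1' z2' z3'] /=.
have -> : G (F z) - G (F z') - (z - z') *m (L *m K) =
  (G (F z) - G (F z') - (F z - F z') *m K) + (F z - F z' - (z - z') *m L) *m K.
  move: (F z - F z') (z - z') => B w.
  by rewrite mulmxBl mulmxA addrA subrK.
rewrite (le_trans (ler_normD _ _))// [eta]splitr mulrDl lerD//.
  rewrite (le_trans (t3P _ _ (Ft3 _ z1 z3) (Ft3 _ z1' z3')))//.
  by rewrite mulrAC ler_pdivrMr// -[leRHS]mulrA ler_wpM2l ?(ltW e20)// mulrC t1P.
have Kij i j : `|K i j| <= `|K|.
  by rewrite [`|K|]mx_normrE; apply: (le_bigmax _ (fun ij => `|K ij.1 ij.2|) (i, j)).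
rewrite (le_trans (norm_mulmx_le _ Kij (t2P _ _ z2 z2')))//.
rewrite mulrA ler_wpM2r// mulrCA -[leRHS]mulr1 ler_wpM2l ?(ltW e20)//.
by rewrite ler_pdivrMr// mul1r lerDl.
Qed.

Lemma strict_diff_id n (y : 'rV[R]_n) : strict_diff id y 1%:M.
Proof.
move=> eta eta0; exists 1 => // z z' _ _; rewrite mulmx1 subrr normr0.
by rewrite mulr_ge0// ltW.
Qed.

Lemma strict_diff_near n p (F G : 'rV[R]_n -> 'rV[R]_p) y L :
  (\forall z \near y, F z = G z) -> strict_diff F y L -> strict_diff G y L.
Proof.
move=> /near_ball[r r0 FG] dF eta eta0; have [t t0 tP] := dF _ eta0.
exists (Num.min t r); first by rewrite lt_min t0.
move=> z z'; rewrite !lt_min => /andP[zt zr] /andP[z't z'r].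
by rewrite -!FG// tP.
Qed.

End Strict.

(** * Pullback of a 1-form and of its exterior derivative *)

Section Pullback.
Variable R : realType.

Lemma C_on_eq (V W : normedModType R) k (U : set V) (f g : V -> W) : open U ->
  (forall x, U x -> f x = g x) -> C_on k U f -> C_on k U g.
Proof.
move=> oU; elim: k f g => [|k IH] f g fg /=.
  move=> cf x Ux; have nfg : \forall y \near x, f y = g y.
    by apply: filterS (open_nbhs_nbhs (conj oU Ux)) => y /fg.
  rewrite /prop_for /continuous_at -fg//.
  exact: cvg_trans (near_eq_cvg nfg) (cf x Ux).
move=> [df cf]; split=> [x Ux|v].
  have nfg : \forall y \near x, f y = g y.
    by apply: filterS (open_nbhs_nbhs (conj oU Ux)) => y /fg.
  by have [] := near_eq_diff nfg (df _ Ux).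
apply: IH (cf v) => x Ux; apply: near_eq_derive.
by apply: filterS (open_nbhs_nbhs (conj oU Ux)) => y /fg.
Qed.

Lemma C_on_sub (V W : normedModType R) k (U U' : set V) (F : V -> W) : U' `<=` U ->
  C_on k U F -> C_on k U' F.
Proof.
move=> sU; elim: k F => [|k IH] F /=; first by move=> H x /sU; exact: H.
by move=> [dF CF]; split=> [x /sU|v]; [exact: dF|exact: IH].
Qed.

Lemma C_on_continuous (V W : normedModType R) k (U : set V) (f : V -> W) x :
  C_on k U f -> U x -> {for x, continuous f}.
Proof.
case: k => [|k] /=; first exact.
by move=> [df _] Ux; apply: differentiable_continuous; exact: df.
Qed.

Lemma C_onS (V W : normedModType R) k (U : set V) (f : V -> W) :
  C_on k.+1 U f -> C_on k U f.
Proof.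
elim: k f => [|k IH] f; first by move=> H x; exact: C_on_continuous H.
by move=> [df cf]; split=> // v; exact: IH (cf v).
Qed.

Lemma C_on_entry n p q k (U : set 'rV[R]_n) (f : 'rV[R]_n -> 'M[R]_(p, q)) i j :
  open U -> C_on k U f -> C_on k U (fun x => f x i j : R^o).
Proof.
move=> oU; elim: k f => [|k IH] f.
  move=> cf x Ux; have := continuous_comp (cf x Ux) (@coord_continuous R p q i j (f x)).
  exact.
move=> [df cf]; split=> [x Ux|v]; first by apply: differentiable_entry; exact: df.
apply: C_on_eq oU _ (IH _ (cf v)) => x Ux.
by rewrite derive_coord//; exact: df.
Qed.

Lemma schwarz_rV n p (F : 'rV[R]_n -> 'rV[R]_p) (U : set 'rV[R]_n) u v y :
  open U -> U y -> C_on 2 U F -> 'D_u ('D_v F) y = 'D_v ('D_u F) y.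
Proof.
move=> oU Uy CF; apply/rowP => j; have [dF CdF] := CF.
have nU : nbhs y U := open_nbhs_nbhs (conj oU Uy).
have E a b : ('D_a ('D_b F) y) 0 j = 'D_a ('D_b (fun x => F x 0 j : R^o)) y.
  rewrite -derive_coord; last by have [dbF _] := CdF b; exact: dbF.
  apply: near_eq_derive; apply: filterS nU => x Ux.
  by rewrite derive_coord//; exact: dF.
exact: etrans (E u v) (etrans (schwarz u v oU Uy (C_on_entry 0 j oU CF)) (esym (E v u))).
Qed.

Lemma pairingE n (v : 'rV[R]_n) (a : 'cV[R]_n) : pairing v a = \sum_i v 0 i * a i 0.
Proof. by rewrite /pairing mxE. Qed.

Lemma differentiable_pairing m n (X : 'rV[R]_m -> 'rV[R]_n) (a : 'rV[R]_m -> 'cV[R]_n) y :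
  differentiable X y -> differentiable a y ->
  differentiable (fun z => pairing (X z) (a z) : R^o) y.
Proof.
move=> dX da.
have -> : (fun z => pairing (X z) (a z) : R^o) =
          \sum_(i < n) (fun z => (X z 0 i : R^o) * (a z i 0 : R^o)).
  by apply/funext => z; rewrite fct_sumE pairingE.
apply: differentiable_sum => i.
by apply: differentiableM; apply: differentiable_entry.
Qed.

Lemma derive_pairing m n (X : 'rV[R]_m -> 'rV[R]_n) (a : 'rV[R]_m -> 'cV[R]_n) y u :
  differentiable X y -> differentiable a y ->
  'D_u (fun z => pairing (X z) (a z) : R^o) y =
    pairing ('D_u X y) (a y) + pairing (X y) ('D_u a y).
Proof.
move=> dX da.
have -> : (fun z => pairing (X z) (a z) : R^o) =
          \sum_(i < n) (fun z => (X z 0 i : R^o) * (a z i 0 : R^o)).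
  by apply/funext => z; rewrite fct_sumE pairingE.
have dXi i : differentiable (fun z => X z 0 i : R^o) y by exact: differentiable_entry.
have dai i : differentiable (fun z => a z i 0 : R^o) y by exact: differentiable_entry.
rewrite derive_sum; last by move=> i; apply/diff_derivable/differentiableM.
rewrite !pairingE -big_split/=; apply: eq_bigr => i _.
rewrite deriveM; [|exact: diff_derivable..].
by rewrite !derive_coord// addrC; congr (_ + _); exact: mulrC.
Qed.

(** Matrix of d alpha, where alpha has the coefficients [a], with the normalization of [extd]. *)
Definition dform_mx n (a : 'rV[R]_n -> 'cV[R]_n) (y : 'rV[R]_n) : 'M[R]_n :=
  \matrix_(i, j) (('D_(delta_mx 0 i) a y) j 0 - ('D_(delta_mx 0 j) a y) i 0).

Lemma dform_mx_entry n (a : 'rV[R]_n -> 'cV[R]_n) y i j :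
  dform_mx a y i j = ('D_(delta_mx 0 i) a y) j 0 - ('D_(delta_mx 0 j) a y) i 0.
Proof. by rewrite mxE. Qed.

Lemma dform_mxE n (a : 'rV[R]_n -> 'cV[R]_n) y (u v : 'rV[R]_n) : differentiable a y ->
  (u *m dform_mx a y *m v^T) 0 0 = pairing v ('D_u a y) - pairing u ('D_v a y).
Proof.
have aux (p q x z : R) : p * (x - z) * q = q * (p * x) - p * (q * z) by ring.
move=> da.
have DE w k : ('D_w a y) k 0 = \sum_i w 0 i * ('D_(delta_mx 0 i) a y) k 0.
  by rewrite (derive_sum_delta w da) summxE; apply: eq_bigr => i _; rewrite mxE.
rewrite !pairingE.
under eq_bigr do rewrite DE mulr_sumr.
under [X in _ = _ - X]eq_bigr do rewrite DE mulr_sumr.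
rewrite [X in _ = X - _]exchange_big/= -sumrB mxE.
under eq_bigr do rewrite mxE mulr_suml.
rewrite exchange_big/=; apply: eq_bigr => i _; rewrite -sumrB; apply: eq_bigr => j _.
have -> : v^T j 0 = v 0 j by rewrite mxE.
rewrite dform_mx_entry; exact: aux.
Qed.

Lemma dform_mx_antisym n (a : 'rV[R]_n -> 'cV[R]_n) y : (dform_mx a y)^T = - dform_mx a y.
Proof. by apply/matrixP => i j; rewrite !mxE opprB. Qed.

Lemma extd_one_form n (a : 'rV[R]_n -> 'cV[R]_n) y : differentiable a y ->
  extd (one_form a) y = bilinear_kform (dform_mx a y).
Proof.
move=> da; apply/funext => v; rewrite /bilinear_kform dform_mxE//.
have D u w : 'D_u (fun z => pairing w (a z) : R^o) y = pairing w ('D_u a y).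
  rewrite (derive_pairing u (differentiable_cst w y) da).
  by rewrite derive_cst /pairing mul0mx mxE add0r.
rewrite /extd big_ord_recl big_ord1 /= expr0 mul1r expr1 mulN1r.
rewrite /one_form !D; congr (pairing (v _) _ - pairing (v _) _); exact/val_inj.
Qed.

Lemma proportional n (p q : 'cV[R]_n) :
  (forall v : 'rV[R]_n, pairing v p = 0 -> pairing v q = 0) -> exists c, q = c *: p.
Proof.
move=> H; have [p0|/eqP p0] := boolP (p == 0).
  exists 0; rewrite scale0r; apply/colP => i; rewrite mxE.
  have := H (delta_mx 0 i); rewrite (eqP p0) /pairing mulmx0 mxE => /(_ erefl).
  by rewrite -rowE mxE.
have [i pi] : exists i, p i 0 != 0.
  apply/existsP; apply: contra_notT p0; rewrite negb_exists => /forallP ai.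
  by apply/colP => i; rewrite mxE; apply/eqP; rewrite -[_ == _]negbK.
exists (q i 0 / p i 0); apply/colP => j; rewrite mxE.
have := H (p i 0 *: delta_mx 0 j - p j 0 *: delta_mx 0 i).
rewrite /pairing !mulmxBl -!scalemxAl -!rowE !mxE.
rewrite mulrC subrr => /(_ erefl)/eqP; rewrite subr_eq0 => /eqP E.
by apply: (mulfI pi); rewrite E; field.
Qed.

Lemma pairing_inj n (p q : 'cV[R]_n) : (forall v : 'rV[R]_n, pairing v p = pairing v q) -> p = q.
Proof.
by move=> H; apply/colP => i; have := H (delta_mx 0 i); rewrite /pairing -!rowE !mxE.
Qed.

Lemma bilinear_inj n (A B : 'M[R]_n) :
  (forall u v : 'rV[R]_n, (u *m A *m v^T) 0 0 = (u *m B *m v^T) 0 0) -> A = B.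
Proof.
move=> H; apply/matrixP => i j; have := H (delta_mx 0 i) (delta_mx 0 j).
by rewrite trmx_delta -!rowE -!colE !mxE.
Qed.

(** The kernel condition makes the pullback of alpha' proportional to alpha at each point. The
    factor h is differentiable, being a quotient of values on one fixed vector w. The identity
    alpha'(DF v) = h alpha(v) is then differentiated along u, for constant u and v, and
    antisymmetrized: the second derivatives of F cancel by Schwarz. The vector [b] is the gradient
    of h, so the last bracket is the matrix of dh /\ alpha. *)
Lemma pullback_dform n (F : 'rV[R]_n -> 'rV[R]_n) (U : set 'rV[R]_n)
    (a a' : 'rV[R]_n -> 'cV[R]_n) y :
  open U -> U y -> C_on 2 U F -> (forall z, U z -> differentiable a z) ->
  (forall z, U z -> differentiable a' (F z)) -> a y != 0 ->
  (forall z, U z -> forall v, pairing v (a z) = 0 -> pairing ('D_v F z) (a' (F z)) = 0) ->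
  exists h b, 'J F y *m a' (F y) = h *: a y /\
    'J F y *m dform_mx a' (F y) *m ('J F y)^T =
      h *: dform_mx a y + (b *m (a y)^T - a y *m b^T).
Proof.
move=> oU Uy CF da da' ay0 kerF; have [dF CdF] := CF.
have [w w0] : exists w, pairing w (a y) != 0.
  apply/not_existsP => H; move/eqP: ay0; apply; apply: pairing_inj => v.
  by rewrite [RHS]/pairing mulmx0 mxE; apply/eqP/negPn/negP; exact: H.
pose phi v z : R^o := pairing ('D_v F z) (a' (F z)).
pose psi v z : R^o := pairing v (a z).
have prop z : U z -> exists c, forall v, phi v z = c * psi v z.
  move=> Uz; have [|c cE] := @proportional n (a z) ('J F z *m a' (F z)).
    move=> v /(kerF z Uz v); rewrite deriveEjacobian; last exact: dF.
    by rewrite /pairing mulmxA.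
  exists c => v; rewrite /phi deriveEjacobian; last exact: dF.
  by rewrite /psi /pairing -mulmxA cE -scalemxAr mxE.
have dphi v : differentiable (phi v) y.
  apply: differentiable_pairing; first by have [dvF _] := CdF v; exact: dvF.
  by apply: (@differentiable_comp _ _ _ _ F a'); [exact: dF|exact: da'].
have dpsi v : differentiable (psi v) y.
  by apply: differentiable_pairing; [exact: (differentiable_cst v y)|exact: da].
pose h z : R := phi w z / psi w z.
have dh : differentiable h y.
  by apply: differentiableM; [exact: dphi|apply: differentiableV; [exact: dpsi|]].
have nU : nbhs y U := open_nbhs_nbhs (conj oU Uy).
have hE v : \forall z \near y, phi v z = h z * psi v z.
  have npsi : \forall z \near y, psi w z != 0.
    exact: cvgr_neq0 (differentiable_continuous (dpsi w)) w0.
  apply: filterS2 nU npsi => z Uz pz.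
  have [c cE] := prop z Uz; rewrite /h !cE mulfK//; exact: cE.
have D u v : 'D_u (phi v) y = h y * 'D_u (psi v) y + psi v y * 'D_u h y.
  rewrite (near_eq_derive u (hE v)).
  by rewrite deriveM; [|exact: diff_derivable..].
have Dphi u v : 'D_u (phi v) y = pairing ('D_u ('D_v F) y) (a' (F y)) +
    pairing ('D_v F y) ('D_('D_u F y) a' (F y)).
  have dvF : differentiable ('D_v F) y by have [dvF _] := CdF v; exact: dvF.
  have daF : differentiable (a' \o F) y.
    by apply: differentiable_comp; [exact: dF|exact: da'].
  rewrite (derive_pairing u dvF daF); congr (_ + pairing _ _).
  rewrite (deriveE _ daF) diff_comp; [|exact: dF|exact: da'].
  by rewrite (deriveE _ (da' _ Uy)) (deriveE _ (dF _ Uy)).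
have Dpsi u v : 'D_u (psi v) y = pairing v ('D_u a y).
  rewrite (derive_pairing u (differentiable_cst v y) (da _ Uy)) derive_cst.
  by rewrite {1}/pairing mul0mx mxE add0r.
pose b : 'cV[R]_n := \col_i 'D_(delta_mx 0 i) h y.
have bE u : pairing u b = 'D_u h y.
  rewrite (derive_sum_delta u dh) pairingE; apply: eq_bigr => i _.
  by rewrite /b mxE.
exists (h y), b; split.
  apply: pairing_inj => v; rewrite /pairing mulmxA -deriveEjacobian; last exact: dF.
  rewrite -scalemxAr [RHS]mxE; exact: nbhs_singleton (hE v).
apply: bilinear_inj => u v.
have JE x : x *m 'J F y = 'D_x F y by rewrite deriveEjacobian//; exact: dF.
have -> : u *m ('J F y *m dform_mx a' (F y) *m ('J F y)^T) *m v^T =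
          'D_u F y *m dform_mx a' (F y) *m ('D_v F y)^T.
  by rewrite -!JE trmx_mul !mulmxA.
rewrite (dform_mxE _ _ (da' _ Uy)).
have -> : (u *m (h y *: dform_mx a y + (b *m (a y)^T - a y *m b^T)) *m v^T) 0 0 =
    h y * (pairing v ('D_u a y) - pairing u ('D_v a y)) +
    (pairing u b * pairing v (a y) - pairing u (a y) * pairing v b).
  rewrite -(dform_mxE _ _ (da _ Uy)).
  have outer (p q : 'cV[R]_n) : (u *m (p *m q^T) *m v^T) 0 0 = pairing u p * pairing v q.
    rewrite mulmxA -mulmxA -trmx_mul [u *m p]mx11_scalar mul_scalar_mx.
    by rewrite /pairing [LHS]mxE [X in _ * X = _]mxE.
  rewrite mulmxDr mulmxBr mulmxDl mulmxBl -scalemxAr -scalemxAl.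
  have entD (A B : 'M[R]_1) : (A + B) 0 0 = A 0 0 + B 0 0 by rewrite mxE.
  have entN (A : 'M[R]_1) : (- A) 0 0 = - A 0 0 by rewrite mxE.
  have entZ c (A : 'M[R]_1) : (c *: A) 0 0 = c * A 0 0 by rewrite mxE.
  by rewrite entD entD entN entZ !outer.
rewrite !bE; have E1 := etrans (esym (D u v)) (Dphi u v).
have E2 := etrans (esym (D v u)) (Dphi v u).
have E3 := congr1 (fun p => pairing p (a' (F y))) (schwarz_rV u v oU Uy CF).
rewrite !Dpsi in E1 E2.
have alg (A1 A2 B1 B2 C1 C2 hu hv pu pv hy : R) :
    hy * B1 + pv * hu = C1 + A1 -> hy * B2 + pu * hv = C2 + A2 -> C1 = C2 ->
    A1 - A2 = hy * (B1 - B2) + (hu * pv - pu * hv).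
  move=> H1 H2 H3; have -> : A1 = hy * B1 + pv * hu - C1 by rewrite H1; ring.
  have -> : A2 = hy * B2 + pu * hv - C2 by rewrite H2; ring.
  by rewrite H3; ring.
exact: (alg _ _ _ _ _ _ _ _ _ _ _ E1 E2 E3).
Qed.

End Pullback.

(** * Charts and tangent maps *)

(** Local constants have a common upper bound, and [P] is monotone in the constant; the compactness
    argument runs along the filter at infinity. Radii that must be small are put into this form
    through their inverses. *)
Lemma compact_uniform (R : realType) (T : topologicalType) (K : set T) (P : R -> T -> Prop) :
  compact K -> (forall C C' x, C <= C' -> P C x -> P C' x) ->
  (forall x0, K x0 -> exists C, \forall x \near x0, K x -> P C x) ->
  exists C, forall x, K x -> P C x.
Proof.
move=> /compact_near_coveringP/near_covering_withinP cK mono loc.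
have := cK _ (@pinfty_nbhs R) P _.
case.
- move=> x0 /loc[C nC].
  exists ([set x | K x -> P C x], [set C' | C < C']); first by split=> //=; exists C; split=> //; exact: num_real.
  by move=> [x C'] /= [Px CC'] Kx; apply: mono (ltW CC') (Px Kx).
- move=> C [_ H]; exists (C + 1) => x Kx; by apply: (H (C + 1)) => //; rewrite ltrDl.
Qed.

Lemma compact_bounded_fun (R : realType) (T : topologicalType) (K : set T) (g : T -> R) :
  compact K -> (forall x, K x -> {for x, continuous g}) ->
  exists C, forall x, K x -> `|g x| <= C.
Proof.
move=> cK cg; apply: (compact_uniform (P := fun C x => `|g x| <= C) cK).
  by move=> C C' x CC' /le_trans; exact.
move=> x0 Kx0; exists (`|g x0| + 1).
have : \forall x \near x0, `|g x0 - g x| < 1.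
  by have /cvgrPdist_lt/(_ _ ltr01) := cg _ Kx0.
apply: filterS => x gx _.
rewrite -(subrK (g x0) (g x)) addrC (le_trans (ler_normD _ _))// lerD2l distrC ltW//.
Qed.

Lemma continuous_det (R : realType) (T : topologicalType) n (B : T -> 'M[R]_n) x :
  (forall i j, {for x, continuous (fun y => B y i j)}) ->
  {for x, continuous (fun y => \det (B y))}.
Proof.
move=> cB; rewrite /prop_for /continuous_at /determinant.
apply: (cvg_big (@add_continuous R)) => s _.
apply: cvgM; first exact: cvg_cst.
by apply: (cvg_big (@mul_continuous R)) => i _; exact: cB.
Qed.

Section Manifold.
Variables (R : realType) (n : nat) (M : topologicalType) (A : smooth_atlas R n M).
Local Notation V := 'rV[R]_n.
Local Notation dom i := (chart_dom (s := A) i).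
Local Notation ch i := (chart (s := A) i).
Local Notation inv i := (chart_inv (s := A) i).

Definition local_rep (g : M -> M) (i j : chart_index A) : V -> V := ch j \o g \o inv i.

Lemma chart_at_dom x : dom (chart_at A x) x.
Proof. exact: projT2 (cid (dom_cover A x)). Qed.

Lemma chart_invP i y : (ch i @` dom i) y -> dom i (inv i y) /\ ch i (inv i y) = y.
Proof. by move=> [x dx <-]; rewrite chartK. Qed.

Lemma chart_image x i : dom i x -> (ch i @` dom i) (ch i x).
Proof. by move=> dx; exists x. Qed.

Lemma near_chart_inv i x (P : M -> Prop) : dom i x -> (\forall x' \near x, P x') ->
  \forall y \near ch i x, [/\ dom i (inv i y), ch i (inv i y) = y & P (inv i y)].
Proof.
move=> dx nP; have ci := @chart_inv_continuous _ _ _ A i _ (chart_image dx).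
have nP' : \forall y \near ch i x, P (inv i y).
  by apply: ci; rewrite chartK.
have nc : nbhs (ch i x) (ch i @` dom i).
  by apply: open_nbhs_nbhs; split; [exact: codom_open|exact: chart_image].
by apply: filterS2 nc nP' => y /chart_invP[dy yE] Py; split.
Qed.

Lemma near_chart i x (P : V -> Prop) : dom i x -> (\forall y \near ch i x, P y) ->
  \forall x' \near x, P (ch i x').
Proof. by move=> dx nP; exact: (chart_continuous dx). Qed.

Lemma near_dom i x : dom i x -> \forall x' \near x, dom i x'.
Proof. by move=> dx; apply: open_nbhs_nbhs; split=> //; exact: dom_open. Qed.

Lemma open_chart_image i (W : set M) : open W -> open (ch i @` (dom i `&` W)).
Proof.
move=> oW; rewrite openE => y [x [dx Wx] <-].
have nW : \forall x' \near x, W x' by exact: open_nbhs_nbhs.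
rewrite /interior; apply: filterS (near_chart_inv dx nW) => z [dz zE Wz].
by exists (inv i z).
Qed.

(** Coordinate changes become local representations of the identity, so that the chain rule for maps
    also governs [tcoord] and [tvec]. *)
Lemma C_map_id k : C_map A k idfun.
Proof. by split; [move=> x; exact: cvg_id|move=> i j; exact: chart_smooth]. Qed.

Lemma local_rep_domain k g i j x : C_map A k g -> dom i x -> dom j (g x) ->
  exists2 U, open U /\ U (ch i x) & C_on k U (local_rep g i j).
Proof.
move=> [cg Cg] dx dgx; exists (ch i @` (dom i `&` g @^-1` dom j)); last exact: Cg.
split; last by exists x.
by apply: open_chart_image; apply: open_comp => [y _|]; [exact: cg|exact: dom_open].
Qed.

Lemma local_rep_differentiable k g i j x : C_map A k.+1 g -> dom i x -> dom j (g x) ->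
  differentiable (local_rep g i j) (ch i x).
Proof. by move=> Cg dx dgx; have [U [_ Ux] [dU _]] := local_rep_domain Cg dx dgx; exact: dU. Qed.

Lemma local_rep_comp_near (g1 g2 : M -> M) i j l x : {for x, continuous g1} ->
  dom i x -> dom j (g1 x) ->
  \forall z \near ch i x, (local_rep g2 j l \o local_rep g1 i j) z = local_rep (g2 \o g1) i l z.
Proof.
move=> cg1 dx dgx; have nj : \forall x' \near x, dom j (g1 x') by apply: cg1; exact: near_dom.
apply: filterS (near_chart_inv dx nj) => z [dz zE gz].
by rewrite /local_rep /= chartK.
Qed.

Lemma local_rep_comp_diff k l g1 g2 i j p x : C_map A k.+1 g1 -> C_map A l.+1 g2 ->
  dom i x -> dom j (g1 x) -> dom p (g2 (g1 x)) ->
  forall v, 'd (local_rep (g2 \o g1) i p) (ch i x) v =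
    'd (local_rep g2 j p) (ch j (g1 x)) ('d (local_rep g1 i j) (ch i x) v).
Proof.
move=> C1 C2 dx dgx dggx v.
have d1 := local_rep_differentiable C1 dx dgx.
have r1 : local_rep g1 i j (ch i x) = ch j (g1 x) by rewrite /local_rep /= chartK.
have d2 : differentiable (local_rep g2 j p) (local_rep g1 i j (ch i x)).
  by rewrite r1; exact: local_rep_differentiable C2 dgx dggx.
have [_ E] := near_eq_diff (local_rep_comp_near g2 p (C1.1 x) dx dgx) (differentiable_comp d1 d2).
apply: etrans (congr1 (@^~ v) E) _.
apply: etrans (congr1 (@^~ v) (diff_comp d1 d2)) _.
exact: (congr1 (fun z => 'd (local_rep g2 j p) z ('d (local_rep g1 i j) (ch i x) v)) r1).
Qed.

Lemma local_rep_id_diff i x v : dom i x -> 'd (local_rep id i i) (ch i x) v = v.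
Proof.
move=> dx; have nE : \forall z \near ch i x, id z = local_rep id i i z.
  by apply: filterS (near_chart_inv dx (@filterT _ (nbhs x) _)) => z [_ zE _].
have did : differentiable (id : V -> V) (ch i x) by exact: ex_diff.
have [_ E] := near_eq_diff nE did.
by apply: etrans (congr1 (@^~ v) E) _; rewrite diff_val.
Qed.

Lemma tvecK i x v : dom i x -> tcoord i x (tvec i x v) = v.
Proof.
move=> dx; rewrite -[RHS](local_rep_id_diff v dx).
exact/esym/(local_rep_comp_diff (C_map_id 1) (C_map_id 1) dx (chart_at_dom x) dx).
Qed.

Lemma tcoordK i x v : dom i x -> tvec i x (tcoord i x v) = v.
Proof.
move=> dx; rewrite -[RHS](local_rep_id_diff v (chart_at_dom x)).
exact/esym/(local_rep_comp_diff (C_map_id 1) (C_map_id 1) (chart_at_dom x) dx (chart_at_dom x)).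
Qed.

Lemma tcoord_tmap k g i j x v : C_map A k.+1 g -> dom i x -> dom j (g x) ->
  tcoord j (g x) (tmap A g x v) = tcoord i x v *m 'J (local_rep g i j) (ch i x).
Proof.
move=> Cg dx dgx; rewrite /jacobian mul_rV_lin1.
transitivity ('d (local_rep g (chart_at A x) j) (ch (chart_at A x) x) v).
  exact/esym/(local_rep_comp_diff Cg (C_map_id 1) (chart_at_dom x) (chart_at_dom (g x)) dgx).
exact: (local_rep_comp_diff (C_map_id 1) Cg (chart_at_dom x) dx dgx).
Qed.

Lemma tmap_cancel k g g' x v : C_map A k.+1 g -> C_map A k.+1 g' -> cancel g g' ->
  tmap A g' (g x) (tmap A g x v) = v.
Proof.
move=> Cg Cg' gK.
have E := local_rep_comp_diff Cg Cg' (chart_at_dom x) (chart_at_dom (g x)) (chart_at_dom (g' (g x))) v.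
have id' : g' \o g = id by apply/funext => y /=.
rewrite id' gK in E; rewrite -[RHS](local_rep_id_diff v (chart_at_dom x)) E.
by rewrite /tmap gK.
Qed.

End Manifold.

(** * Continuous fields of subspaces *)

Section Fields.
Variables (R : realType) (n : nat) (M : topologicalType) (A : smooth_atlas R n M).
Local Notation V := 'rV[R]_n.
Local Notation dom i := (chart_dom (s := A) i).
Local Notation ch i := (chart (s := A) i).

Lemma tcoordP (i : chart_index A) x a u v :
  tcoord i x (a *: u + v) = a *: tcoord i x u + tcoord i x v.
Proof. by rewrite /tcoord linearP. Qed.

Lemma tvecP (i : chart_index A) x a u v :
  tvec i x (a *: u + v) = a *: tvec i x u + tvec i x v.
Proof. by rewrite /tvec linearP. Qed.

Lemma dim_tcoord (E : {vspace V}) (i : chart_index A) x : dom i x ->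
  \dim (linfun (tcoord i x) @: E) = \dim E.
Proof.
move=> dx; apply: limg_dim_eq; apply/eqP; rewrite -subv0; apply/subvP => v.
rewrite memv_cap memv_ker /tcoord lfunE -/(tcoord _ _ _) => /andP[_ /eqP v0].
rewrite memv0 -(tcoordK v dx) v0; apply/eqP.
by have := tvecP i x (-1) 0 0; rewrite scaler0 addr0 scaleN1r addNr.
Qed.

Lemma dim_locally_constant (E : subspace_field R n M) x0 : continuous_subspace_field A E ->
  \forall x \near x0, \dim (E x) = \dim (E x0).
Proof.
move=> cE; have [i [r [e nE]]] := cE x0.
have dimE x : dom i x -> basis_of (linfun (tcoord i x) @: E x)%VS [seq e k x | k <- enum 'I_r] ->
    \dim (E x) = r.
  move=> dx /andP[/eqP bE]; rewrite /free => /eqP dE.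
    by rewrite -(dim_tcoord _ dx) -bE dE size_map size_enum_ord.
have [d0 b0 _] := nbhs_singleton nE.
by apply: filterS nE => x [dx bx _]; rewrite !dimE.
Qed.

Lemma continuous_for_sum (T : topologicalType) (W : normedModType R) r (f : 'I_r -> T -> W) x :
  (forall k, {for x, continuous (f k)}) -> {for x, continuous (fun y => \sum_k f k y)}.
Proof.
move=> cf; rewrite /prop_for /continuous_at.
by apply: (cvg_big (@add_continuous W)) => k _; exact: cf.
Qed.

(** The coefficients of [v0] in a local frame are frozen. The frame is given in some chart j, whence
    the passage to the prescribed chart i through the Jacobian of the change of coordinates. *)
Lemma continuous_section (E : subspace_field R n M) i x0 v0 :
  continuous_subspace_field A E -> dom i x0 -> v0 \in E x0 ->
  exists w : M -> V, [/\ {for x0, continuous w}, w x0 = tcoord i x0 v0 &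
    \forall x \near x0, tvec i x (w x) \in E x].
Proof.
move=> cE dx0 v0E; have [j [r [e nE]]] := cE x0.
have [dj0 b0 c0] := nbhs_singleton nE.
pose X x := [tuple e k x | k < r].
have spanX x : dom j x -> basis_of (linfun (tcoord j x) @: E x)%VS [seq e k x | k <- enum 'I_r] ->
    (linfun (tcoord j x) @: E x)%VS = <<X x>>%VS.
  by move=> dx /andP[/eqP <- _].
have [c cE0] : exists c : 'I_r -> R, tcoord j x0 v0 = \sum_k c k *: e k x0.
  exists (fun k => coord (X x0) k (tcoord j x0 v0)).
  have /coord_span {1}-> : tcoord j x0 v0 \in <<X x0>>%VS.
    rewrite -spanX//; have := memv_img (linfun (tcoord j x0)) v0E.
    by rewrite {1}/tcoord lfunE.
  by apply: eq_bigr => k _; rewrite -tnth_nth tnth_mktuple.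
pose w' x := \sum_k c k *: e k x.
have cw' : {for x0, continuous w'}.
  by apply: continuous_for_sum => k; exact: (cvgZ (cvg_cst (c k)) (c0 k)).
pose F := local_rep (A := A) id j i.
pose w x := \sum_l w' x 0 l *: 'D_(delta_mx 0 l) F (ch j x).
have [U [oU Ux0] [dF CF]] := local_rep_domain (C_map_id A 1) dj0 dx0.
have wE x : dom j x -> dom i x -> w x = w' x *m 'J F (ch j x).
  move=> djx dix; have dFx := local_rep_differentiable (C_map_id A 1) djx dix.
  by rewrite -deriveEjacobian// (derive_sum_delta (w' x) dFx).
have tw x v : dom j x -> dom i x -> tcoord j x v = w' x -> tcoord i x v = w x.
  move=> djx dix vE; rewrite wE// -vE.
  rewrite -(tcoord_tmap v (C_map_id A 1) djx dix).
  by rewrite /tmap (local_rep_id_diff v (chart_at_dom A x)).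
exists w; split.
- apply: continuous_for_sum => l.
  have c1 : {for x0, continuous (fun x => w' x 0 l)}.
    exact: (continuous_comp cw' (@coord_continuous R 1 n 0 l _)).
  have c2 : {for x0, continuous (fun x => 'D_(delta_mx 0 l) F (ch j x))}.
    exact: (continuous_comp (chart_continuous dj0) (CF (delta_mx 0 l) _ Ux0)).
  exact: (cvgZ c1 c2).
- by rewrite (tw x0 v0).
- apply: filterS2 nE (near_dom dx0) => x [djx bx _] dix.
  have : w' x \in (linfun (tcoord j x) @: E x)%VS.
    rewrite spanX//; apply: memv_suml => k _; apply: memvZ; apply: memv_span.
    by apply/mapP; exists k => //; rewrite mem_enum.
  move=> /memv_imgP[v vE]; rewrite {1}/tcoord lfunE => /esym w'v.
  by rewrite -(tw x v djx dix w'v) tcoordK.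
Qed.

End Fields.

(** * Comparison of the metric with the norm of coordinates *)

Section Metric.
Variables (R : realType) (n : nat) (M : topologicalType) (A : smooth_atlas R n M).
Local Notation V := 'rV[R]_n.
Local Notation dom i := (chart_dom (s := A) i).
Variable g : continuous_metric A.

Definition gram (i : chart_index A) x k l : R := g x (tvec i x (delta_mx 0 k)) (tvec i x (delta_mx 0 l)).
Definition quad (i : chart_index A) x (w : V) : R := \sum_k \sum_l w 0 k * w 0 l * gram i x k l.

Lemma tvec_sum (i : chart_index A) x w : tvec i x w = \sum_k w 0 k *: tvec i x (delta_mx 0 k).
Proof.
rewrite {1}(row_sum_delta w) /tvec linear_sum.
by apply: eq_bigr => k _; rewrite linearZ.
Qed.

Lemma quadE i x w : quad i x w = g x (tvec i x w) (tvec i x w).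
Proof.
rewrite tvec_sum linear_sumlz /quad; apply: eq_bigr => k _.
rewrite linear_sumr; apply: eq_bigr => l _.
by rewrite [RHS]linearZr_LR /= [X in _ = _ * X]linearZl_LR /= -mulrA mulrCA.
Qed.

Lemma quadZ i x a w : quad i x (a *: w) = a ^+ 2 * quad i x w.
Proof.
rewrite /quad mulr_sumr; apply: eq_bigr => k _; rewrite mulr_sumr; apply: eq_bigr => l _.
by rewrite !mxE; ring.
Qed.

Lemma quad_ge0 i x w : 0 <= quad i x w.
Proof.
rewrite quadE; set v := tvec i x w; have [->|v0] := eqVneq v 0.
  by rewrite linear0l.
exact/ltW/neq0_dnorm_gt0.
Qed.

Lemma quad_gt0 i x w : dom i x -> w != 0 -> 0 < quad i x w.
Proof.
move=> dx w0; rewrite quadE; apply: neq0_dnorm_gt0; apply: contra_neq w0 => v0.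
rewrite -(tvecK w dx) v0.
by have := tcoordP i x (-1) 0 0; rewrite scaler0 addr0 scaleN1r addNr.
Qed.

Lemma tnormE i x v : dom i x -> tnorm g x v = Num.sqrt (quad i x (tcoord i x v)).
Proof. by move=> dx; rewrite quadE tcoordK. Qed.

Lemma compact_unit_sphere : compact [set w : V | `|w| = 1].
Proof.
apply: bounded_closed_compact.
  exists 1; split; first exact: num_real.
  by move=> r r1 w /= ->; exact: ltW.
have -> : [set w : V | `|w| = 1] = (fun w : V => `|w|) @^-1` [set 1] by [].
by apply: closed_comp => [w _|]; [exact: norm_continuous|exact: closed_eq].
Qed.

Lemma quad_continuous i x : continuous (quad i x).
Proof.
move=> w0; rewrite /quad.
apply: continuous_for_sum => k; apply: continuous_for_sum => l.
have ck j : {for w0, continuous (fun w : V => w 0 j)} by exact: coord_continuous.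
exact: (cvgM (cvgM (ck k) (ck l)) (cvg_cst _)).
Qed.

(** At x0 the form is bounded below by a positive constant on the compact unit sphere. Nearby its
    finitely many Gram coefficients move little, so the bounds persist uniformly in w; homogeneity
    does the rest. *)
Lemma quad_bound i x0 : dom i x0 ->
  exists2 c, 0 < c & \forall x \near x0, forall w, c * `|w| ^+ 2 <= quad i x w <= c^-1 * `|w| ^+ 2.
Proof.
move=> dx0.
have [||C CP] := compact_uniform (P := fun C w => 0 < C /\ C^-1 <= quad i x0 w) compact_unit_sphere.
- move=> C C' w CC' [C0 Cw]; split; first exact: lt_le_trans C0 CC'.
    by rewrite (le_trans _ Cw)// lef_pV2 ?posrE// (lt_le_trans C0).
- move=> w0 /= w1; have w00 : w0 != 0 by rewrite -normr_gt0 w1.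
  have q0 := quad_gt0 dx0 w00.
  exists (quad i x0 w0 / 2)^-1; have := @quad_continuous i x0 w0.
  move=> /cvgr_gt /(_ (quad i x0 w0 / 2)) H.
  have /H : quad i x0 w0 / 2 < quad i x0 w0 by lra.
  apply: filterS => w qw _; split; first by rewrite invr_gt0 divr_gt0.
  by rewrite invrK ltW.
pose c0 := (Num.max C 1)^-1.
have c00 : 0 < c0 by rewrite invr_gt0 lt_max ltr01 orbT.
have Q0 w : `|w| = 1 -> c0 <= quad i x0 w.
  move=> /CP[C0 Cw]; rewrite (le_trans _ Cw)// lef_pV2 ?posrE ?lt_max ?C0//.
  by rewrite le_max lexx.
(* The n^2 Gram coefficients change the form on the unit sphere by at most n^2 eta, which this
   choice keeps within c0 / 2. *)
pose eta := c0 / (2 * (n * n)%:R + 1).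
have D0 : 0 < 2 * (n * n)%:R + 1 :> R by rewrite ltr_wpDl.
have eta0 : 0 < eta by rewrite divr_gt0.
have nG : \forall x \near x0, forall kl : 'I_n * 'I_n,
    `|gram i x0 kl.1 kl.2 - gram i x kl.1 kl.2| < eta.
  apply: (@filter_forall _ _ (fun (kl : 'I_n * 'I_n) x =>
    `|gram i x0 kl.1 kl.2 - gram i x kl.1 kl.2| < eta) (nbhs x0) _) => kl.
  have /cvgrPdist_lt/(_ _ eta0) := @metric_continuous _ _ _ _ g i (delta_mx 0 kl.1) (delta_mx 0 kl.2) x0 dx0.
  exact.
pose K := \sum_k \sum_l (`|gram i x0 k l| + eta).
have K0 : 0 <= K.
  by apply: sumr_ge0 => k _; apply: sumr_ge0 => l _; rewrite addr_ge0// ltW.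
have wkl (w : V) k l : `|w| = 1 -> `|w 0 k * w 0 l| <= 1.
  move=> w1; have wk j : `|w 0 j| <= 1 by rewrite -w1 rV_coord_le.
  by rewrite normrM mulr_ile1.
have Qx x (w : V) : (forall kl : 'I_n * 'I_n, `|gram i x0 kl.1 kl.2 - gram i x kl.1 kl.2| < eta) ->
    `|w| = 1 -> c0 / 2 <= quad i x w <= K.
  move=> Gx w1; apply/andP; split.
    have : `|quad i x0 w - quad i x w| <= \sum_(k < n) \sum_(l < n) eta.
      rewrite /quad -sumrB (le_trans (ler_norm_sum _ _ _))//; apply: ler_sum => k _.
      rewrite -sumrB (le_trans (ler_norm_sum _ _ _))//; apply: ler_sum => l _.
      rewrite -mulrBr normrM -[leRHS]mul1r ler_pM// ?wkl//.
      exact: ltW (Gx (k, l)).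
    under eq_bigr do rewrite sumr_const card_ord.
    rewrite sumr_const card_ord -mulrnA -[leRHS]mulr_natr.
    have : eta * (n * n)%:R <= c0 / 2.
      rewrite /eta mulrAC ler_pdivrMr// mulrDr mulr1 mulrA divfK//.
      by rewrite lerDl divr_ge0// ltW.
    have alg (q0 q1 k e : R) : k <= q0 -> e <= k / 2 -> `|q0 - q1| <= e -> k / 2 <= q1.
      by rewrite ler_norml => H1 H2 /andP[H3 H4]; lra.
    exact: alg (Q0 _ w1).
  apply: ler_sum => k _; apply: ler_sum => l _.
  rewrite (le_trans (ler_norm _))// normrM -[leRHS]mul1r ler_pM// ?wkl//.
  have := ltW (Gx (k, l)); rewrite /= distrC => G1.
  rewrite -(subrK (gram i x0 k l) (gram i x k l)) addrC (le_trans (ler_normD _ _))//.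
  by rewrite lerD2l.
pose c := Num.min (c0 / 2) (K + 1)^-1.
have cp : 0 < c by rewrite lt_min divr_gt0//= invr_gt0 ltr_wpDl.
exists c => //; apply: filterS nG => x Gx w.
have [->|w0] := eqVneq w 0.
  have -> : quad i x 0 = 0 by rewrite -(scale0r 0) quadZ expr0n mul0r.
  by rewrite normr0 expr0n !mulr0 lexx.
pose u := `|w|^-1 *: w.
have nw : 0 < `|w| by rewrite normr_gt0.
have u1 : `|u| = 1 by rewrite normrZ normfV normr_id mulVf ?gt_eqF.
have -> : w = `|w| *: u by rewrite scalerA divff ?scale1r ?gt_eqF.
rewrite quadZ normrZ normr_id u1 mulr1 ![_ * `|w| ^+ 2]mulrC.
have /andP[q1 q2] := Qx x u Gx u1.
rewrite !ler_pM2l ?exprn_gt0//; apply/andP; split.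
  by rewrite (le_trans _ q1)// ge_min lexx.
rewrite (le_trans q2)// (le_trans (_ : K <= K + 1))// ?lerDl//.
by rewrite -[leLHS]invrK lef_pV2 ?posrE ?invr_gt0 ?ltr_wpDl// ge_min lexx orbT.
Qed.

Lemma metric_compare i x0 : dom i x0 ->
  exists2 C, 0 < C & \forall x \near x0, forall v,
    `|tcoord i x v| <= C * tnorm g x v /\ tnorm g x v <= C * `|tcoord i x v|.
Proof.
move=> dx0; have [c c0 nQ] := quad_bound dx0.
have C0 : 0 < Num.sqrt c^-1 by rewrite sqrtr_gt0 invr_gt0.
exists (Num.sqrt c^-1) => //.
apply: filterS2 nQ (near_dom dx0) => x Qx dx v.
rewrite (tnormE v dx); have /andP[q1 q2] := Qx (tcoord i x v); set w := tcoord i x v in q1 q2 *.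
have Q0 := quad_ge0 i x w; rewrite -sqrtrM ?invr_ge0 ?(ltW c0)//.
have wE : `|w| = Num.sqrt (`|w| ^+ 2) by rewrite sqrtr_sqr normr_id.
split.
  by rewrite {1}wE ler_wsqrtr// -ler_pdivrMl ?invr_gt0// invrK.
by rewrite [X in _ <= _ * X]wE -sqrtrM ?invr_ge0 ?(ltW c0)// ler_wsqrtr.
Qed.

End Metric.

(** * Contact charts *)

Section Pieces.
Variables (R : realType) (m : nat) (M : topologicalType).
Variable A : smooth_atlas R m.*2.+1 M.
Local Notation V := 'rV[R]_(m.*2.+1).
Local Notation dom i := (chart_dom (s := A) i).
Local Notation ch i := (chart (s := A) i).
Local Notation inv i := (chart_inv (s := A) i).
Variable xi : subspace_field R m.*2.+1 M.

(* The norm of 'rV is the sup norm, so that the closed ball around pcenter is a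
   cube. *)
Record contact_piece := ContactPiece {
  pchart : chart_index A;
  popen : set V;
  pform : V -> 'cV[R]_(m.*2.+1);
  pcenter : V;
  pradius : R;
  pradius_gt0 : 0 < pradius;
  popen_open : open popen;
  pball_sub : forall y, `|y - pcenter| <= pradius -> popen y;
  popen_sub : popen `<=` ch pchart @` dom pchart;
  pform_C : forall k, C_on k popen pform;
  pform_nondeg : forall y, popen y -> \det (bordered (pform y) (dform_mx pform y)) != 0;
  pform_ker : forall x, dom pchart x -> popen (ch pchart x) -> forall v,
    v \in xi x <-> pairing (tcoord pchart x v) (pform (ch pchart x)) = 0
}.

(** The compact [body] yields uniform constants; the open [core] serves to cover M and to stay in a
    piece under small displacements. *)
Definition body p x := dom (pchart p) x /\ `|ch (pchart p) x - pcenter p| <= pradius p.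
Definition core p x := dom (pchart p) x /\ `|ch (pchart p) x - pcenter p| < pradius p.

Definition pcoord p x : V := ch (pchart p) x.
Definition pform_at p x := pform p (pcoord p x).
Definition pdform_at p x := dform_mx (pform p) (pcoord p x).

Lemma core_body p x : core p x -> body p x.
Proof. by case=> dx /ltW. Qed.

Lemma body_open p x : body p x -> popen p (pcoord p x).
Proof. by case=> _; exact: pball_sub. Qed.

Lemma pform_diff p y : popen p y -> differentiable (pform p) y.
Proof. by move=> Oy; have [dp _] := pform_C p 1; exact: dp. Qed.

Lemma exists_piece x : contact_structure A xi -> exists p, core p x.
Proof.
move=> [_ /(_ x) [i [W [a [[dx Ox] [oO sO] sa nd ker]]]]].
have [t t0 tO] := near_ball (open_nbhs_nbhs (conj oO Ox)).
have t20 : 0 < t / 2 by rewrite divr_gt0.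
have bO y : `|y - ch i x| <= t / 2 -> W y.
  by move=> yt; apply: tO; rewrite (le_lt_trans yt)// ltr_pdivrMr// ltr_pMr// ltr1n.
have nd' y : W y -> \det (bordered (a y) (dform_mx a y)) != 0.
  move=> Oy; have [v Wv] := nd y Oy; apply: contact_bordered; last exact: dform_mx_antisym.
  exists v; have da : differentiable a y by have [da _] := sa 1; exact: da.
  by rewrite -(extd_one_form da).
exists (ContactPiece t20 oO bO sO sa nd' ker).
by split=> //=; rewrite subrr normr0.
Qed.

Lemma core_near p x : core p x -> \forall x' \near x, core p x'.
Proof.
move=> [dx xr]; have nr : \forall y \near ch (pchart p) x, `|y - pcenter p| < pradius p.
  have c : {for ch (pchart p) x, continuous (fun y : V => `|y - pcenter p|)}.
    apply: (@continuous_comp _ _ _ (fun y : V => y - pcenter p) (fun y : V => `|y|)).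
      exact: (cvgB cvg_id (cvg_cst _)).
    exact: norm_continuous.
  exact: cvgr_lt c _ xr.
exact: filterS2 (near_dom dx) (near_chart dx nr) => x' d n; split.
Qed.

Lemma compact_ball (c : V) r : compact [set y | `|y - c| <= r].
Proof.
apply: bounded_closed_compact.
  exists (`|c| + r); split; first exact: num_real.
  move=> s rs y /= yr; apply: ltW; apply: le_lt_trans rs.
  by rewrite -(subrK c y) addrC (le_trans (ler_normD _ _))// lerD2l.
have -> : [set y : V | `|y - c| <= r] = (fun y : V => `|y - c|) @^-1` [set t | t <= r] by [].
apply: closed_comp => [y _|]; last exact: closed_le.
apply: (@continuous_comp _ _ _ (fun y : V => y - c) (fun y : V => `|y|)).
  exact: (cvgB cvg_id (cvg_cst _)).
exact: norm_continuous.
Qed.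

Lemma body_image p : body p = inv (pchart p) @` [set y | `|y - pcenter p| <= pradius p].
Proof.
apply/seteqP; split=> [x [dx xr]|x [y /= yr <-]].
  by exists (ch (pchart p) x) => //; rewrite chartK.
have [dy yE] := chart_invP (popen_sub (pball_sub yr)).
by split=> //; rewrite yE.
Qed.

Lemma compact_body p : compact (body p).
Proof.
rewrite body_image; apply: continuous_compact; last exact: compact_ball.
apply: continuous_in_subspaceT => y; rewrite inE /= => yr.
exact: (chart_inv_continuous (popen_sub (pball_sub yr))).
Qed.

End Pieces.

Section Step.
Variables (R : realType) (m : nat) (M : topologicalType).
Variable A : smooth_atlas R m.*2.+1 M.
Local Notation V := 'rV[R]_(m.*2.+1).
Local Notation dom i := (chart_dom (s := A) i).
Local Notation ch i := (chart (s := A) i).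
Local Notation inv i := (chart_inv (s := A) i).
Variable xi : subspace_field R m.*2.+1 M.
Local Notation piece := (contact_piece A xi).

Definition pjac (g : M -> M) (p p' : piece) x : 'M[R]_(m.*2.+1) :=
  'J (local_rep (A := A) g (pchart p) (pchart p')) (pcoord p x).

Lemma preserves_mem g (E : subspace_field R m.*2.+1 M) x v : preserves A g E ->
  v \in E x -> tmap A g x v \in E (g x).
Proof.
move=> gE vE; rewrite -gE; have := memv_img (linfun (tmap A g x)) vE.
by rewrite {1}/tmap lfunE.
Qed.

Lemma preserves_surj g (E : subspace_field R m.*2.+1 M) x w : preserves A g E ->
  w \in E (g x) -> exists2 v, v \in E x & w = tmap A g x v.
Proof.
move=> gE; rewrite -gE => /memv_imgP[v vE ->]; exists v => //.
by rewrite {1}/tmap lfunE.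
Qed.

Variables (f f' : M -> M).
Hypotheses (Cf : C_map A 2 f) (Cf' : C_map A 2 f').
Hypothesis fK : cancel f f'.

Lemma tcoord_pjac (p p' : piece) x v : dom (pchart p) x -> dom (pchart p') (f x) ->
  tcoord (pchart p') (f x) (tmap A f x v) = tcoord (pchart p) x v *m pjac f p p' x.
Proof. by move=> dx dfx; exact: (tcoord_tmap v Cf dx dfx). Qed.

Lemma pjac_unit (p p' : piece) x : dom (pchart p) x -> dom (pchart p') (f x) ->
  pjac f p p' x \in unitmx.
Proof.
move=> dx dfx; have dffx : dom (pchart p) (f' (f x)) by rewrite fK.
suff E : pjac f p p' x *m pjac f' p' p (f x) = 1%:M.
  have [H _] := mulmx1_unit E; exact: H.
apply/row_matrixP => k; rewrite !rowE mulmxA mulmx1.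
set v := delta_mx 0 k; rewrite -(tvecK v dx) -(tcoord_pjac _ dx dfx).
rewrite -(tcoord_tmap _ Cf' dfx dffx).
by rewrite (tmap_cancel _ _ Cf Cf' fK) fK.
Qed.

Hypothesis fxi : preserves A f xi.

(** An instance of [pullback_dform] in charts. Each piece has its own form, so [h] depends on the
    pair of pieces and its sign is immaterial. It does not vanish, because the Jacobian is
    invertible and the form at [f x] is nonzero. *)
Lemma contact_step (p p' : piece) x : body p x -> body p' (f x) ->
  exists h b, [/\ h != 0, pjac f p p' x *m pform_at p' (f x) = h *: pform_at p x &
    pjac f p p' x *m pdform_at p' (f x) *m (pjac f p p' x)^T =
      h *: pdform_at p x + (b *m (pform_at p x)^T - pform_at p x *m b^T)].
Proof.
move=> bx bfx; have [dx _] := bx; have [dfx _] := bfx.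
have Ox := body_open bx; have Ofx := body_open bfx.
set i := pchart p in dx Ox *; set i' := pchart p' in dfx Ofx *.
have nP : \forall x' \near x, [/\ dom i' (f x'), popen p (ch i x') & popen p' (ch i' (f x'))].
  have n1 : \forall x' \near x, popen p (ch i x').
    by apply: near_chart dx _; apply: open_nbhs_nbhs; split; [exact: popen_open|].
  have n2 : \forall y \near f x, dom i' y /\ popen p' (ch i' y).
    apply: near_and; first exact: near_dom.
    by apply: near_chart dfx _; apply: open_nbhs_nbhs; split; [exact: popen_open|].
  have n2' : \forall x' \near x, dom i' (f x') /\ popen p' (ch i' (f x')) by exact: Cf.1 n2.
  by apply: filterS2 n1 n2' => x' O1 [d2 O2]; split.
have nQ := near_chart_inv dx nP.
have [U [oU Ux] CU] := local_rep_domain Cf dx dfx.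
(* Coordinates of points that stay, together with their images, inside both charts and both domains
   of forms; the interior is taken because [pullback_dform] works on an open set. *)
pose Q : set V := fun y => [/\ dom i (inv i y), ch i (inv i y) = y &
  [/\ dom i' (f (inv i y)), popen p (ch i (inv i y)) & popen p' (ch i' (f (inv i y)))]].
pose U2 := U `&` Q^°.
have oU2 : open U2 by apply: openI => //; exact: open_interior.
have U2x : U2 (ch i x) by split=> //; exact: nQ.
have QU z : U2 z -> Q z by move=> [_ /interior_subset].
have repx : local_rep (A := A) f i i' (ch i x) = ch i' (f x) by rewrite /local_rep /= chartK.
have nd' := pform_nondeg Ofx.
have a0 : pform p (ch i x) != 0 by apply: bordered_neq0 (pform_nondeg Ox).
have [|||h [b [E1 E2]]] := @pullback_dform R _ (local_rep (A := A) f i i') U2 (pform p) (pform p') (ch i x) oU2 U2x (C_on_sub (@subIsetl _ U _) CU) _ _ a0.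
- by move=> z /QU[_ zE [_ + _]]; rewrite zE => /pform_diff.
- by move=> z /QU[_ zE [_ _ /pform_diff]].
- move=> z U2z v va; have [dz zE [dfz Oz Ofz]] := QU z U2z.
  set x' := inv i z in dz zE dfz Oz Ofz.
  have v0 : tvec i x' v \in xi x'.
    by apply/(pform_ker dz Oz); rewrite tvecK// zE.
  have := preserves_mem fxi v0.
  move=> /(pform_ker dfz Ofz); rewrite (tcoord_tmap _ Cf dz dfz) tvecK//.
  rewrite -deriveEjacobian; last exact: local_rep_differentiable Cf dz dfz.
  by rewrite zE.
rewrite repx in E1 E2; exists h, b; split=> //.
apply: contraTneq (pjac_unit dx dfx) => h0.
rewrite h0 scale0r in E1; apply/negP => uL; move/eqP: (bordered_neq0 nd'); apply.
by rewrite -(mulKmx uL (pform p' _)) -/i' E1 mulmx0.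
Qed.

End Step.

Section Constants.
Variables (R : realType) (m : nat) (M : topologicalType).
Variable A : smooth_atlas R m.*2.+1 M.
Local Notation V := 'rV[R]_(m.*2.+1).
Local Notation ch i := (chart (s := A) i).
Variable xi : subspace_field R m.*2.+1 M.
Local Notation piece := (contact_piece A xi).
Variable g : continuous_metric A.

(** One constant bounds everything, in a form that survives enlarging it; finitely many pieces then
    have a common constant. *)
Definition bounded_geometry C (p : piece) := 0 < C /\ forall x, body p x ->
  [/\ forall v, `|tcoord (pchart p) x v| <= C * tnorm g x v /\
        tnorm g x v <= C * `|tcoord (pchart p) x v|,
      forall i, `|pform_at p x i 0| <= C,
      forall i j, `|pdform_at p x i j| <= C &
      C^-1 <= `|\det (bordered (pform_at p x) (pdform_at p x))| <= C].

Lemma tnorm_ge0 x v : 0 <= tnorm g x v.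
Proof. exact: sqrtr_ge0. Qed.

Lemma bounded_geometryS C C' p : C <= C' -> bounded_geometry C p -> bounded_geometry C' p.
Proof.
move=> CC' [C0 H]; have C'0 := lt_le_trans C0 CC'; split=> // x /H[H1 H2 H3 /andP[H4 H5]].
split=> [v|i|i j|].
- have [h1 h2] := H1 v; split.
    by rewrite (le_trans h1)// ler_wpM2r// tnorm_ge0.
  by rewrite (le_trans h2)// ler_wpM2r.
- exact: le_trans (H2 i) CC'.
- exact: le_trans (H3 i j) CC'.
- by rewrite (le_trans _ H4) ?(le_trans H5)// lef_pV2.
Qed.

Lemma pform_continuous (p : piece) x i : body p x ->
  {for x, continuous (fun y => pform_at p y i 0)}.
Proof.
move=> bx; have [dx _] := bx; have c1 := C_on_continuous (pform_C p 0) (body_open bx).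
apply: (@continuous_comp _ _ _ (ch (pchart p)) (fun z => pform p z i 0)).
  exact: chart_continuous.
exact: (continuous_comp c1 (@coord_continuous R _ _ i 0 _)).
Qed.

Lemma pdform_continuous (p : piece) x i j : body p x ->
  {for x, continuous (fun y => pdform_at p y i j)}.
Proof.
move=> bx; have [dx _] := bx; have [_ c1] := pform_C p 1.
apply: (@continuous_comp _ _ _ (ch (pchart p)) (fun z => dform_mx (pform p) z i j)).
  exact: chart_continuous.
have c k l : {for pcoord p x, continuous (fun z => ('D_(delta_mx 0 k) (pform p) z) l 0)}.
  exact: (continuous_comp (c1 (delta_mx 0 k) _ (body_open bx)) (@coord_continuous R _ _ l 0 _)).
have -> : (fun z => dform_mx (pform p) z i j) = (fun z =>
  ('D_(delta_mx 0 i) (pform p) z) j 0 - ('D_(delta_mx 0 j) (pform p) z) i 0).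
  by apply/funext => z; exact: dform_mx_entry.
exact: (cvgB (c i j) (c j i)).
Qed.

Lemma det_continuous (p : piece) x : body p x ->
  {for x, continuous (fun y => \det (bordered (pform_at p y) (pdform_at p y)))}.
Proof.
move=> bx; apply: continuous_det => i j.
pose B y := bordered (pform_at p y) (pdform_at p y).
suff : {for x, continuous (fun y => B y i j)} by [].
case: (split_ordP i) => k ->; case: (split_ordP j) => l ->.
- have -> : (fun y => B y (lshift _ k) (lshift _ l)) = cst 0.
    by apply/funext => y; rewrite /B /bordered block_mxEul mxE.
  exact: cvg_cst.
- have -> : (fun y => B y (lshift _ k) (rshift _ l)) = fun y => pform_at p y l 0.
    by apply/funext => y; rewrite /B /bordered block_mxEur mxE ord1.
  exact: pform_continuous.
- have -> : (fun y => B y (rshift _ k) (lshift _ l)) = fun y => 0 - pform_at p y k 0.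
    by apply/funext => y; rewrite /B /bordered block_mxEdl mxE ord1 sub0r.
  apply: (@cvgB R R^o); [exact: cvg_cst|exact: pform_continuous].
- have -> : (fun y => B y (rshift _ k) (rshift _ l)) = fun y => pdform_at p y k l.
    by apply/funext => y; rewrite /B /bordered block_mxEdr.
  exact: pdform_continuous.
Qed.

Lemma exists_bounded_geometry p : exists C, bounded_geometry C p.
Proof.
have cb : compact (body p) by exact: compact_body.
have [||C1 H1] := compact_uniform (P := fun C x => 0 <= C /\ forall v,
  `|tcoord (pchart p) x v| <= C * tnorm g x v /\
        tnorm g x v <= C * `|tcoord (pchart p) x v|) cb.
- move=> C C' x CC' [C0 H]; split=> [|v]; first exact: le_trans CC'.
  have [h1 h2] := H v; split.
    by rewrite (le_trans h1)// ler_wpM2r// tnorm_ge0.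
  by rewrite (le_trans h2)// ler_wpM2r.
- move=> x0 [dx0 _]; have [C C0 nC] := metric_compare g dx0; exists C.
  by apply: filterS nC => x Hx _; split=> //; exact: ltW.
have [|C2 H2] := compact_bounded_fun (g := fun x => \sum_i `|pform_at p x i 0|) cb.
  move=> x bx; apply: (cvg_big (@add_continuous R)) => i _.
  by apply: (@cvg_norm R R^o); exact: pform_continuous.
have [|C3 H3] := compact_bounded_fun (g := fun x => \sum_i \sum_j `|pdform_at p x i j|) cb.
  move=> x bx; apply: (cvg_big (@add_continuous R)) => i _.
  apply: (cvg_big (@add_continuous R)) => j _.
  by apply: (@cvg_norm R R^o); exact: pdform_continuous.
have [C4 H4] := compact_bounded_fun cb (@det_continuous p).
have [|C5 H5] := compact_bounded_fun
    (g := fun x => (\det (bordered (pform_at p x) (pdform_at p x)))^-1) cb.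
  move=> x bx; apply: cvgV; last exact: det_continuous.
  exact: pform_nondeg (body_open bx).
pose C := `|C1| + `|C2| + `|C3| + `|C4| + `|C5| + 1.
have Cpos : [/\ 0 <= `|C1|, 0 <= `|C2|, 0 <= `|C3|, 0 <= `|C4| & 0 <= `|C5|] by [].
have Cge : [/\ C1 <= `|C1|, C2 <= `|C2|, C3 <= `|C3|, C4 <= `|C4| & C5 <= `|C5|].
  by split; exact: ler_norm.
have C0 : 0 < C by rewrite /C; case: Cpos => *; lra.
have [l1 l2 l3 l4 l5] : [/\ C1 <= C, C2 <= C, C3 <= C, C4 <= C & C5 <= C].
  case: Cpos Cge => p1 p2 p3 p4 p5 [g1 g2 g3 g4 g5]; rewrite /C.
  by split; rewrite -?addrA; lra.
exists C; split=> // x bx; split=> [v|i|i j|].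
- have [C10 /(_ v)[h1 h2]] := H1 x bx; split.
    by rewrite (le_trans h1)// ler_wpM2r// tnorm_ge0.
  by rewrite (le_trans h2)// ler_wpM2r.
- apply: le_trans l2; apply: le_trans (H2 x bx); apply: le_trans (ler_norm _).
  by rewrite (bigD1 i)//= lerDl sumr_ge0.
- apply: le_trans l3; apply: le_trans (H3 x bx); apply: le_trans (ler_norm _).
  rewrite (bigD1 i)//= (bigD1 j)//= -addrA lerDl addr_ge0 ?sumr_ge0//.
  by move=> k _; rewrite sumr_ge0.
- have d0 := pform_nondeg (body_open bx).
  rewrite (le_trans (H4 x bx) l4) andbT -[leRHS]invrK lef_pV2 ?posrE ?invr_gt0 ?normr_gt0//.
  by rewrite -normfV (le_trans (H5 x bx)).
Qed.

(** Quantitative version of: E x is not contained in xi x. A single vector suffices, since the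
    factor relating two proportional 1-forms can be read off on any vector outside the kernel. *)
Definition transversal (E : subspace_field R m.*2.+1 M) C (p : piece) x :=
  exists v, [/\ v \in E x, 0 < `|tcoord (pchart p) x v| &
    `|tcoord (pchart p) x v| <= C * `|pairing (tcoord (pchart p) x v) (pform_at p x)| ].

(** The vector [v0] extends to a continuous section of E. Near x0 the form stays away from 0 on it
    and its norm stays bounded; the quotient of these two bounds is the constant. *)
Lemma transversal_local E p x0 v0 : continuous_subspace_field A E -> body p x0 ->
  v0 \in E x0 -> v0 \notin xi x0 -> exists C, \forall x \near x0, transversal E C p x.
Proof.
move=> cE bx0 v0E v0xi; have [dx0 _] := bx0.
have [w [cw w0 nw]] := continuous_section cE dx0 v0E.
pose q x := pairing (w x) (pform_at p x).
have q0 : q x0 != 0.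
  apply: contraNneq v0xi => q0; apply/(pform_ker dx0 (body_open bx0)).
  by rewrite -w0; exact: q0.
have cq : {for x0, continuous q}.
  have -> : q = fun x => \sum_i w x 0 i * pform_at p x i 0.
    by apply/funext => x; exact: pairingE.
  apply: (cvg_big (@add_continuous R)) => i _; apply: cvgM; last exact: pform_continuous.
  exact: (continuous_comp cw (@coord_continuous R 1 _ 0 i _)).
have cqn : {for x0, continuous (fun x => `|q x|)}.
  by apply: (@cvg_norm R R^o); exact: cq.
have cwn : {for x0, continuous (fun x => `|w x|)}.
  by apply: (@cvg_norm R V); exact: cw.
have q00 : 0 < `|q x0| by rewrite normr_gt0.
have nq : \forall x \near x0, `|q x0| / 2 < `|q x|.
  by apply: cvgr_gt cqn _ _; lra.
have nww : \forall x \near x0, `|w x| < `|w x0| + 1.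
  by apply: cvgr_lt cwn _ _; rewrite ltrDl.
exists ((`|w x0| + 1) / (`|q x0| / 2)).
apply: filterS (near_and (near_and nw (near_dom dx0)) (near_and nq nww)) => x [[wE dx] [qx wx]].
exists (tvec (pchart p) x (w x)); rewrite tvecK//; split=> //.
  rewrite normr_gt0; apply/eqP => wx0; have qx0 : q x = 0 by rewrite /q wx0 /pairing mul0mx mxE.
  move: qx; rewrite qx0 normr0.
  by apply/negP; rewrite -leNgt divr_ge0.
rewrite -/(q x) mulrAC ler_pdivlMr ?divr_gt0//.
by rewrite ler_pM// ?divr_ge0 ?(ltW qx)// ltW.
Qed.

(** The second alternative disposes of points with a neighbourhood free of [Q]. The lemma serves for
    Eu, with [Q] the inclusion of Es in xi, and for Es, with [Q] the property [thin]. *)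
Lemma uniform_transversal E p (Q : M -> Prop) : continuous_subspace_field A E ->
  (forall x0, body p x0 -> (exists2 v0, v0 \in E x0 & v0 \notin xi x0) \/
    \forall x \near x0, body p x -> ~ Q x) ->
  exists C, forall x, body p x -> Q x -> transversal E C p x.
Proof.
move=> cE H.
apply: (compact_uniform (P := fun C x => Q x -> transversal E C p x) (@compact_body _ _ _ _ _ p)).
  move=> C C' x CC' P Qx; have [v [vE v0 vC]] := P Qx; exists v; split=> //.
  by rewrite (le_trans vC)// ler_wpM2r.
move=> x0 bx0; have [[v0 v0E v0xi]|nQ] := H x0 bx0.
  have [C nC] := transversal_local cE bx0 v0E v0xi; exists C.
  by apply: filterS nC => x.
by exists 0; apply: filterS nQ => x nQx bx /(nQx bx).
Qed.

End Constants.

(** * Growth along orbits *)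

Section Orbit.
Variables (R : realType) (m : nat) (M : topologicalType).
Variable A : smooth_atlas R m.*2.+1 M.
Local Notation d := m.*2.+1.
Local Notation V := 'rV[R]_d.
Variable xi : subspace_field R d M.
Local Notation piece := (contact_piece A xi).
Variable g : continuous_metric A.
Variables (f f' : M -> M).
Hypotheses (Cf : C_map A 2 f) (Cf' : C_map A 2 f').
Hypothesis fK : cancel f f'.
Hypothesis fxi : preserves A f xi.
Variable x0 : M.

Local Notation orb n := (iter n f x0).

(** The differential of f^n at x0, built step by step so that invariance and the one-step estimates
    of the splitting pass to it by induction. *)
Fixpoint tmap_iter n (v : V) : V :=
  match n with 0 => v | n'.+1 => tmap A f (orb n') (tmap_iter n' v) end.

Lemma tmap_iter_mem (E : subspace_field R d M) n v : preserves A f E -> v \in E x0 ->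
  tmap_iter n v \in E (orb n).
Proof. by move=> fE vE; elim: n => [//|n IH] /=; exact: preserves_mem. Qed.

Lemma tmap_iter_surj (E : subspace_field R d M) n w : preserves A f E -> w \in E (orb n) ->
  exists2 v, v \in E x0 & tmap_iter n v = w.
Proof.
move=> fE; elim: n w => [|n IH] w; first by exists w.
by move=> /= /(preserves_surj fE)[u /IH[v vE <-] ->]; exists v.
Qed.

Lemma tmap_iter_contract (E : subspace_field R d M) lam n v : 0 < lam -> preserves A f E ->
  (forall x v, v \in E x -> tnorm g (f x) (tmap A f x v) <= lam * tnorm g x v) ->
  v \in E x0 -> tnorm g (orb n) (tmap_iter n v) <= lam ^+ n * tnorm g x0 v.
Proof.
move=> l0 fE H vE; elim: n => [|n IH] /=; first by rewrite expr0 mul1r.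
rewrite (le_trans (H _ _ (tmap_iter_mem n fE vE)))// exprS -mulrA ler_wpM2l// ltW//.
Qed.

Lemma tmap_iter_expand (E : subspace_field R d M) lam n v : 0 < lam -> preserves A f E ->
  (forall x v, v \in E x -> tnorm g (f' x) (tmap A f' x v) <= lam * tnorm g x v) ->
  v \in E x0 -> tnorm g x0 v <= lam ^+ n * tnorm g (orb n) (tmap_iter n v).
Proof.
move=> l0 fE H vE; elim: n => [|n IH] /=; first by rewrite expr0 mul1r.
rewrite (le_trans IH)// exprSr -mulrA ler_wpM2l ?exprn_ge0 ?(ltW l0)//.
have := H _ _ (tmap_iter_mem n.+1 fE vE) => /=.
by rewrite (tmap_cancel _ _ Cf Cf' fK) fK.
Qed.

Variable k : nat -> piece.
Hypothesis bk : forall n, body (k n) (orb n).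

(** The differential of f^n read in the pieces [k 0] and [k n]. Tangent vectors are rows, so the
    first step is the leftmost factor. *)
Fixpoint jprod n : 'M[R]_d :=
  match n with 0 => 1%:M | n'.+1 => jprod n' *m pjac f (k n') (k n'.+1) (orb n') end.

Lemma tcoord_tmap_iter n v : tcoord (pchart (k n)) (orb n) (tmap_iter n v) =
  tcoord (pchart (k 0)) x0 v *m jprod n.
Proof.
elim: n => [|n IH]; first by rewrite mulmx1.
by rewrite /= mulmxA -IH; apply: (tcoord_pjac Cf); [exact: (bk n).1|exact: (bk n.+1).1].
Qed.

(* h is the factor in (f^n)^* alpha = h alpha. *)
Lemma orbit_forms n : exists h b, [/\ h != 0,
  jprod n *m pform_at (k n) (orb n) = h *: pform_at (k 0) x0 &
  jprod n *m pdform_at (k n) (orb n) *m (jprod n)^T = h *: pdform_at (k 0) x0 +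
    (b *m (pform_at (k 0) x0)^T - pform_at (k 0) x0 *m b^T)].
Proof.
elim: n => [|n [h [b [h0 E1 E2]]]].
  exists 1, 0; rewrite oner_neq0 /= !mul1mx trmx1 mulmx1 !scale1r.
  by rewrite mul0mx trmx0 mulmx0 subr0 addr0.
have [h' [b' [h'0 F1 F2]]] := contact_step Cf Cf' fK fxi (bk n) (bk n.+1).
(* Leibniz rule: the factor of f^(n+1) has differential h' dh + h dh', with dh' pulled back by
   f^n. *)
exists (h' * h), (h' *: b + h *: (jprod n *m b')); split; first by rewrite mulf_neq0.
  by rewrite /= -mulmxA F1 -scalemxAr E1 scalerA.
rewrite /= trmx_mul.
set a0 := pform_at (k 0) x0 in E1 E2 *; set P := jprod n in E1 E2 *.
set L := pjac _ _ _ _ in F1 F2 *.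
rewrite [LHS](_ : _ = P *m (L *m pdform_at (k n.+1) (f (orb n)) *m L^T) *m P^T); last first.
  by rewrite !mulmxA.
rewrite F2 mulmxDr mulmxBr mulmxDl mulmxBl -!scalemxAr -!scalemxAl E2.
rewrite [P *m (b' *m _)]mulmxA -[_ *m _^T *m P^T]mulmxA -trmx_mul E1.
rewrite [P *m (_ *m b'^T)]mulmxA E1 -[_ *m b'^T *m P^T]mulmxA -trmx_mul.
rewrite scalerDr scalerA -addrA; congr (_ + _).
have -> : (h' *: b + h *: (P *m b'))^T = h' *: b^T + h *: (P *m b')^T.
  by rewrite linearD !linearZ.
have -> : (h *: a0)^T = h *: a0^T by rewrite linearZ.
rewrite mulmxDl mulmxDr -!scalemxAl -!scalemxAr.
by rewrite scalerBr opprD addrACA.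
Qed.

Lemma iter_continuous n : continuous (iter n f).
Proof.
elim: n => [|n IH] x; first exact: cvg_id.
exact: (continuous_comp (IH x) (Cf.1 _)).
Qed.

Lemma jprod_strict_diff n :
  strict_diff (local_rep (A := A) (iter n f) (pchart (k 0)) (pchart (k n))) (pcoord (k 0) x0) (jprod n).
Proof.
elim: n => [|n IH].
  apply: strict_diff_near (@strict_diff_id _ _ _).
  by apply: filterS (near_chart_inv (bk 0).1 (@filterT _ (nbhs x0) _)) => z [_ zE _].
have [d0 _] := bk 0; have [dn _] := bk n; have [dn1 _] := bk n.+1.
have repx : local_rep (A := A) (iter n f) (pchart (k 0)) (pchart (k n)) (pcoord (k 0) x0) =
    pcoord (k n) (orb n) by rewrite /local_rep /= chartK.
have [U [oU Ux] CU] := local_rep_domain Cf dn dn1.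
have sd := C1_strict_diff oU Ux (C_onS CU).
have sd2 : strict_diff (local_rep (A := A) f (pchart (k n)) (pchart (k n.+1)))
    (local_rep (A := A) (iter n f) (pchart (k 0)) (pchart (k n)) (pcoord (k 0) x0))
    (pjac f (k n) (k n.+1) (orb n)) by rewrite repx; exact: sd.
apply: strict_diff_near (strict_diff_comp IH sd2).
exact: local_rep_comp_near (@iter_continuous n x0) d0 dn.
Qed.

End Orbit.

Lemma norm_det_eq (R : realDomainType) n (p q D D' : R) : p ^+ 2 * D = q ^+ n * D' ->
  p ^+ 2 * `|D| = `|q| ^+ n * `|D'|.
Proof.
move=> /(congr1 Num.norm); rewrite [`|p ^+ 2 * D|]normrM [`|_ * D'|]normrM.
by rewrite [`|p ^+ 2|]normrX [`|q ^+ _|]normrX real_normK ?num_real.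
Qed.

Lemma div_mul_le (R : realFieldType) (p q c : R) : 0 < c -> p * c^-1 <= q * c ->
  p <= c ^+ 2 * q.
Proof. by move=> c0; rewrite ler_pdivrMr// -mulrA -expr2 mulrC. Qed.

Section Growth.
Variables (R : realType) (m : nat) (M : topologicalType).
Variable A : smooth_atlas R m.*2.+1 M.
Local Notation d := m.*2.+1.
Local Notation V := 'rV[R]_d.
Variable xi : subspace_field R d M.
Local Notation piece := (contact_piece A xi).
Variable g : continuous_metric A.
Variables (f f' : M -> M).
Hypotheses (Cf : C_map A 2 f) (Cf' : C_map A 2 f').
Hypothesis fK : cancel f f'.
Hypothesis fxi : preserves A f xi.
Variables (Es Eu : subspace_field R d M) (lam : R).
Hypotheses (lam0 : 0 < lam) (fEs : preserves A f Es) (fEu : preserves A f Eu).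
Hypothesis contr : forall x v, v \in Es x -> tnorm g (f x) (tmap A f x v) <= lam * tnorm g x v.
Hypothesis expa : forall x v, v \in Eu x -> tnorm g (f' x) (tmap A f' x v) <= lam * tnorm g x v.
Variable x0 : M.
Local Notation orb n := (iter n f x0).
Variable k : nat -> piece.
Hypothesis bk : forall n, body (k n) (orb n).
Variable C : R.
Hypothesis Ck : forall n, bounded_geometry g C (k n).

Local Notation tc n v := (tcoord (pchart (k n)) (orb n) v).
Local Notation a n := (pform_at (k n) (orb n)).
Local Notation B n := (pdform_at (k n) (orb n)).
Local Notation P n := (jprod f x0 k n).

Let C0 : 0 < C := (Ck 0).1.

Lemma pairing_bound n v : `|pairing v (a n)| <= d%:R * C * `|v|.
Proof.
have [_ /(_ _ (bk n))[_ aC _ _]] := Ck n.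
have aC' i j : `|a n i j| <= C by rewrite ord1.
have := norm_mulmx_le (ltW C0) aC' (lexx `|v|); apply: le_trans; exact: rV_coord_le.
Qed.

Lemma bilinear_bound n (v w : V) : `|(v *m B n *m w^T) 0 0| <= (d%:R * C * `|v|) * (d%:R * `|w|).
Proof.
have [_ /(_ _ (bk n))[_ _ BC _]] := Ck n.
have wT i j : `|w^T i j| <= `|w| by rewrite mxE ord1 rV_coord_le.
have := norm_mulmx_le (normr_ge0 w) wT (norm_mulmx_le (ltW C0) BC (lexx `|v|)).
rewrite [leRHS]mulrC; apply: le_trans; exact: rV_coord_le.
Qed.

Lemma tc_le n v : `|tc n v| <= C * tnorm g (orb n) v.
Proof. by have [_ /(_ _ (bk n))[/(_ v)[]]] := Ck n. Qed.

Lemma tc_ge n v : tnorm g (orb n) v <= C * `|tc n v|.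
Proof. by have [_ /(_ _ (bk n))[/(_ v)[]]] := Ck n. Qed.

(** Passing between chart norm and metric norm costs a factor C at each end of the orbit segment and
    nothing in between, so the constant does not grow with n. *)
Lemma stable_bound n v : v \in Es x0 -> `|tc 0 v *m P n| <= C ^+ 2 * lam ^+ n * `|tc 0 v|.
Proof.
move=> vE; rewrite -(tcoord_tmap_iter Cf bk) (le_trans (tc_le n _))// expr2 -!mulrA ler_wpM2l ?(ltW C0)//.
have H : tnorm g (orb n) (tmap_iter A f x0 n v) <= lam ^+ n * tnorm g x0 v.
  exact: tmap_iter_contract vE.
rewrite (le_trans H)// mulrCA ler_wpM2l ?exprn_ge0 ?(ltW lam0)//.
exact: tc_ge 0 v.
Qed.

Lemma unstable_bound n v : v \in Eu x0 -> `|tc 0 v| <= C ^+ 2 * lam ^+ n * `|tc 0 v *m P n|.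
Proof.
move=> vE; rewrite -(tcoord_tmap_iter Cf bk) (le_trans (tc_le 0 _))// expr2 -!mulrA ler_wpM2l ?(ltW C0)//.
have H : tnorm g x0 v <= lam ^+ n * tnorm g (orb n) (tmap_iter A f x0 n v).
  exact: (tmap_iter_expand Cf Cf' fK n lam0 fEu expa vE).
rewrite (le_trans H)// mulrCA ler_wpM2l ?exprn_ge0 ?(ltW lam0)//.
exact: tc_ge.
Qed.

(** On the image of a transversal v in Es the form at time n takes the value h alpha(v), while that
    image is of order lam^n. In the constant, d C bounds the form, C^2 comes from [stable_bound] and
    the last C from transversality. *)
Lemma factor_upper n h : P n *m a n = h *: a 0 -> transversal Es C (k 0) x0 ->
  `|h| <= d%:R * C ^+ 4 * lam ^+ n.
Proof.
move=> E [v [vE v0 vC]].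
have E1 : pairing (tc 0 v *m P n) (a n) = h * pairing (tc 0 v) (a 0).
  by rewrite /pairing -mulmxA E -scalemxAr mxE.
have b0 : 0 < `|pairing (tc 0 v) (a 0)|.
  by rewrite -(pmulr_rgt0 _ C0); exact: lt_le_trans vC.
rewrite -(ler_pM2r b0) -normrM -E1 (le_trans (pairing_bound n _))//.
have dC : 0 <= d%:R * C by rewrite mulr_ge0 ?(ltW C0).
rewrite (le_trans (ler_wpM2l dC (stable_bound n vE)))//.
have K0 : 0 <= C ^+ 2 * lam ^+ n by rewrite mulr_ge0 ?exprn_ge0 ?(ltW C0) ?(ltW lam0).
rewrite (le_trans (ler_wpM2l dC (ler_wpM2l K0 vC)))//.
rewrite [leLHS](_ : _ = d%:R * C ^+ 4 * lam ^+ n * `|pairing (tc 0 v) (a 0)|) ?lexx//.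
by move: (`|_|) (lam ^+ n) => b l; ring.
Qed.

(** Mirror image of [factor_upper]: a transversal vector of Eu at the end of the orbit segment is
    pulled back to x0, where it has shrunk by the order of lam^n and the form is bounded. *)
Lemma factor_lower n h : P n *m a n = h *: a 0 -> transversal Eu C (k n) (orb n) ->
  1 <= `|h| * (d%:R * C ^+ 4 * lam ^+ n).
Proof.
move=> E [u [uE u0 uC]].
have [v vE vu] := tmap_iter_surj fEu uE.
have tcu : tc n u = tc 0 v *m P n by rewrite -vu (tcoord_tmap_iter Cf bk).
rewrite tcu in u0 uC.
have E1 : pairing (tc 0 v *m P n) (a n) = h * pairing (tc 0 v) (a 0).
  by rewrite /pairing -mulmxA E -scalemxAr mxE.
rewrite E1 normrM in uC.
have Ch : 0 <= C * `|h| by rewrite mulr_ge0 ?(ltW C0).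
have dC : 0 <= d%:R * C by rewrite mulr_ge0 ?(ltW C0).
rewrite -(ler_pM2r u0) mul1r (le_trans uC)// mulrA.
rewrite (le_trans (ler_wpM2l Ch (pairing_bound 0 _)))//.
rewrite (le_trans (ler_wpM2l Ch (ler_wpM2l dC (unstable_bound n vE))))//.
rewrite [leLHS](_ : _ = `|h| * (d%:R * C ^+ 4 * lam ^+ n) * `|tc 0 v *m P n|) ?lexx//.
by move: (`|h|) (`|_|) (lam ^+ n) => b c l; ring.
Qed.

(* Along the orbit the factor of f^n grows, as Eu is transversal to xi, while
   d alpha (Df^n v, Df^n w) tends to 0. *)
Lemma stable_isotropic v w : lam < 1 -> (forall n, transversal Eu C (k n) (orb n)) ->
  (Es x0 <= xi x0)%VS -> v \in Es x0 -> w \in Es x0 ->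
  (tc 0 v *m B 0 *m (tc 0 w)^T) 0 0 = 0.
Proof.
move=> lam1 trE sub vE wE.
have ker u : u \in Es x0 -> tc 0 u *m a 0 = 0.
  move=> /(subvP sub) uxi; apply/matrixP => i j; rewrite !ord1 [RHS]mxE.
  exact/(pform_ker (bk 0).1 (body_open (bk 0))).
set z := (_ *m _ *m _) 0 0.
pose K := (d%:R * C ^+ 4) * ((d%:R * C) * d%:R * C ^+ 4 * `|tc 0 v| * `|tc 0 w|).
have bound n : `|z| <= K * lam ^+ n.
  have [h [b [h0 E1 E2]]] := orbit_forms Cf Cf' fK fxi bk n.
  have l01 : 0 <= lam ^+ n <= 1 by rewrite exprn_ge0 ?exprn_ile1 ?(ltW lam0) ?ltW.
  have zE : h * z = (tc 0 v *m P n *m B n *m (tc 0 w *m P n)^T) 0 0.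
    have -> : tc 0 v *m P n *m B n *m (tc 0 w *m P n)^T =
        tc 0 v *m (P n *m B n *m (P n)^T) *m (tc 0 w)^T by rewrite trmx_mul !mulmxA.
    (* The terms in b vanish because v and w are in the kernel of alpha. *)
    rewrite E2 mulmxDr mulmxDl mulmxBr mulmxBl.
    rewrite [tc 0 v *m (a 0 *m _)]mulmxA ker// !mul0mx subr0 [_ *m (b *m _)]mulmxA.
    by rewrite -[_ *m (a 0)^T *m _]mulmxA -trmx_mul ker// trmx0 mulmx0 addr0 -scalemxAr -scalemxAl [RHS]mxE.
  have low := factor_lower E1 (trE n).
  have zb : `|h| * `|z| <= d%:R * C * (C ^+ 2 * lam ^+ n * `|tc 0 v|) *
      (d%:R * (C ^+ 2 * lam ^+ n * `|tc 0 w|)).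
    rewrite -normrM zE (le_trans (bilinear_bound n _ _))//.
    by rewrite ler_pM ?mulr_ge0 ?(ltW C0)// ler_wpM2l ?mulr_ge0 ?(ltW C0)// stable_bound.
  have q0 : 0 <= d%:R * C ^+ 4 * lam ^+ n.
    by rewrite !mulr_ge0 ?exprn_ge0 ?(ltW C0) ?(ltW lam0).
  rewrite -[`|z|]mul1r (le_trans (ler_wpM2r (normr_ge0 z) low))//.
  rewrite mulrAC mulrC (le_trans (ler_wpM2l q0 zb))//.
  (* The decay is in fact lam^(3n), two powers from v and w and one from 1 / |h|; the surplus
     lam^(2n) <= 1 is dropped. *)
  rewrite [leLHS](_ : _ = K * lam ^+ n * (lam ^+ n * lam ^+ n)); last first.
    by rewrite /K; move: (`|tc 0 v|) (`|tc 0 w|) (lam ^+ n) => r s l; ring.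
  have K0 : 0 <= K * lam ^+ n.
    by rewrite /K !mulr_ge0 ?exprn_ge0 ?(ltW C0) ?(ltW lam0).
  by rewrite -[leRHS]mulr1 ler_wpM2l// mulr_ile1//; case/andP: l01.
have cv : (fun n => K * lam ^+ n) @ \oo --> (K * 0 : R).
  apply: cvgM; first exact: cvg_cst.
  by apply: cvg_expr; rewrite gtr0_norm.
apply/eqP; rewrite -normr_le0; rewrite mulr0 in cv.
rewrite leNgt; apply/negP => z0.
near \oo => n; have := bound n; rewrite leNgt => /negP; apply.
by near: n; exact: cvgr_lt cv _ z0.
Unshelve. all: by end_near. Qed.

(** This is [det_bordered_pullback] with the factor bounded by [factor_upper]. Both bordered
    determinants lie between C^-1 and C in absolute value, hence C^2; the exponent d + 1 is 2m +
    2. *)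
Lemma det_bound n : transversal Es C (k 0) x0 ->
  \det (P n) ^+ 2 <= C ^+ 2 * (d%:R * C ^+ 4 * lam ^+ n) ^+ d.+1.
Proof.
move=> tr; have [h [b [h0 E1 E2]]] := orbit_forms Cf Cf' fK fxi bk n.
have hu := factor_upper E1 tr.
have E := norm_det_eq (det_bordered_pullback h0 E1 E2).
have [_ /(_ _ (bk 0))[_ _ _ /andP[_ D0]]] := Ck 0.
have [_ /(_ _ (bk n))[_ _ _ /andP[Dn _]]] := Ck n.
have D1 : \det (P n) ^+ 2 * C^-1 <= (d%:R * C ^+ 4 * lam ^+ n) ^+ d.+1 * C.
  apply: le_trans (ler_wpM2l (sqr_ge0 _) Dn) _; rewrite E.
  apply: ler_pM (exprn_ge0 _ (normr_ge0 _)) (normr_ge0 _) _ D0.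
  have q0 : d%:R * C ^+ 4 * lam ^+ n \is Num.nneg.
    by rewrite nnegrE; exact: le_trans (normr_ge0 h) hu.
  have h1 : `|h| \is Num.nneg by rewrite nnegrE; exact: normr_ge0.
  exact: lerXn2r h1 q0 hu.
exact: div_mul_le C0 D1.
Qed.

End Growth.

(** * Uniform estimates *)

Section Uniform.
Variables (R : realType) (m : nat) (M : topologicalType).
Variable A : smooth_atlas R m.*2.+1 M.
Local Notation d := m.*2.+1.
Local Notation V := 'rV[R]_d.
Local Notation dom i := (chart_dom (s := A) i).
Variable xi : subspace_field R d M.
Local Notation piece := (contact_piece A xi).

Lemma isotropic_dim (E : {vspace V}) (i : chart_index A) x (a : 'cV[R]_d) (B : 'M[R]_d) :
  dom i x -> \det (bordered a B) != 0 -> (forall v, v \in E -> tcoord i x v *m a = 0) ->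
  (forall v w, v \in E -> w \in E -> (tcoord i x v *m B *m (tcoord i x w)^T) 0 0 = 0) ->
  (\dim E <= m)%N.
Proof.
move=> dx det0 ka kB.
pose X : 'M[R]_(\dim E, d) := \matrix_(k < \dim E) tcoord i x (vbasis E)`_k.
have bE (k : 'I_(\dim E)) : (vbasis E)`_k \in E.
  by apply: vbasis_mem; rewrite mem_nth// size_tuple.
have rX : row_free X.
  apply: inj_row_free => u uX.
  have w0 : \sum_(k < \dim E) u 0 k *: (vbasis E)`_k = 0.
    rewrite -[LHS](tcoordK _ dx).
    have -> : tcoord i x (\sum_(k < \dim E) u 0 k *: (vbasis E)`_k) = u *m X.
      rewrite mulmx_sum_row /tcoord linear_sum; apply: eq_bigr => k _.
      by rewrite rowK linearZ.
    by rewrite uX; have := tvecP i x (-1) 0 0; rewrite scaler0 addr0 scaleN1r addNr.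
  have /freeP/(_ _ w0) u0 := basis_free (vbasisP E).
  by apply/rowP => k; rewrite mxE u0.
have Xa : X *m a = 0.
  by apply/row_matrixP => k; rewrite row_mul rowK row0 ka.
have XB : X *m B *m X^T = 0.
  apply/matrixP => k l; rewrite [RHS]mxE.
  have -> : (X *m B *m X^T) k l = (row k X *m B *m (row l X)^T) 0 0.
    rewrite -row_mul [LHS]mxE [RHS]mxE; apply: eq_bigr => j _.
    by rewrite [row k _ 0 j]mxE [(row l X)^T j 0]mxE [row l X 0 j]mxE [X^T j l]mxE.
  by rewrite !rowK kB.
have := isotropic_rank det0 rX Xa XB; lia.
Qed.

(* compact_cover is only available for pointed spaces; the finite subcover comes
   from near_covering and the filter of large finite lists. *)
Lemma finite_pieces : compact [set: M] -> contact_structure A xi ->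
  exists p (q : 'I_p -> piece), forall x, exists i, core (q i) x.
Proof.
move=> cM hxi; have pcP x := exists_piece x hxi.
pose pc x := projT1 (cid (pcP x)).
have pcc x : core (pc x) x := projT2 (cid (pcP x)).
pose F : set_system (seq M) := fun P => exists s0 : seq M, forall s : seq M, {subset s0 <= s} -> P s.
have FF : Filter F.
  split.
  - by exists [::].
  - move=> P Q [s1 H1] [s2 H2]; exists (s1 ++ s2) => s s12; split.
      by apply: H1 => x xs; apply: s12; rewrite mem_cat xs.
    by apply: H2 => x xs; apply: s12; rewrite mem_cat xs orbT.
  - by move=> P Q PQ [s0 H]; exists s0 => s /H /PQ.
have := cM; move=> /compact_near_coveringP/(_ _ F (fun s x => exists2 y, y \in s & core (pc y) x) FF).
case.
- move=> x _; exists ([set x' | core (pc x) x'], [set s : seq M | x \in s]).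
    split=> /=; first exact: core_near.
    by exists [:: x] => s; apply; rewrite mem_head.
  by move=> [x' s] /= [cx xs]; exists x.
- move=> s0 H; exists (size s0), (fun i => pc (tnth (in_tuple s0) i)) => x.
  have [y ys cy] := H s0 (fun _ => id) x I.
  have yi : (index y s0 < size s0)%N by rewrite index_mem.
  by exists (Ordinal yi); rewrite (tnth_nth x) /= nth_index.
Qed.

End Uniform.

Lemma uniform_ord (R : realDomainType) p (P : 'I_p -> R -> Prop) :
  (forall i C C', C <= C' -> P i C -> P i C') -> (forall i, exists C, P i C) ->
  exists C, forall i, P i C.
Proof.
move=> mono /fin_all_exists[c cP]; exists (\sum_i `|c i|) => i.
apply: mono (cP i); rewrite (le_trans (ler_norm _))// (bigD1 i)//= lerDl.
by rewrite sumr_ge0.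
Qed.

Section Dynamics.
Variables (R : realType) (m : nat) (M : topologicalType).
Variable A : smooth_atlas R m.*2.+1 M.
Local Notation d := m.*2.+1.
Variable xi : subspace_field R d M.
Local Notation piece := (contact_piece A xi).
Variable g : continuous_metric A.
Variables (f f' : M -> M).
Hypotheses (Cf : C_map A 2 f) (Cf' : C_map A 2 f').
Hypothesis fK : cancel f f'.
Hypotheses (hxi : forall x, \dim (xi x) = m.*2) (fxi : preserves A f xi).
Variables (Es Eu : subspace_field R d M) (lam : R).
Hypotheses (cEs : continuous_subspace_field A Es) (cEu : continuous_subspace_field A Eu).
Hypothesis split : forall x, (Es x + Eu x)%VS = fullv /\ directv (Es x + Eu x).
Hypotheses (lam0 : 0 < lam) (lam1 : lam < 1).
Hypotheses (fEs : preserves A f Es) (fEu : preserves A f Eu).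
Hypothesis contr : forall x v, v \in Es x -> tnorm g (f x) (tmap A f x v) <= lam * tnorm g x v.
Hypothesis expa : forall x v, v \in Eu x -> tnorm g (f' x) (tmap A f' x v) <= lam * tnorm g x v.
Variables (p : nat) (q : 'I_p -> piece).
Hypothesis qcore : forall x, exists i, core (q i) x.

(** The set N of the overview. By [dim_split], Es has dimension at least m + 1 there, too large for
    an isotropic subspace of xi. *)
Definition thin x := (\dim (Eu x) <= m)%N.

Lemma dim_split x : (\dim (Es x) + \dim (Eu x))%N = d.
Proof.
have [full /directv_addP dir] := split x.
by rewrite -(dimv_disjoint_sum dir) full dimvf /dim /= mul1n.
Qed.

Lemma dim_image (E : subspace_field R d M) x : preserves A f E -> \dim (E (f x)) = \dim (E x).
Proof.
move=> fE; rewrite -fE; apply: limg_dim_eq; apply/eqP; rewrite -subv0; apply/subvP => v.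
rewrite memv_cap memv_ker {1}/tmap lfunE memv0 => /andP[_ /eqP v0].
rewrite -(tmap_cancel x v Cf Cf' fK) [tmap A f x v]v0.
by rewrite /tmap linear0.
Qed.

Lemma thin_image x : thin (f x) <-> thin x.
Proof. by rewrite /thin dim_image. Qed.

Lemma thin_iter n x : thin (iter n f x) <-> thin x.
Proof. by elim: n => [//|n IH] /=; rewrite thin_image. Qed.

Lemma near_thin x : thin x -> \forall x' \near x, thin x'.
Proof.
by move=> tx; apply: filterS (dim_locally_constant x cEu) => y; rewrite /thin => ->.
Qed.

Lemma near_not_thin x : ~ thin x -> \forall x' \near x, ~ thin x'.
Proof.
by move=> tx; apply: filterS (dim_locally_constant x cEu) => y; rewrite /thin => ->.
Qed.

Lemma transversalS (E : subspace_field R d M) C C' (b : piece) x : C <= C' ->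
  transversal E C b x -> transversal E C' b x.
Proof.
move=> CC' [v [vE v0 vC]]; exists v; split=> //.
by rewrite (le_trans vC)// ler_wpM2r.
Qed.

Lemma orbit_pieces x : exists k : nat -> 'I_p, forall n, core (q (k n)) (iter n f x).
Proof.
exists (fun n => projT1 (cid (qcore (iter n f x)))) => n.
exact: projT2 (cid (qcore (iter n f x))).
Qed.

Lemma Es_not_in_xi x : thin x -> exists2 v, v \in Es x & v \notin xi x.
Proof.
move=> tx; apply: contrapT => nex.
have not_sub (E : subspace_field R d M) y : ~~ (E y <= xi y)%VS ->
    exists2 v, v \in E y & v \notin xi y.
  move=> ns; apply: contrapT => ney; move/negP: ns; apply; apply/subvP => v vE.
  by apply/negPn/negP => nv; apply: ney; exists v.
have sub : (Es x <= xi x)%VS by apply/negPn/negP => /not_sub.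
(* Both fields are invariant, so the assumed inclusion propagates along the forward orbit and the
   constant found next is valid at all times. *)
have subn n : (Es (iter n f x) <= xi (iter n f x))%VS.
  apply/subvP => w /(tmap_iter_surj fEs)[v vE <-]; apply: tmap_iter_mem fxi _.
  exact: subvP sub _ vE.
have [||C2 H2] := @uniform_ord R p
  (fun i C => forall y, body (q i) y -> (Es y <= xi y)%VS -> transversal Eu C (q i) y).
- by move=> i C C' CC' H y bx ty; apply: transversalS CC' (H y bx ty).
(* Where Es lies in xi, Eu does not, since together they span. Elsewhere a vector of Es lies outside
   xi, and this persists nearby. *)
- move=> i; apply: uniform_transversal cEu _ => y by0.
  have [suby|/not_sub[v vE vxi]] := boolP (Es y <= xi y)%VS; [left|right].
    apply: not_sub; apply/negP => sub'; have [full _] := split y.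
    have : (fullv <= xi y)%VS by rewrite -full subv_add suby.
    by move=> /dimvS; rewrite hxi dimvf /dim /= mul1n ltnn.
  have [C nC] := transversal_local cEs by0 vE vxi.
  apply: filterS nC => z [w [wE w0 wC]] bz /subvP/(_ _ wE) wxi.
  have wk := iffLR (pform_ker bz.1 (body_open bz) _) wxi.
  by move: wC; rewrite [pairing _ _]wk normr0 mulr0 leNgt w0.
have [C1 H1] := uniform_ord (fun i C C' => @bounded_geometryS _ _ _ _ _ g C C' (q i)) (fun i => exists_bounded_geometry g (q i)).
have [k kc] := orbit_pieces x.
pose k' n := q (k n).
have bk n : body (k' n) (iter n f x) by exact: core_body (kc n).
pose C := `|C1| + `|C2|.
have gC n : bounded_geometry g C (k' n).
  by apply: bounded_geometryS (H1 _); rewrite (le_trans (ler_norm _))// lerDl.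
have tC n : transversal Eu C (k' n) (iter n f x).
  by apply: transversalS (H2 _ _ (bk n) (subn n)); rewrite (le_trans (ler_norm _))// lerDr.
have iso v w : v \in Es x -> w \in Es x ->
    (tcoord (pchart (k' 0%N)) x v *m pdform_at (k' 0%N) x *m (tcoord (pchart (k' 0%N)) x w)^T) 0 0 = 0.
  move=> vE wE.
  exact: (stable_isotropic Cf Cf' fK fxi lam0 fEs fEu contr expa bk gC lam1 tC sub vE wE).
have kera v : v \in Es x -> tcoord (pchart (k' 0%N)) x v *m pform_at (k' 0%N) x = 0.
  move=> /(subvP sub) vxi; apply/matrixP => i j; rewrite !ord1 [RHS]mxE.
  exact/(pform_ker (bk 0%N).1 (body_open (bk 0%N))).
have := isotropic_dim (bk 0%N).1 (pform_nondeg (body_open (bk 0%N))) kera iso.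
by have := dim_split x; move: tx; rewrite /thin; lia.
Qed.

Lemma uniform_constant : exists C, (forall i, bounded_geometry g C (q i)) /\
  forall i x, body (q i) x -> thin x -> transversal Es C (q i) x.
Proof.
have [C1 H1] := uniform_ord (fun i C C' => @bounded_geometryS _ _ _ _ _ g C C' (q i)) (fun i => exists_bounded_geometry g (q i)).
have [||C2 H2] := @uniform_ord R p
  (fun i C => forall x, body (q i) x -> thin x -> transversal Es C (q i) x).
- by move=> i C C' CC' H x bx tx; apply: transversalS CC' (H x bx tx).
- move=> i; apply: uniform_transversal cEs _ => x0 bx0.
  have [tx|ntx] := boolP (\dim (Eu x0) <= m)%N; first by left; exact: Es_not_in_xi.
  right; have : ~ thin x0 by apply/negP.
  by move=> /near_not_thin; apply: filterS => x nt _.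
exists (`|C1| + `|C2|); split=> [i|i x bx tx].
  by apply: bounded_geometryS (H1 i); rewrite (le_trans (ler_norm _))// lerDl.
by apply: transversalS (H2 i x bx tx); rewrite (le_trans (ler_norm _))// lerDr.
Qed.

(** One n serves for every thin point and every choice of pieces along its orbit, so that the same
    iterate can be applied to all of N. With n positive, the last piece can still be chosen when the
    first is prescribed. *)
Lemma det_small (delta : R) : 0 < delta -> exists2 n, (0 < n)%N &
  forall x (k : nat -> 'I_p), thin x -> (forall j, body (q (k j)) (iter j f x)) ->
  `|\det (jprod f x (fun j => q (k j)) n)| < delta.
Proof.
move=> delta0; have [C [gC tC]] := uniform_constant.
pose K := d%:R * C ^+ 4.
have cv : (fun n => K * lam ^+ n) @ \oo --> (0 : R).
  rewrite -[0](mulr0 K); apply: cvgM; first exact: cvg_cst.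
  by apply: cvg_expr; rewrite gtr0_norm.
(* For y = K lam^n < 1 the squared determinant is at most C^2 y, and this bound on y puts it below
   delta^2. *)
have e0 : 0 < delta ^+ 2 / (C ^+ 2 + 1) by rewrite divr_gt0 ?exprn_gt0// ltr_wpDl// sqr_ge0.
have K0 : 0 <= K by rewrite mulr_ge0// (_ : C ^+ 4 = (C ^+ 2) ^+ 2) ?sqr_ge0// -exprM.
near \oo => n.
have y1 : K * lam ^+ n < 1 by near: n; exact: cvgr_lt cv _ ltr01.
have y2 : K * lam ^+ n < delta ^+ 2 / (C ^+ 2 + 1).
  by near: n; exact: cvgr_lt cv _ e0.
exists n; first by near: n; exact: nbhs_infty_gt.
move=> x k tx bk.
have kb j : bounded_geometry g C (q (k j)) by exact: gC.
have tr : transversal Es C (q (k 0%N)) x by apply: tC => //; exact: (bk 0%N).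
have := det_bound Cf Cf' fK fxi lam0 fEs contr bk kb n tr.
rewrite -/K; set D := \det _; set y := K * lam ^+ n => Db.
have y0 : 0 <= y by rewrite mulr_ge0// exprn_ge0// ltW.
rewrite -/y in y1 y2.
have C20 : 0 <= C ^+ 2 by exact: sqr_ge0.
have yd : y ^+ d.+1 <= y by rewrite exprS ler_piMr// exprn_ile1// ltW.
rewrite -(@ltr_pXn2r _ 2) ?nnegrE ?(ltW delta0)// real_normK ?num_real//.
apply: le_lt_trans Db _; apply: le_lt_trans (ler_wpM2l C20 yd) _.
move: y2; rewrite ltr_pdivlMr ?ltr_wpDl// mulrDr mulr1; apply: le_lt_trans.
by rewrite mulrC lerDl.
Unshelve. all: by end_near. Qed.

End Dynamics.

(** * Volume *)

Section Volume.
Variables (R : realType) (m : nat) (M : topologicalType).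
Variable A : smooth_atlas R m.*2.+1 M.
Local Notation d := m.*2.+1.
Local Notation V := 'rV[R]_d.
Local Notation dom i := (chart_dom (s := A) i).
Local Notation ch i := (chart (s := A) i).
Local Notation inv i := (chart_inv (s := A) i).
Variable xi : subspace_field R d M.
Local Notation piece := (contact_piece A xi).
Variables (f f' : M -> M).
Hypotheses (Cf : C_map A 2 f) (f'K : cancel f' f).
Variable N : M -> Prop.
Hypothesis nearN : forall x, N x -> \forall x' \near x, N x'.
Hypothesis nearNN : forall x, ~ N x -> \forall x' \near x, ~ N x'.
Hypothesis Niter : forall n x, N (iter n f x) <-> N x.
Variables (p : nat) (q : 'I_p -> piece).
Hypothesis qcore : forall x, exists i, core (q i) x.
Hypothesis haus : hausdorff_space M.

Local Notation cube := ('I_p * (V * R))%type.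
(** A cube is a piece index with a centre and a radius in the coordinates of that piece; the centre
    need not come from a point of the piece. *)
Definition in_cube (b : cube) x := body (q b.1) x /\ `|pcoord (q b.1) x - b.2.1| <= b.2.2.
Definition covers (l : seq cube) (S : M -> Prop) :=
  (forall b, b \in l -> 0 < b.2.2) /\ forall x, S x -> exists2 b, b \in l & in_cube b x.
Definition vol (l : seq cube) : R := \sum_(b <- l) b.2.2 ^+ d.

Lemma union_cover (I : finType) (S : I -> M -> Prop) (v : I -> R) :
  (forall i, exists l, covers l (S i) /\ vol l <= v i) ->
  exists l, covers l (fun y => exists i, S i y) /\ vol l <= \sum_i v i.
Proof.
move=> /fin_all_exists[L LP]; exists (flatten [seq L i | i <- enum I]); split; first split.
- by move=> b /flatten_mapP[i _ bi]; have [[H _] _] := LP i; exact: H.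
- move=> x [i Si]; have [[_ H] _] := LP i; have [b bl bx] := H x Si.
  by exists b => //; apply/flatten_mapP; exists i => //; rewrite mem_enum.
- rewrite /vol big_flatten big_map -big_enum; apply: ler_sum => i _.
  by have [_] := LP i.
Qed.

Definition image_of n (i : 'I_p) (z : V) rho y :=
  exists x', [/\ N x', in_cube (i, (z, rho)) x' & y = iter n f x'].

(** The factor lost in [linear_image_cover]; it depends on the dimension only. *)
Let K : R := (d.+1 * d)%:R ^+ d.

(* A small cube is mapped by f^n close to the image of a cube under a linear map
   of determinant less than delta. *)
Lemma image_cover n delta i : (0 < n)%N -> 0 < delta ->
  (forall x (k : nat -> 'I_p), N x -> (forall j, body (q (k j)) (iter j f x)) ->
    `|\det (jprod f x (fun j => q (k j)) n)| < delta) ->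
  exists2 rho0, 0 < rho0 & forall x, body (q i) x -> forall rho, 0 < rho <= rho0 ->
    exists l, covers l (image_of n i (pcoord (q i) x) rho) /\ vol l <= K * delta * rho ^+ d.
Proof.
move=> n0 delta0 Hdet.
(* The smallness of rho is expressed through C^-1, which makes the property monotone in C. *)
pose Q C x := 0 < C /\ forall rho, 0 < rho <= C^-1 ->
    exists l, covers l (image_of n i (pcoord (q i) x) rho) /\ vol l <= K * delta * rho ^+ d.
suff [C CP] : exists C, forall x, body (q i) x -> Q C x.
  have C0 : 0 < Num.max C 1 by rewrite lt_max ltr01 orbT.
  exists (Num.max C 1)^-1; first by rewrite invr_gt0.
  move=> x /CP[C1 H] rho /andP[r0 rC]; apply: H; rewrite r0 (le_trans rC)//.
  by rewrite lef_pV2 ?posrE// le_max lexx.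
apply: (compact_uniform (P := Q) (@compact_body _ _ _ _ _ (q i))).
  move=> C C' x CC' [C0 H]; have C'0 := lt_le_trans C0 CC'; split=> // rho /andP[r0 rC].
  by apply: H; rewrite r0 (le_trans rC)// lef_pV2.
move=> x0 bx0; have [dx0 _] := bx0; set z0 := pcoord (q i) x0.
have loc (t : R) : 0 < t ->
    (forall x, body (q i) x -> `|pcoord (q i) x - z0| < t / 2 -> forall rho, 0 < rho <= t / 2 ->
      exists l, covers l (image_of n i (pcoord (q i) x) rho) /\ vol l <= K * delta * rho ^+ d) ->
    exists C, \forall x \near x0, body (q i) x -> Q C x.
  move=> t0 H; have t20 : 0 < t / 2 by rewrite divr_gt0.
  exists (t / 2)^-1.
  have nz : \forall z \near ch (pchart (q i)) x0, `|z - z0| < t / 2.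
    apply/nbhs_ballP; exists (t / 2) => //= z.
    by rewrite -ball_normE /ball_/= distrC.
  apply: filterS (near_chart dx0 nz) => x xz bx; split; first by rewrite invr_gt0.
  by rewrite invrK => rho rt; exact: H.
have inball (t rho : R) (z z' : V) : `|z - z0| < t / 2 -> rho <= t / 2 -> `|z' - z| <= rho -> `|z' - z0| < t.
  move=> H1 H2 H3; rewrite -(subrKA z z' (- z0)) (le_lt_trans (ler_normD _ _))// [t]splitr.
  by rewrite ler_ltD// (le_trans H3).
(* Near a point outside N there are no points of N, so the set to be covered is empty and so is the
   cover. *)
have [Nx0|nNx0] := pselect (N x0); last first.
  have [t t0 tP] := near_ball (near_chart_inv dx0 (nearNN nNx0)).
  apply: (loc t t0) => x bx xz rho /andP[r0 rt]; exists [::]; split; last first.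
    by rewrite /vol big_nil !mulr_ge0 ?exprn_ge0 ?ler0n ?(ltW delta0) ?(ltW r0).
  split=> // y [x' [Nx' [[dx' _] /= x'z] _]].
  have [_ _] := tP _ (inball _ _ _ _ xz rt x'z).
  by rewrite chartK.
have [kap kapP] : exists kap : nat -> 'I_p, forall j, core (q (kap j)) (iter j f x0).
  exists (fun j => projT1 (cid (qcore (iter j f x0)))) => j.
  exact: projT2 (cid (qcore (iter j f x0))).
(* The first piece is the prescribed [i], with x0 merely in its body. The later ones have the orbit
   in their cores, so, n being positive, nearby points still land in the body of the last piece. *)
pose k j := if j is 0 then i else kap j.
have bk j : body (q (k j)) (iter j f x0) by case: j => [|j] //; exact: core_body (kapP j.+1).
have det_lt := Hdet x0 k Nx0 bk.
have sd := jprod_strict_diff Cf bk n.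
set F := local_rep _ _ _ in sd; set P := jprod _ _ _ _ in sd det_lt.
have [eta eta0 etaP] := linear_image_cover det_lt.
have [t1 t10 t1P] := sd eta eta0.
have cn : core (q (k n)) (iter n f x0) by case: (n) n0 => // n' _; exact: kapP.
have nbody : \forall x \near x0, body (q (k n)) (iter n f x).
  have : \forall y \near iter n f x0, body (q (k n)) y.
    by apply: filterS (core_near cn) => y; exact: core_body.
  by move=> nb; apply: (iter_continuous Cf nb).
have [t2 t20 t2P] := near_ball (near_chart_inv dx0 nbody).
apply: (loc (Num.min t1 t2)); first by rewrite lt_min t10.
move=> x bx xz rho /andP[r0 rt].
have [l [sg [sg0 lP lvol]]] := etaP rho r0.
(* The increment of coordinates from x to x' goes through [P], up to the remainder in [sd], which is
   the error [e] tolerated by [linear_image_cover]. *)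
exists [seq (k n, (F (pcoord (q i) x) + c, sg)) | c <- l]; split; last first.
  by rewrite /vol big_map /= big_const_seq count_predT iter_addr_0 -mulr_natl.
split; first by move=> b /mapP[c _ ->].
move=> y [x' [Nx' [bx' /= x'z] ->]]; have [dx' _] := bx'.
have rmin : rho <= t1 / 2 /\ rho <= t2 / 2.
  move: rt; rewrite !ler_pdivlMr// le_min => /andP[]; split=> //.
have [xz1 xz2] : `|pcoord (q i) x - z0| < t1 / 2 /\ `|pcoord (q i) x - z0| < t2 / 2.
  by move: xz; rewrite !ltr_pdivlMr// lt_min => /andP[].
have z'1 := inball _ _ _ _ xz1 rmin.1 x'z; have z'2 := inball _ _ _ _ xz2 rmin.2 x'z.
have z1 : `|pcoord (q i) x - z0| < t1.
  by rewrite (lt_trans xz1)// ltr_pdivrMr// ltr_pMr// ltr1n.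
have [_ _] := t2P _ z'2; rewrite chartK// => bn.
have Fx' : F (pcoord (q i) x') = pcoord (q (k n)) (iter n f x').
  by rewrite /F /local_rep /= chartK.
have [c cl cE] := lP _ _ x'z (le_trans (t1P _ _ z'1 z1) (ler_wpM2l (ltW eta0) x'z)).
exists (k n, (F (pcoord (q i) x) + c, sg)); first by apply/mapP; exists c.
split=> //=; rewrite -Fx'; move: cE; set w := (_ *m _).
by rewrite [w + _]addrC subrK opprD addrA.
Qed.

(** The cube of the piece is cut into T^d equal cubes of radius r / T <= rho0. The d-th powers of
    their radii add up to r^d exactly, so the fine scale that n imposes costs nothing. *)
Lemma body_cover n delta i : (0 < n)%N -> 0 < delta ->
  (forall x (k : nat -> 'I_p), N x -> (forall j, body (q (k j)) (iter j f x)) ->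
    `|\det (jprod f x (fun j => q (k j)) n)| < delta) ->
  exists l, covers l (fun y => exists x, [/\ N x, body (q i) x & y = iter n f x]) /\
    vol l <= K * delta * pradius (q i) ^+ d.
Proof.
move=> n0 delta0 Hdet; have [rho0 rho00 H] := image_cover i n0 delta0 Hdet.
set r := pradius (q i); have r0 : 0 < r := pradius_gt0 (q i).
pose T := (Num.truncn (r / rho0)).+1.
have T0 : 0 < T%:R :> R by rewrite ltr0n.
pose rho := r / T%:R; have rhop : 0 < rho by rewrite divr_gt0.
have Trho : T%:R * rho = r by rewrite mulrC divfK ?gt_eqF.
have rho_le : rho <= rho0.
  rewrite ler_pdivrMr// -ler_pdivrMl// mulrC.
  by have /andP[_ /ltW] := truncn_itv (divr_ge0 (ltW r0) (ltW rho00)).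
pose G := {dffun forall j : 'I_d, 'I_T}.
pose z (t : G) : V := pcenter (q i) + grid_point rho t.
have zb t : `|z t - pcenter (q i)| <= r.
  rewrite /z addrC addKr; apply/rV_norm_leP => [|j]; first exact: ltW.
  rewrite mxE normrM (gtr0_norm rhop) -Trho ler_wpM2r ?(ltW rhop)//.
  have : (t j).+1%:R <= T%:R :> R by rewrite ler_nat.
  rewrite -natr1 ler_norml => tT; have t0 : 0 <= (t j)%:R :> R by rewrite ler0n.
  by apply/andP; split; lra.
have zx t : exists2 x, body (q i) x & pcoord (q i) x = z t.
  have [dz zE] := chart_invP (popen_sub (pball_sub (zb t))).
  by exists (inv (pchart (q i)) (z t)) => //; split=> //; rewrite zE.
have [t|l [lc lv]] := @union_cover G (fun t => image_of n i (z t) rho)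
    (fun=> K * delta * rho ^+ d).
  by have [x bx <-] := zx t; apply: H => //; rewrite rhop.
exists l; split; last first.
  apply: le_trans lv _; rewrite sumr_const card_grid prod_nat_const card_ord -[leLHS]mulr_natl.
  by rewrite natrX mulrCA -exprMn Trho.
split; first exact: lc.1.
move=> y [x [Nx bx ->]]; apply: lc.2.
have [|//||t tP] := @box_grid R d (fun=> T) rho (pcoord (q i) x - pcenter (q i)).
- by [].
- by move=> j; rewrite Trho; apply: le_trans (rV_coord_le _ _) _; exact: bx.2.
exists t, x; split=> //; split=> //=.
by rewrite /z opprD addrA.
Qed.

(** Since f^n maps N onto N, the images of the parts of N in the bodies cover N; preimages are
    supplied by the iterates of f'. *)
Lemma total_cover n delta : (0 < n)%N -> 0 < delta ->
  (forall x (k : nat -> 'I_p), N x -> (forall j, body (q (k j)) (iter j f x)) ->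
    `|\det (jprod f x (fun j => q (k j)) n)| < delta) ->
  exists l, covers l N /\ vol l <= K * delta * \sum_i pradius (q i) ^+ d.
Proof.
move=> n0 delta0 Hdet.
have [i|l [lc lv]] := @union_cover 'I_p
    (fun i y => exists x, [/\ N x, body (q i) x & y = iter n f x])
    (fun i => K * delta * pradius (q i) ^+ d).
  exact: (body_cover i n0 delta0 Hdet).
exists l; split; last by rewrite mulr_sumr.
split; first exact: lc.1.
have iterK y : iter n f (iter n f' y) = y.
  by elim: (n) => [//|j IH]; rewrite iterSr /= f'K IH.
move=> y Ny; apply: lc.2; have [i ci] := qcore (iter n f' y).
exists i, (iter n f' y); split; [|exact: core_body|by rewrite iterK].
by apply/(Niter n); rewrite iterK.
Qed.

(** A small compact cube S of N in one chart is compared with the cubes of a cover, which live in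
    all the charts. A cube of radius at least L^-1 / 2 is enough by itself. The part in S of a
    smaller one lies, through a Lipschitz change of chart, in a cube of the chart of S with radius 2
    L times its own; if all are small, [cube_cover_lower_bound] applies. *)
Lemma volume_lower_bound x1 : N x1 ->
  exists2 c, 0 < c & forall l, covers l N -> c <= vol l.
Proof.
move=> Nx1; have [i1 ci1] := qcore x1; have [dx1 _] := ci1.
set ch1 := pcoord (q i1); set y1 := ch1 x1.
have [t t0 tP] := near_ball (near_chart_inv dx1 (near_and (nearN Nx1) (core_near ci1))).
pose r := t / 2; have r0 : 0 < r by rewrite divr_gt0.
have rt z : `|z - y1| <= r -> `|z - y1| < t.
  by move=> /le_lt_trans; apply; rewrite ltr_pdivrMr// ltr_pMr// ltr1n.
pose S : set M := inv (pchart (q i1)) @` [set z | `|z - y1| <= r].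
have SP x : S x -> [/\ dom (pchart (q i1)) x, N x & `|ch1 x - y1| <= r].
  by move=> [z /= zr <-]; have [dz zE [Nz cz]] := tP _ (rt _ zr); split=> //; rewrite /ch1 /pcoord zE.
(* Closedness, which uses that M is Hausdorff, gives each point outside S a neighbourhood missing S,
   where the Lipschitz property below is vacuous. *)
have clS : closed S.
  apply: compact_closed => //; apply: continuous_compact; last exact: compact_ball.
  apply: continuous_in_subspaceT => z; rewrite inE /= => zr.
  have [dz zE _] := tP _ (rt _ zr).
  by apply: chart_inv_continuous; exists (inv (pchart (q i1)) z).
(* [L] is both the Lipschitz constant and the inverse of the scale at which it holds, so that [Q] is
   monotone in [L]. *)
pose Q i L x := 0 < L /\ forall x', body (q i) x' ->
  `|pcoord (q i) x' - pcoord (q i) x| <= L^-1 -> S x -> S x' ->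
  `|ch1 x' - ch1 x| <= L * `|pcoord (q i) x' - pcoord (q i) x|.
have QS i L L' x : L <= L' -> Q i L x -> Q i L' x.
  move=> LL' [L0 H]; have L'0 := lt_le_trans L0 LL'; split=> // x' bx' x'L Sx Sx'.
  rewrite (le_trans (H x' bx' _ Sx Sx'))//; last by rewrite ler_wpM2r.
  by rewrite (le_trans x'L)// lef_pV2.
have [||L LP] := @uniform_ord R p (fun i L => forall x, body (q i) x -> Q i L x).
- by move=> i C C' CC' H x bx; apply: QS CC' (H x bx).
- move=> i; apply: (compact_uniform (P := Q i) (@compact_body _ _ _ _ _ (q i))).
    by move=> C C' x; exact: QS.
  move=> x0 bx0; have [dx0 _] := bx0.
  have [Sx0|nSx0] := pselect (S x0); last first.
    have nS : \forall x \near x0, ~ S x.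
      by apply: open_nbhs_nbhs; split=> //; exact: closed_openC.
    by exists 1; apply: filterS nS => x nSx _; split.
  have [d1x0 _ _] := SP _ Sx0.
  have [U [oU Ux] CU] := local_rep_domain (C_map_id A 1) dx0 d1x0.
  have [c c0 [s s0 sP]] := strict_diff_lipschitz (C1_strict_diff oU Ux CU).
  have s20 : 0 < s / 2 by rewrite divr_gt0.
  exists (Num.max c (s / 2)^-1).
  have nz : \forall z \near ch (pchart (q i)) x0, `|z - pcoord (q i) x0| < s / 2.
    apply/nbhs_ballP; exists (s / 2) => //= z.
    by rewrite -ball_normE /ball_/= distrC.
  apply: filterS (near_chart dx0 nz) => x xz bx; split; first by rewrite lt_max c0.
  move=> x' bx' x'x Sx Sx'.
  have x's : `|pcoord (q i) x' - pcoord (q i) x| <= s / 2.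
    rewrite (le_trans x'x)// -[leRHS]invrK lef_pV2 ?posrE ?invr_gt0 ?lt_max ?c0//.
    by rewrite le_max lexx orbT.
  have E z : S z -> body (q i) z -> ch1 z = local_rep (A := A) idfun (pchart (q i)) (pchart (q i1)) (pcoord (q i) z).
    by move=> _ [dz _]; rewrite /local_rep /= chartK.
  rewrite !E// (le_trans (sP _ _ _ _))//.
  - rewrite -(subrKA (pcoord (q i) x)) (le_lt_trans (ler_normD _ _))// [s]splitr.
    by rewrite ler_ltD.
  - by rewrite (lt_trans xz)// ltr_pdivrMr// ltr_pMr// ltr1n.
  - by rewrite ler_wpM2r// le_max lexx.
have [i0 b0] : exists i, body (q i) x1 by exists i1; exact: core_body.
have L0 : 0 < L by have [] := LP i0 x1 b0.
exists (Num.min ((L^-1 / 2) ^+ d) (r ^+ d / (3 ^+ d * (2 * L) ^+ d))).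
  by rewrite lt_min exprn_gt0 ?divr_gt0 ?invr_gt0 ?mulr_gt0 ?exprn_gt0// mulr_gt0.
move=> l [lpos lc].
have [[b bl bL]|small] := pselect (exists2 b, b \in l & L^-1 / 2 <= b.2.2).
  rewrite ge_min; apply/orP; left.
  apply: le_trans (_ : b.2.2 ^+ d <= _).
    by apply: lerXn2r; rewrite ?nnegrE ?divr_ge0 ?invr_ge0 ?(ltW L0)// ltW// lpos.
  rewrite /vol (big_rem b)//= lerDl big_seq sumr_ge0// => b' /mem_rem b'l.
  by rewrite exprn_ge0// ltW// lpos.
have {}small b : b \in l -> b.2.2 < L^-1 / 2.
  by move=> bl; rewrite ltNge; apply/negP => bL; apply: small; exists b.
rewrite ge_min; apply/orP; right.
(* A cube meeting S is recentred at one of its points in S; two of its points are at most twice its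
   radius apart, whence the 2 in 2 L. The value [y1] for the other cubes is arbitrary. *)
pose center (b : cube) : V := match pselect (exists x, S x /\ in_cube b x) with
  | left ex => ch1 (projT1 (cid ex)) | right _ => y1 end.
have := @cube_cover_lower_bound R d r y1 [seq (center b, 2 * L * b.2.2) | b <- l] r0.
rewrite big_map /= => /(_ _ _) H.
rewrite ler_pdivrMr; last by rewrite mulr_gt0 ?exprn_gt0 ?mulr_gt0.
apply: le_trans (H _ _) _; last first.
- rewrite [leRHS]mulrC -[leRHS]mulrA ler_pM2l ?exprn_gt0// /vol mulr_sumr ler_sum// => b _.
  by rewrite -exprMn.
- move=> w wr; have [dw wE [Nw _]] := tP _ (rt _ wr).
  set x := inv _ w in dw wE Nw; have Sx : S x by exists w.
  have [b bl bx] := lc x Nw; exists (center b, 2 * L * b.2.2).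
    by apply/mapP; exists b.
  rewrite /= /center; case: pselect => [ex|[]]; last by exists x.
  case: cid => x' [Sx' [bx' x'b]] /=; have [bx1 xb] := bx.
  have [_ LPx] := LP b.1 x' bx'.
  have xx' : `|pcoord (q b.1) x - pcoord (q b.1) x'| <= 2 * b.2.2.
    rewrite -(subrKA b.2.1) (le_trans (ler_normD _ _))// [X in _ + X]distrC.
    by rewrite mulr_natl mulr2n lerD.
  have := LPx x bx1 _ Sx' Sx; rewrite {1}/ch1 /pcoord wE -/ch1 => /(_ _)/le_trans; apply.
    by rewrite (le_trans xx')// -ler_pdivlMl// mulrC ltW// small.
  by rewrite -[leRHS]mulrA [leRHS]mulrCA ler_pM2l.
- by move=> b /mapP[b' b'l ->] /=; rewrite !mulr_gt0// lpos.
Qed.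

(** The total factor [W] depends neither on delta nor on n. For delta = c / (W + 1) the cover of N
    has volume at most W c / (W + 1) < c, against the lower bound c. *)
Lemma no_volume_contraction x1 : N x1 ->
  (forall delta : R, 0 < delta -> exists2 n, (0 < n)%N &
    forall x (k : nat -> 'I_p), N x -> (forall j, body (q (k j)) (iter j f x)) ->
      `|\det (jprod f x (fun j => q (k j)) n)| < delta) -> False.
Proof.
move=> Nx1 H; have [c c0 cP] := volume_lower_bound Nx1.
pose W := K * \sum_i pradius (q i) ^+ d.
have W0 : 0 <= W.
  rewrite mulr_ge0 ?exprn_ge0 ?ler0n// sumr_ge0// => i _.
  by rewrite exprn_ge0// ltW// pradius_gt0.
have W1 : 0 < W + 1 by rewrite ltr_wpDl.
have [n n0 Hn] := H (c / (W + 1)) (divr_gt0 c0 W1).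
have [l [lN lv]] := total_cover n0 (divr_gt0 c0 W1) Hn.
have := le_trans (cP l lN) lv; apply/negP; rewrite -ltNge.
rewrite mulrAC -/W mulrA ltr_pdivrMr// mulrC mulrDr mulr1.
by rewrite ltrDl.
Qed.

End Volume.

Lemma preserves_inv (R : realType) n (M : topologicalType) (A : smooth_atlas R n M)
    (f f' : M -> M) (E : subspace_field R n M) :
  C_map A 2 f -> C_map A 2 f' -> cancel f f' -> cancel f' f ->
  preserves A f E -> preserves A f' E.
Proof.
move=> Cf Cf' fK f'K fE x.
have lf y : linfun (tmap A f y) =1 tmap A f y by move=> v; rewrite {1}/tmap lfunE.
have lf' y : linfun (tmap A f' y) =1 tmap A f' y by move=> v; rewrite {1}/tmap lfunE.
have cancel_v v : tmap A f' x (tmap A f (f' x) v) = v.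
  by have := tmap_cancel (f' x) v Cf Cf' fK; rewrite f'K.
have Ex : (linfun (tmap A f (f' x)) @: E (f' x))%VS = E x by rewrite fE f'K.
apply/vspaceP => v; apply/idP/idP => [/memv_imgP[w wE ->]|vE].
  by move: wE; rewrite lf' -Ex => /memv_imgP[u uE ->]; rewrite lf cancel_v.
rewrite -(cancel_v v) -lf'; apply: memv_img; rewrite -lf -Ex; exact: memv_img.
Qed.

Lemma thin_unstable_absurd (R : realType) (m : nat) (M : topologicalType)
    (A : smooth_atlas R m.*2.+1 M) (f f' : M -> M) (xi Es Eu : subspace_field R m.*2.+1 M)
    (g : continuous_metric A) (lam : R) x1 :
  closed_manifold A -> C_map A 2 f -> C_map A 2 f' -> cancel f f' -> cancel f' f ->
  contact_structure A xi -> preserves A f xi ->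
  continuous_subspace_field A Es -> continuous_subspace_field A Eu ->
  (forall x, (Es x + Eu x)%VS = fullv /\ directv (Es x + Eu x)) ->
  preserves A f Es -> preserves A f Eu -> 0 < lam < 1 ->
  (forall x v, v \in Es x -> tnorm g (f x) (tmap A f x v) <= lam * tnorm g x v) ->
  (forall x v, v \in Eu x -> tnorm g (f' x) (tmap A f' x v) <= lam * tnorm g x v) ->
  (\dim (Eu x1) <= m)%N -> False.
Proof.
move=> [_ cM hM] Cf Cf' fK f'K hxi fxi cEs cEu split fEs fEu /andP[l0 l1] contr expa tx1.
have [p [q qcore]] := finite_pieces cM hxi.
apply: (@no_volume_contraction _ _ _ _ _ f f' Cf f'K (thin Eu) _ _ _ p q qcore hM x1 tx1).
- exact: near_thin.
- exact: near_not_thin.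
- exact: (thin_iter Cf Cf' fK fEu).
- exact: (det_small Cf Cf' fK hxi.1 fxi cEs cEu split l0 l1 fEs fEu contr expa qcore).
Qed.

Theorem theorem1p1 (R : realType) (m : nat) (M : topologicalType)
    (A : smooth_atlas R m.*2.+1 M) (hM : closed_manifold A)
    (f : diffeo A 2) (hf : Anosov f) :
  ~ exists xi : subspace_field R m.*2.+1 M,
      contact_structure A xi /\ preserves A f xi.
Proof.
move=> [xi [hxi fxi]].
have [Es [Eu [g [lam [[cEs cEu] split [fEs fEu] lam01 [contr expa]]]]]] := hf.
have [[x1 _] _ _] := hM.
have Cf := diffeo_C f; have Cf' := diffeo_inv_C f.
have fK := diffeoK f; have f'K := diffeo_invK f.
have [tx1|ux1] := leqP (\dim (Eu x1)) m.
  exact: (thin_unstable_absurd hM Cf Cf' fK f'K hxi fxi cEs cEu split fEs fEu lam01 contr expa tx1).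
have split' x : (Eu x + Es x)%VS = fullv /\ directv (Eu x + Es x).
  have [full /directv_addP dir] := split x; split; first by rewrite addvC.
  by apply/directv_addP; rewrite capvC.
have inv E := @preserves_inv _ _ _ _ _ _ E Cf Cf' fK f'K.
have tx1 : (\dim (Es x1) <= m)%N.
  by have := dim_split split x1; lia.
exact: (thin_unstable_absurd hM Cf' Cf f'K fK hxi (inv _ fxi) cEu cEs split'
  (inv _ fEu) (inv _ fEs) lam01 expa contr tx1).
Qed.
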